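(* Let $G_{1/2,1/2,1}(x,t)$ be the Green function of the one-dimensional space-time fractional diffusion equation $\mathbb{D}_t^{1/2}u(x,t)=-(-\Delta)^{1/2}u(x,t)$, $t>0$, $x\in\mathbb{R}$, $u(x,0)=v(x)$. Then for all $x\in\mathbb{R}$, $x\ne 0$, and $t>0$ $$G_{1/2,1/2,1}(x,t)=\frac{1}{2\pi^{3/2}\sqrt t}\,e^{x^2/4t}\,\mathbb{E}_1\left(\frac{x^2}{4t}\right),\qquad \mathbb{E}_1(z)=\int_z^\infty\frac{e^{-\xi}}{\xi}\,d\xi.$$ Moreover, $$G_{1/2,1/2,1}(x,t)\approx\frac{2\sqrt t}{\pi^{3/2}x^2}\quad\text{as }\frac{x^2}{4t}\to\infty,\qquad G_{1/2,1/2,1}(x,t)\approx\frac{\ln 4t-\ln x^2}{2\pi^{3/2}\sqrt t}\quad\text{as }\frac{x^2}{4t}\to 0,$$ and for all $x\in\mathbb{R}$, $x\neq0$, and $t>0$ $$\frac{1}{4\pi^{3/2}\sqrt t}\ln\left(1+\frac{8t}{x^2}\right)<G_{1/2,1/2,1}(x,t)<\frac{1}{2\pi^{3/2}\sqrt t}\ln\left(1+\frac{4t}{x^2}\right).$$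
   Context: Here $\approx$ means that the ratio of the two sides tends to $1$ in the indicated limit. $X$ is one of the spaces $L^p(\mathbb{R})$, $1<p<\infty$, or $C_0(\mathbb{R})$ (continuous functions vanishing at infinity), and $A=-\Delta=-d^2/dx^2$ on $X$ with maximal domain; $-A$ generates the Gaussian semigroup with kernel $(4\pi t)^{-1/2}e^{-x^2/4t}$. $(-\Delta)^{1/2}$ is the Balakrishnan fractional power, given on $D(A)$ by $A^{1/2}v=\frac1\pi\int_0^\infty\lambda^{-1/2}(\lambda+A)^{-1}Av\,d\lambda$ and extended to its closure. The Caputo derivative is $\mathbb{D}_t^{1/2}u(t)=\frac{1}{\Gamma(1/2)}\int_0^t(t-\tau)^{-1/2}u'(\tau)\,d\tau$. The solution operator $S(t)$ of the problem is the strongly continuous family of bounded operators on $X$ with $S(0)=I$, leaving $D(A^{1/2})$ invariant, commuting with $A^{1/2}$ on it, and satisfying $S(t)v=v-\frac{1}{\Gamma(1/2)}\int_0^t(t-s)^{-1/2}A^{1/2}S(s)v\,ds$ for $v\in D(A^{1/2})$, $t\ge0$. The Green function $G_{1/2,1/2,1}(\cdot,t)$ is its convolution kernel (taken continuous away from $x=0$): $(S(t)v)(x)=\int_{\mathbb{R}}G_{1/2,1/2,1}(y,t)v(x-y)\,dy$ for $v\in X$, $t>0$. *)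

(* Defs.v *)
(* An element of X is handled through a representative
   R -> R; [Xforall] ("for all x" in C_0, "for a.e. x" in L^p) gives equality
   in X.  An unbounded operator is the relation describing its graph. *)
From HB Require Import structures.
From mathcomp Require Import all_boot all_order all_algebra.
From mathcomp Require Import all_classical all_reals all_analysis.
Set Implicit Arguments.
Unset Strict Implicit.
Unset Printing Implicit Defensive.
Import Order.TTheory GRing.Theory Num.Theory.
Import numFieldNormedType.Exports.
Local Open Scope classical_set_scope.
Local Open Scope ring_scope.

Inductive Xspace (R : realType) : Type :=
| Lp (p : R) of 1 < p
| C0.
Arguments C0 {R}.

Definition Xmem (R : realType) (X : Xspace R) (f : R -> R) : Prop :=
  match X with
  | Lp p _ => f \in Lfun (@lebesgue_measure R) p%:E
  | C0 => [/\ continuous f, f x @[x --> +oo] --> 0 & f x @[x --> -oo] --> 0]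
  end.

Definition Xnorm (R : realType) (X : Xspace R) (f : R -> R) : \bar R :=
  match X with
  | Lp p _ => Lnorm (@lebesgue_measure R) p%:E (EFin \o f)
  | C0 => ereal_sup [set `|f x|%:E | x in [set: R]]
  end.

Definition Xforall (R : realType) (X : Xspace R) (P : R -> Prop) : Prop :=
  match X with
  | Lp _ _ => {ae (@lebesgue_measure R), forall x, P x}
  | C0 => forall x, P x
  end.

Definition Xeq (R : realType) (X : Xspace R) (f g : R -> R) : Prop :=
  Xforall X (fun x => f x = g x).

Definition Xcvg (R : realType) (X : Xspace R) (u : nat -> R -> R) (v : R -> R) :
    Prop :=
  Xnorm X (u n \- v) @[n --> \oo] --> 0%E.

(* [is_Bochner X D f w]: the X-valued function f is Bochner integrable over D
   with integral w.  The n-th approximating simple function is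
   \sum_(i < k n) \1_(E n i) c n i. *)
Definition is_Bochner (R : realType) (X : Xspace R) (D : set R)
    (f : R -> R -> R) (w : R -> R) : Prop :=
  let mu := @lebesgue_measure R in
  (forall l : R, D l -> Xmem X (f l)) /\ Xmem X w /\
  exists (k : nat -> nat) (E : nat -> nat -> set R) (c : nat -> nat -> R -> R),
    let s n l x := \sum_(i < k n) \1_(E n i) l * c n i x in
    let I n x := \sum_(i < k n) fine (mu (E n i)) * c n i x in
    [/\ forall n i, (i < k n)%N ->
          [/\ measurable (E n i), E n i `<=` D, (mu (E n i) < +oo)%E
            & Xmem X (c n i)],
        {ae mu, forall l : R, D l -> Xcvg X (s ^~ l) (f l)},
        (\int[mu]_(l in D) Xnorm X (f l \- s n l)%R)%E @[n --> \oo] --> 0%E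
      & Xcvg X I w].

Definition test_function (R : realType) (phi : R -> R) : Prop :=
  (forall n x, derivable (derive1n n phi) x 1) /\
  exists M : R, forall x, M < `|x| -> phi x = 0.

(* Graph of A = - d^2/dx^2 with maximal domain: the distributional second
   derivative of v belongs to X. *)
Definition is_A (R : realType) (X : Xspace R) (v w : R -> R) : Prop :=
  let mu := @lebesgue_measure R in
  [/\ Xmem X v, Xmem X w
    & forall phi, test_function phi ->
      \int[mu]_x (v x * derive1n 2 phi x) = - \int[mu]_x (w x * phi x)].

(* r = (l + A)^-1 w *)
Definition is_resolvent (R : realType) (X : Xspace R) (l : R) (w r : R -> R) :
    Prop :=
  exists2 a, is_A X r a & Xeq X (fun x => l * r x + a x) w.

Definition is_Balakrishnan (R : realType) (X : Xspace R) (v w : R -> R) : Prop :=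
  exists (a : R -> R) (r : R -> R -> R) (I : R -> R),
    [/\ is_A X v a,
        forall l : R, 0 < l -> is_resolvent X l a (r l),
        is_Bochner X `]0, +oo[ (fun l x => l `^ (- 2^-1) * r l x) I,
        Xmem X w
      & Xeq X w (fun x => pi^-1 * I x)].

(* Graph of A^(1/2), the closure of the operator above. *)
Definition is_Ahalf (R : realType) (X : Xspace R) (v w : R -> R) : Prop :=
  [/\ Xmem X v, Xmem X w
    & exists v_ w_ : nat -> R -> R,
      [/\ forall n, is_Balakrishnan X (v_ n) (w_ n),
          Xcvg X v_ v & Xcvg X w_ w]].

Definition Gamma (R : realType) (a : R) : R :=
  \int[@lebesgue_measure R]_(s in `]0, +oo[) (s `^ (a - 1) * expR (- s)).

(* Bounded linear operator on X; together the conditions imply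
   compatibility with [Xeq]. *)
Definition is_bounded_operator (R : realType) (X : Xspace R)
    (T : (R -> R) -> R -> R) : Prop :=
  [/\ forall v, Xmem X v -> Xmem X (T v),
      forall a v w, Xmem X v -> Xmem X w ->
        Xeq X (T (fun x => a * v x + w x)) (fun x => a * T v x + T w x)
    & exists C : R, forall v, Xmem X v -> (Xnorm X (T v) <= C%:E * Xnorm X v)%E].

Definition is_solution_operator (R : realType) (X : Xspace R)
    (S : R -> (R -> R) -> R -> R) : Prop :=
  [/\ forall t : R, 0 <= t -> is_bounded_operator X (S t),
      forall v, Xmem X v -> forall t0 : R, 0 <= t0 ->
        Xnorm X (S t v \- S t0 v)
          @[t --> within [set t : R | 0 <= t] (nbhs t0)] --> 0%E,
      forall v, Xmem X v -> Xeq X (S 0 v) v,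
      (* S(t) leaves D(A^(1/2)) invariant and A^(1/2) S(t) v = S(t) A^(1/2) v *)
      forall (t : R) v w, 0 <= t -> is_Ahalf X v w -> is_Ahalf X (S t v) (S t w)
    & forall (t : R) v w, 0 <= t -> is_Ahalf X v w ->
        exists (g : R -> R -> R) (I : R -> R),
          [/\ forall s : R, 0 <= s -> is_Ahalf X (S s v) (g s),
              is_Bochner X `]0, t[ (fun s x => (t - s) `^ (- 2^-1) * g s x) I
            & Xeq X (S t v) (fun x => v x - (Gamma 2^-1)^-1 * I x)]].

(* G x t is the kernel G_{1/2,1/2,1}(x, t). *)
Definition is_Green_function (R : realType) (X : Xspace R)
    (S : R -> (R -> R) -> R -> R) (G : R -> R -> R) : Prop :=
  let mu := @lebesgue_measure R in
  forall t : R, 0 < t ->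
    (forall x : R, x != 0 -> {for x, continuous (G ^~ t)}) /\
    forall v, Xmem X v -> Xforall X (fun x =>
      mu.-integrable [set: R] (fun y : R => (G y t * v (x - y))%:E) /\
      S t v x = \int[mu]_y (G y t * v (x - y))).

Definition E1 (R : realType) (z : R) : R :=
  \int[@lebesgue_measure R]_(xi in `[z, +oo[) (expR (- xi) / xi).

(* The filter on pairs (x, t), x != 0, t > 0, for which x^2/(4t) tends
   to the limit described by F. *)
Definition similarity_filter (R : realType) (F : set_system R) :
    set_system (R * R) :=
  [set P | \forall z \near F, forall x t : R,
    x != 0 -> 0 < t -> x ^+ 2 / (4 * t) = z -> P (x, t)].

Definition asymp_equiv (R : realType) (F : set_system (R * R))
    (f g : R -> R -> R) : Prop :=
  f q.1 q.2 / g q.1 q.2 @[q --> F] --> (1 : R).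

(* Main.v *)
Require Import Defs.
From mathcomp Require Import all_boot all_order all_algebra.
From mathcomp Require Import all_classical all_reals all_analysis.
From mathcomp Require Import measurable_realfun ring lra.
Set Implicit Arguments.
Unset Strict Implicit.
Unset Printing Implicit Defensive.
Import Order.TTheory GRing.Theory Num.Theory.
Import numFieldNormedType.Exports.
Local Open Scope classical_set_scope.
Local Open Scope ring_scope.

(* Pairing an element u of X with the heat kernel, [hp u b t] =
   (e^{-tA} u)(b), makes everything scalar: Balakrishnan's formula becomes
     hp (A^{1/2} u) b t = - pi^{-1/2} int_0^oo s^{-1/2} (d/dt) hp u b (t + s) ds,
   and the equation for S(.)v becomes a scalar Volterra equation, one for
   every t, coupled through this formula.  It is solved without Laplace
   inversion: one convolves the equation at t + s with the kernel
     qk s T = sqrt T / (pi sqrt s (s + T)),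
   whose convolution with T^{-1/2} is s^{-1/2} - (T + s)^{-1/2}, and integrates
   over s.  The terms containing A^{1/2} cancel and there remains
     hp (S(T) v) b t = int_0^oo qk s T * hp v b (t + s) ds.
   For v a heat kernel, which lies in D(A^{1/2}), this determines the integrals
   of G(., T) against all heat kernels; letting their width tend to 0 gives
     G(b, T) = int_0^oo qk s T * hk s b ds      (b <> 0),
   and the integrand is the s-derivative of a constant times
   E1 (b^2/(4T) + b^2/(4s)).  The asymptotics and the bounds are those of E1,
   obtained by comparing derivatives. *)

(** * Integration *)

(** The kernel [qk] is read off the formal solution
    $E_{1/2}(-\sqrt{tA})=e^{tA}\,\mathrm{erfc}\sqrt{tA}$: in $e^{z}\,\mathrm{erfc}\sqrt
    z=\frac1\pi\int_0^\infty e^{-zu}u^{-1/2}(1+u)^{-1}du$ put $z=tA$ and $u=s/t$. The given family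
    S, however, is characterised only by its integral equation, so the argument is one of
    uniqueness. The double integral of [th s (T - r) * hA (S r v) b (t + s)] over s and r is
    evaluated in both orders; the two values share a mixed term in [qk] and S, and removing it
    leaves an identity between integrals over 0 < r < T, which is then differentiated in T. Two
    obstacles shape the rest. The integral equation holds only on D(A^(1/2)), so heat kernels have
    to be placed in that domain by a Bochner integral in the norm of X; the envelope 1/(1 + |x|),
    which lies in every admissible X, treats L^p and C_0 alike. And G is known only through its
    convolutions, so domination by wider Gaussians has to supply its measurability and
    integrability. *)

Section integration_toolkit.
Context {R : realType}.
Notation mu := (@lebesgue_measure R).
Implicit Types (D : set R) (f g F : R -> R).

Lemma intble_meas D f : mu.-integrable D (EFin \o f) -> measurable_fun D f.
Proof. by move=> /measurable_int /measurable_EFinP. Qed.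

Lemma le_intble D f g : measurable D -> measurable_fun D f ->
  mu.-integrable D (EFin \o g) -> (forall x, D x -> `|f x| <= g x) ->
  mu.-integrable D (EFin \o f).
Proof.
move=> mD mf ig fg; apply: (@le_integrable _ _ _ mu D mD _ (EFin \o g)) => //.
  exact/measurable_EFinP.
move=> x Dx /=; rewrite lee_fin (le_trans (fg _ Dx))//; exact: ler_norm.
Qed.

Lemma Rintegral_le_norm D f g : measurable D -> measurable_fun D f ->
  mu.-integrable D (EFin \o g) -> (forall x, D x -> `|f x| <= g x) ->
  `|\int[mu]_(x in D) f x| <= \int[mu]_(x in D) g x.
Proof.
move=> mD mf ig fg; have jf := le_intble mD mf ig fg.
apply: le_trans (le_normr_Rintegral _ _) _ => //.
apply: le_Rintegral => //.
have := integrable_norm jf; exact.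
Qed.

Lemma Rintegral_dct D (f_ : nat -> R -> R) f g : measurable D ->
  (forall n, measurable_fun D (f_ n)) -> measurable_fun D f ->
  (forall x, D x -> f_ n x @[n --> \oo] --> f x) ->
  mu.-integrable D (EFin \o g) ->
  (forall n x, D x -> `|f_ n x| <= g x) ->
  \int[mu]_(x in D) f_ n x @[n --> \oo] --> \int[mu]_(x in D) f x.
Proof.
move=> mD mf_ mf ff ig fg.
have mEf_ n : measurable_fun D (EFin \o f_ n) by exact/measurable_EFinP.
have mEf : measurable_fun D (EFin \o f) by exact/measurable_EFinP.
have cff : {ae mu, forall x, D x ->
    (EFin \o f_ n) x @[n --> \oo] --> (EFin \o f) x}.
  apply: aeW => x Dx; apply: cvg_EFin; first exact: nearW.
  exact: ff.
have bfg : {ae mu, forall x n, D x -> (`|(EFin \o f_ n) x| <= (EFin \o g) x)%E}.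
  by apply: aeW => x n Dx /=; rewrite lee_fin fg.
have [intf _ H] := @dominated_convergence _ _ _ mu D mD (fun n => EFin \o f_ n)
  (EFin \o f) (EFin \o g) mEf_ mEf cff ig bfg.
apply/fine_cvg.
rewrite /Rintegral fineK; first exact: H.
exact: integrable_fin_num.
Qed.

(* Fatou on an exhaustion of D by compact intervals. *)
Lemma ftc_exhaust_ge0 D f F (a b : nat -> R) (A B : R) : open D ->
  (forall n, a n < b n) -> (forall n, `[a n, b n] `<=` D) ->
  (forall x, D x -> \forall n \near \oo, x \in `[a n, b n]) ->
  (forall x, D x -> is_derive x 1 F (f x)) ->
  (forall x, D x -> {for x, continuous f}) ->
  F (a n) @[n --> \oo] --> A -> F (b n) @[n --> \oo] --> B ->
  [/\ measurable_fun D f,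
    forall n, (\int[mu]_(x in `[a n, b n]) (f x)%:E = (F (b n) - F (a n))%:E)%E,
    (forall x, D x -> 0 <= f x) -> mu.-integrable D (EFin \o f) &
    mu.-integrable D (EFin \o f) -> \int[mu]_(x in D) f x = B - A].
Proof.
move=> oD ab abD exD dF cf FaA FbB.
have mD : measurable D by exact: open_measurable.
have mf : measurable_fun D f.
  apply: open_continuous_measurable_fun => // x; rewrite inE; exact: cf.
have I n : (\int[mu]_(x in `[a n, b n]) (f x)%:E = (F (b n) - F (a n))%:E)%E.
  rewrite EFinB; apply: continuous_FTC2 => //.
  - apply: continuous_in_subspaceT => x; rewrite inE => /abD; exact: cf.
  - have cF x : D x -> {for x, continuous F}.
      move=> Dx; apply/differentiable_continuous/derivable1_diffP.
      by have [] := dF x Dx.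
    split.
    + move=> x xab; have [] // := dF x _.
      by apply: (abD n); apply: subset_itv_oo_cc xab.
    + apply: cvg_at_right_filter; apply: cF.
      by apply: (abD n); rewrite /= in_itv/= lexx ltW.
    + apply: cvg_at_left_filter; apply: cF.
      by apply: (abD n); rewrite /= in_itv/= lexx ltW.
  - move=> x xab; rewrite derive1E; have [] // := dF x _.
    by apply: (abD n); apply: subset_itv_oo_cc xab.
have cI : (F (b n) - F (a n)) @[n --> \oo] --> B - A by exact: cvgB.
pose f_ n := f \_ `[a n, b n].
have If_ n : (\int[mu]_(x in D) (f_ n x)%:E = (F (b n) - F (a n))%:E)%E.
  rewrite -I [RHS]integral_mkcond [LHS]integral_mkcond; apply: eq_integral => x _.
  rewrite /f_ !patchE; case: ifPn => xD.
    by case: ifPn.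
  by case: ifPn => // /set_mem/abD xD'; move: xD; rewrite mem_set.
have mf_ n : measurable_fun D (f_ n).
  apply/(measurable_restrict _ _ _) => //.
  by apply: measurable_funS mf => //; exact: subIsetl.
have ff x : D x -> f_ n x @[n --> \oo] --> f x.
  move=> Dx; apply: cvg_near_cst; near=> n.
  rewrite /f_ patchE ifT//; rewrite inE/=; near: n; exact: exD.
split => //.
- move=> f0; apply/integrableP; split; first exact/measurable_EFinP.
  rewrite (_ : integral _ _ _ = \int[mu]_(x in D) (limn_einf (fun n => (f_ n x)%:E)))%E; last first.
    apply: eq_integral => x; rewrite inE => Dx.
    have c : (f_ n x)%:E @[n --> \oo] --> (f x)%:E.
      by apply: cvg_EFin; [exact: nearW|exact: ff].
    rewrite is_cvg_limn_einfE; last by apply/cvg_ex; eexists; exact: c.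
    by rewrite (cvg_lim _ c)//= ger0_norm// f0.
  have mEf_ n : measurable_fun D (EFin \o f_ n) by exact/measurable_EFinP.
  have pf_ n x : D x -> (0 <= (EFin \o f_ n) x)%E.
    move=> Dx; rewrite lee_fin /f_ patchE; case: ifP => // _; exact: f0.
  apply: le_lt_trans (fatou mu mD mEf_ pf_) _.
  under eq_fun do rewrite If_.
  have c : (F (b n) - F (a n))%:E @[n --> \oo] --> (B - A)%:E.
    by apply: cvg_EFin; [exact: nearW|exact: cI].
  rewrite is_cvg_limn_einfE; last by apply/cvg_ex; eexists; exact: c.
  by rewrite (cvg_lim _ c)// ltry.
- move=> jf.
  have H : \int[mu]_(x in D) f_ n x @[n --> \oo] --> \int[mu]_(x in D) f x.
    apply: (@Rintegral_dct D f_ f (fun x => `|f x|)) => //.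
      have := integrable_norm jf; exact.
    by move=> n x Dx; rewrite /f_ patchE; case: ifP => // _; rewrite normr0.
  rewrite -(cvg_lim _ H)//; apply/cvg_lim => //.
  by under eq_fun do rewrite /Rintegral If_ /=; exact: cI.
Unshelve. all: by end_near. Qed.

(** The final disjunction separates two uses: for a nonnegative integrand integrability comes for
    free from the finite limits of the primitive, while for a signed one it has to be known
    beforehand. *)
Lemma ftc_exhaust D f F (a b : nat -> R) (A B : R) : open D ->
  (forall n, a n < b n) -> (forall n, `[a n, b n] `<=` D) ->
  (forall x, D x -> \forall n \near \oo, x \in `[a n, b n]) ->
  (forall x, D x -> is_derive x 1 F (f x)) ->
  (forall x, D x -> {for x, continuous f}) ->
  F (a n) @[n --> \oo] --> A -> F (b n) @[n --> \oo] --> B ->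
  (forall x, D x -> 0 <= f x) \/ mu.-integrable D (EFin \o f) ->
  mu.-integrable D (EFin \o f) /\ \int[mu]_(x in D) f x = B - A.
Proof.
move=> oD ab abD exD dF cf FaA FbB h.
have [mf _ i0 i1] := ftc_exhaust_ge0 oD ab abD exD dF cf FaA FbB.
have jf : mu.-integrable D (EFin \o f) by case: h => // /i0.
by split => //; exact: i1.
Qed.

Lemma ftc_oo f F (a b A B : R) : a < b ->
  (forall x, a < x < b -> is_derive x 1 F (f x)) ->
  (forall x, a < x < b -> {for x, continuous f}) ->
  F x @[x --> a^'+] --> A -> F x @[x --> b^'-] --> B ->
  (forall x, a < x < b -> 0 <= f x) \/ mu.-integrable `]a, b[ (EFin \o f) ->
  mu.-integrable `]a, b[ (EFin \o f) /\ \int[mu]_(x in `]a, b[) f x = B - A.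
Proof.
move=> ab dF cf FA FB h.
(* A denominator of at least 3 keeps the two insets together below [b - a], so the compact intervals
   are nondegenerate from [n = 0] on. *)
pose d (n : nat) := (b - a) / n.+3%:R.
have d0 n : 0 < d n by rewrite divr_gt0 ?subr_gt0.
have dab n : d n + d n < b - a.
  have k3 : 3 <= n.+3%:R :> R by rewrite ler_nat.
  have : d n * n.+3%:R = b - a by rewrite /d divfK.
  have := d0 n; nra.
have d0' : d n @[n --> \oo] --> (0 : R).
  rewrite -[0](mulr0 (b - a)); apply: cvgMr.
  have := @cvg_harmonic R; rewrite -(cvg_shiftn 2)/= /harmonic.
  by under eq_fun do rewrite addn2.
apply: (@ftc_exhaust `]a, b[%classic _ F (fun n => a + d n) (fun n => b - d n)) => //.
- by move=> n; have := dab n; lra.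
- by move=> n x; rewrite /= !in_itv/= => /andP[? ?]; have := d0 n; lra.
- move=> x; rewrite /= in_itv/= => /andP[ax xb].
  have h1 : 0 < Num.min (x - a) (b - x) by rewrite lt_min !subr_gt0 ax.
  apply: filterS (cvgr_lt _ d0' _ h1) => n /=.
  by rewrite lt_min in_itv/= => /andP[? ?]; lra.
- by move/cvg_at_rightP : FA; apply; split=> [n|];
    [by rewrite ltrDl|rewrite -[X in _ --> X]addr0; apply: cvgD => //; exact: cvg_cst].
- by move/cvg_at_leftP : FB; apply; split=> [n|];
    [by rewrite ltrBlDr ltrDl|rewrite -[X in _ --> X]subr0; apply: cvgB => //; exact: cvg_cst].
Qed.

Lemma ftc_oy f F (a A B : R) :
  (forall x, a < x -> is_derive x 1 F (f x)) ->
  (forall x, a < x -> {for x, continuous f}) ->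
  F x @[x --> a^'+] --> A -> F x @[x --> +oo] --> B ->
  (forall x, a < x -> 0 <= f x) \/ mu.-integrable `]a, +oo[ (EFin \o f) ->
  mu.-integrable `]a, +oo[ (EFin \o f) /\ \int[mu]_(x in `]a, +oo[) f x = B - A.
Proof.
move=> dF cf FA FB h.
have E x : `]a, +oo[%classic x = (a < x) by rewrite /= in_itv/= andbT.
have d0 : n.+1%:R^-1 @[n --> \oo] --> (0 : R) by exact: cvg_harmonic.
(* The shift to [n.+2] makes the right end exceed the left one already for [n = 0], where the left
   end is [a + 1]. *)
apply: (@ftc_exhaust `]a, +oo[%classic _ F (fun n => a + n.+1%:R^-1) (fun n => a + n.+2%:R)).
- exact: itv_open_ends_open.
- move=> n; rewrite ltrD2l (@le_lt_trans _ _ 1)// ?ltr1n// invf_le1//.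
  by rewrite ler1n.
- move=> n x; rewrite E/= !in_itv/= => /andP[p0 _].
  have p : 0 < n.+1%:R^-1 :> R by [].
  by apply: lt_le_trans p0; rewrite ltrDl.
- move=> x; rewrite E => ax.
  have h1 : 0 < x - a by lra.
  near=> n; rewrite in_itv/=; apply/andP; split.
    rewrite -lerBrDl; near: n; exact: (cvgr_le _ d0 _ h1).
  rewrite -lerBlDl (@le_trans _ _ n%:R) ?ler_nat//; last by rewrite -addn2 leq_addr.
  near: n; exact: nbhs_infty_ger.
- by move=> x; rewrite E; exact: dF.
- by move=> x; rewrite E; exact: cf.
- by move/cvg_at_rightP : FA; apply; split=> [n|];
    [by rewrite ltrDl|rewrite -[X in _ --> X]addr0; apply: cvgD => //; exact: cvg_cst].
- move/cvg_pinftyP : FB; apply; apply/cvgryPge => M; near=> n.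
  rewrite -lerBlDl (@le_trans _ _ n%:R)//; last by rewrite ler_nat -addn2 leq_addr.
  near: n; exact: nbhs_infty_ger.
- by case: h => h; [left=> x; rewrite E; exact: h|right].
Unshelve. all: by end_near. Qed.

Lemma ftc_T f F (A B : R) :
  (forall x : R, is_derive x 1 F (f x)) -> continuous f ->
  F x @[x --> -oo] --> A -> F x @[x --> +oo] --> B ->
  (forall x, 0 <= f x) \/ mu.-integrable setT (EFin \o f) ->
  mu.-integrable setT (EFin \o f) /\ \int[mu]_x f x = B - A.
Proof.
move=> dF cf FA FB h.
apply: (@ftc_exhaust _ _ F (fun n => - n.+1%:R) (fun n => n.+1%:R)) => //.
- exact: openT.
- by move=> n; have : 0 < n.+1%:R :> R by []; lra.
- move=> x _; near=> n; rewrite in_itv/= -ler_norml.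
  rewrite (@le_trans _ _ n%:R) ?ler_nat//.
  near: n; exact: nbhs_infty_ger.
- by move=> x _; exact: cf.
- move/cvg_ninftyP : FA; apply; apply/cvgrNyPle => M; near=> n.
  rewrite lerNl (@le_trans _ _ n%:R) ?ler_nat//.
  near: n; exact: nbhs_infty_ger.
- move/cvg_pinftyP : FB; apply; apply/cvgryPge => M; near=> n.
  rewrite (@le_trans _ _ n%:R) ?ler_nat//.
  near: n; exact: nbhs_infty_ger.
- by case: h; [left|right].
Unshelve. all: by end_near. Qed.

Lemma ae_imp (P Q : R -> Prop) : (forall x, P x -> Q x) ->
  {ae mu, forall x, P x} -> {ae mu, forall x, Q x}.
Proof.
move=> PQ; apply: (@filterS _ _ (ae_filter_ringOfSetsType mu)) => x; exact: PQ.
Qed.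

Lemma cvg_within_seq (A : set R) (u : nat -> R) (y : R) :
  u n @[n --> \oo] --> y -> (forall n, A (u n)) ->
  u n @[n --> \oo] --> within A (nbhs y).
Proof.
move=> uy Au P nP; have H : \forall x \near y, A x -> P x by exact: nP.
have h : \forall n \near \oo, A (u n) -> P (u n) by exact: (uy _ H).
suff : \forall n \near \oo, P (u n) by [].
by apply: filterS h => n; apply; exact: Au.
Qed.

(** Carathéodory functions are jointly measurable: with [y] rounded down to the grid of step
    1/(n+1), the function depends on [x] alone on each strip, and continuity in [y] recovers [f] in
    the limit. Rounding down of [y >= 0] never leaves [[0, +oo[], where [f] is controlled. *)
Lemma measurable_fun_cara D (f : R -> R -> R) : measurable D ->
  (forall y : R, 0 <= y -> measurable_fun D (f^~ y)) ->
  (forall x y : R, D x -> 0 <= y ->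
     f x y' @[y' --> within [set s | 0 <= s] (nbhs y)] --> f x y) ->
  measurable_fun (D `*` `[0, +oo[ : set (R * R)) (fun z : R * R => f z.1 z.2).
Proof.
move=> mD mf cf.
pose s n (y : R) := (Num.truncn (y * n.+1%:R))%:R / n.+1%:R : R.
have s0 n y : 0 <= s n y by rewrite divr_ge0.
have sE n k y : k%:R / n.+1%:R <= y < k.+1%:R / n.+1%:R -> s n y = k%:R / n.+1%:R.
  rewrite ler_pdivrMr// ltr_pdivlMr// => /truncn_def kE.
  by rewrite /s kE.
have sy (y : R) : 0 <= y -> s n y @[n --> \oo] --> y.
  move=> y0; apply/cvgrPdist_le => e e0; near=> n.
  have /andP[t1 t2] : s n y <= y < s n y + n.+1%:R^-1.
    have := @truncn_itv _ (y * n.+1%:R) _.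
    rewrite mulr_ge0// => /(_ isT); rewrite -ler_pdivrMr// -ltr_pdivlMr// -/(s n y).
    by rewrite -natr1 mulrDl mul1r.
  rewrite ger0_norm ?subr_ge0//.
  have : n.+1%:R^-1 <= e by near: n; exact: (cvgr_le _ (@cvg_harmonic R) _ e0).
  by move: t2 => /ltW; rewrite -lerBlDl => /le_trans; apply.
have mI k n : measurable (D `*` `[k%:R / n.+1%:R, k.+1%:R / n.+1%:R[ : set (R * R)).
  exact: measurableX.
apply: (@measurable_fun_cvg _ _ _ _ (fun n (z : R * R) => f z.1 (s n z.2))); last first.
  move=> -[x y] [/= Dx]; rewrite in_itv/= andbT => y0.
  apply: (cvg_comp (s^~ y) (f x) _ (cf _ _ Dx y0)).
  by apply: cvg_within_seq => [|n]; [exact: sy|exact: s0].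
move=> n.
have -> : D `*` (`[0, +oo[ : set R) =
    \bigcup_k (D `*` (`[k%:R / n.+1%:R, k.+1%:R / n.+1%:R[ : set R)).
  apply/seteqP; split=> -[x y] /=; rewrite ?in_itv/= ?andbT.
    move=> [Dx y0]; exists (Num.truncn (y * n.+1%:R)) => //; split=> //=.
    rewrite in_itv/= ler_pdivrMr// ltr_pdivlMr//.
    by apply: truncn_itv; rewrite mulr_ge0.
  move=> [k _ [/= Dx]]; rewrite in_itv/= => /andP[y0 _]; split=> //.
  by apply: le_trans y0; rewrite divr_ge0.
apply/measurable_fun_bigcup => [k|k]; first exact: mI.
apply: (eq_measurable_fun (fun z => f z.1 (k%:R / n.+1%:R))).
  by move=> -[x y] /set_mem[/= _]; rewrite in_itv/= => /sE ->.
have mfst : measurable_fun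
    (D `*` `[k%:R / n.+1%:R, k.+1%:R / n.+1%:R[ : set (R * R)) (@fst R R).
  exact: measurable_funTS.
apply: (measurable_comp mD _ (mf _ _) mfst).
  by move=> _ [z [/= Dz _] <-].
by rewrite divr_ge0.
Unshelve. all: by end_near. Qed.

Lemma Rintegral_ae_eq D f g : measurable D -> measurable_fun D f ->
  measurable_fun D g -> {ae mu, forall x, D x -> f x = g x} ->
  \int[mu]_(x in D) f x = \int[mu]_(x in D) g x.
Proof.
move=> mD mf mg fg; rewrite /Rintegral; congr fine.
apply: ae_eq_integral => //; [exact/measurable_EFinP|exact/measurable_EFinP|].
by apply: ae_imp fg => x fg Dx; rewrite fg.
Qed.

(** Immediate from the definition of the integral as a supremum over simple functions. Measurability
    is avoided because it will be applied to [l |-> Xnorm X (f l \- s n l)], about which nothing of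
    the kind is known. *)
Lemma ge0_le_integral_nomeas D (f g : R -> \bar R) : measurable D ->
  (forall x, D x -> 0 <= f x)%E -> (forall x, D x -> f x <= g x)%E ->
  (\int[mu]_(x in D) f x <= \int[mu]_(x in D) g x)%E.
Proof.
move=> mD f0 fg; have g0 x : D x -> (0 <= g x)%E.
  by move=> Dx; exact: le_trans (f0 _ Dx) (fg _ Dx).
rewrite !ge0_integralE//=; apply: ge_ereal_sup => _ [k /= kf <-].
apply: ereal_sup_ubound; exists k => // x; apply: le_trans (kf x) _.
by rewrite !patchE; case: ifPn => // /set_mem; exact: fg.
Qed.

(** Integrability on the product follows by Tonelli from the majorant [b] of the inner absolute
    integrals, the form in which the explicit kernel integrals provide it. Integrability of the
    partial integrals is returned as well: it is how functions defined by an integral are later seen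
    to be measurable. *)
Lemma Rintegral_Fubini (D1 D2 : set R) (h : R -> R -> R) (b : R -> R) :
  measurable D1 -> measurable D2 ->
  measurable_fun (D1 `*` D2) (fun z : R * R => h z.1 z.2) ->
  (forall x, D1 x -> mu.-integrable D2 (EFin \o h x)) ->
  (forall x, D1 x -> \int[mu]_(y in D2) `|h x y| <= b x) ->
  mu.-integrable D1 (EFin \o b) ->
  [/\ mu.-integrable D1 (EFin \o (fun x => \int[mu]_(y in D2) h x y)),
    mu.-integrable D2 (EFin \o (fun y => \int[mu]_(x in D1) h x y)) &
    \int[mu]_(x in D1) \int[mu]_(y in D2) h x y =
    \int[mu]_(y in D2) \int[mu]_(x in D1) h x y].
Proof.
move=> mD1 mD2 mh ih bh ib.
pose H (z : R * R) := ((fun z : R * R => h z.1 z.2) \_ (D1 `*` D2)) z.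
have mH : measurable_fun setT (EFin \o H).
  apply/measurable_EFinP; have mX := measurableX mD1 mD2.
  exact/(measurable_restrictT _ mX).
have HE x y : H (x, y) = (((h x) \_ D2) y) * \1_D1 x.
  rewrite /H !patchE indicE; case: (boolP (x \in D1)) => x1; last first.
    rewrite mulr0 ifF//; apply/negP; rewrite inE => -[/= ? _].
    by move: x1; rewrite mem_set.
  rewrite mulr1; case: (boolP (y \in D2)) => y2.
    by rewrite ifT// inE; split => /=; exact/set_mem.
  rewrite ifF//; apply/negP; rewrite inE => -[/= _ ?].
  by move: y2; rewrite mem_set.
have iH : (mu \x mu)%E.-integrable setT (EFin \o H).
  apply/integrable12ltyP => //.
  have : (\int[mu]_(x in D1) `|(b x)%:E| < +oo)%E by case/integrableP : ib.
  apply: le_lt_trans; rewrite [leRHS]integral_mkcond.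
  apply: ge0_le_integral => //.
  - by move=> x _; exact: integral_ge0.
  - have maH : measurable_fun setT (abse \o (EFin \o H)).
      by apply: measurableT_comp mH.
    exact: (@measurable_fun_fubini_tonelli_F _ _ _ _ _ mu _ maH
      (fun=> abse_ge0 _)).
  - apply/(measurable_restrictT _ mD1).
    by apply: measurableT_comp => //; exact: (measurable_int mu).
  - move=> x _; rewrite patchE; case: ifPn => xD1; last first.
      rewrite integral0_eq// => y _ /=; rewrite HE indicE (negbTE xD1) mulr0.
      by rewrite normr0.
    have x1 : D1 x by exact/set_mem.
    rewrite [leRHS](_ : _ = `|b x|%:E)//.
    apply: (@le_trans _ _ (\int[mu]_(y in D2) `|h x y|)%:E); last first.
      rewrite lee_fin (le_trans (bh _ x1))//; exact: ler_norm.
    have ihx := integrable_norm (ih _ x1).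
    rewrite /Rintegral fineK; last exact: integrable_fin_num ihx.
    rewrite [leRHS]integral_mkcond; apply: ge0_le_integral => //.
    + apply: measurableT_comp => //; apply: measurableT_comp mH _ => //.
    + apply/(measurable_restrictT _ mD2).
      exact: (measurable_int mu).
    + move=> y _ /=; rewrite HE indicE xD1 mulr1 !patchE.
      by case: ifP => //; rewrite normr0.
have := Fubini iH.
have E1 : (\int[mu]_x \int[mu]_y (EFin \o H) (x, y))%E =
          (\int[mu]_(x in D1) \int[mu]_(y in D2) (h x y)%:E)%E.
  rewrite [RHS]integral_mkcond; apply: eq_integral => x _.
  rewrite patchE; case: ifPn => xD1; last first.
    by rewrite integral0_eq// => y _ /=; rewrite HE indicE (negbTE xD1) mulr0.
  rewrite [RHS]integral_mkcond; apply: eq_integral => y _ /=.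
  by rewrite HE indicE xD1 mulr1 !patchE; case: ifP.
have E2 : (\int[mu]_y \int[mu]_x (EFin \o H) (x, y))%E =
          (\int[mu]_(y in D2) \int[mu]_(x in D1) (h x y)%:E)%E.
  rewrite [RHS]integral_mkcond; apply: eq_integral => y _.
  rewrite patchE; case: ifPn => yD2; last first.
    by rewrite integral0_eq// => x _ /=; rewrite HE patchE (negbTE yD2) mul0r.
  rewrite [RHS]integral_mkcond; apply: eq_integral => x _ /=.
  rewrite HE !patchE yD2 indicE; case: ifP => _; by rewrite ?mulr1 ?mulr0.
rewrite E1 E2 => EE.
have E3 y : D2 y -> (\int[mu]_(x in D1) (h x y)%:E =
    \int[mu]_x (EFin \o H) (x, y))%E.
  move=> y2; rewrite [LHS]integral_mkcond; apply: eq_integral => x _ /=.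
  by rewrite HE !patchE (mem_set y2) indicE; case: ifP => _; rewrite ?mulr1 ?mulr0.
have E4 x : D1 x -> (\int[mu]_(y in D2) (h x y)%:E =
    \int[mu]_y (EFin \o H) (x, y))%E.
  move=> x1; rewrite [LHS]integral_mkcond; apply: eq_integral => y _ /=.
  by rewrite HE indicE (mem_set x1) mulr1 !patchE; case: ifP.
have mG : measurable_fun D2 (fun y => \int[mu]_(x in D1) (h x y)%:E)%E.
  apply: (eq_measurable_fun (fun y => \int[mu]_x (EFin \o H) (x, y)))%E.
    by move=> y /set_mem y2; rewrite E3.
  apply: measurable_funTS; exact: (measurable_fubini_G iH).
have afine (z : \bar R) : (`|(fine z)%:E| <= `|z|)%E.
  by case: z => [r||] //=; rewrite normr0 leey.
split; first 2 last.
rewrite /Rintegral.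
have -> : (\int[mu]_(x in D1) (fine (\int[mu]_(y in D2) (h x y)%:E))%:E)%E =
         (\int[mu]_(x in D1) \int[mu]_(y in D2) (h x y)%:E)%E.
  apply: eq_integral => x /set_mem x1; rewrite fineK//.
  by apply: integrable_fin_num => //; exact: ih.
rewrite EE; congr fine.
(* The integrals over [D1] are known to be finite only for almost every [y], so [fine] can be
   inserted only almost everywhere. *)
apply: ae_eq_integral => //.
  by apply/measurable_EFinP; apply: measurableT_comp mG.
apply: ae_imp (ae_integrable2 iH) => y iy y2.
rewrite fineK// E3//; exact: integrable_fin_num iy.
- have i1 : mu.-integrable D1 (fubini_F mu (EFin \o H)).
    by apply: integrableS (integrable_fubini_F iH).
  apply: eq_integrable i1 => // x /set_mem x1 /=.
  rewrite /Rintegral fineK; first by rewrite E4.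
  by apply: integrable_fin_num => //; exact: ih.
- have i1 : mu.-integrable D2 (fubini_G mu (EFin \o H)).
    apply: integrableS (_ : mu.-integrable setT _) => //.
    apply/integrableP; split; first exact: (measurable_fubini_G iH).
    have mH' := measurable_int _ iH.
    have b1 : (\int[mu]_y \int[mu]_x `|(EFin \o H) (x, y)| < +oo)%E.
      by apply/integrable21ltyP.
    apply: le_lt_trans b1.
    apply: ge0_le_integral_nomeas => // y _.
    by apply: le_abse_integral => //; exact: measurableT_comp mH' _.
  have i2 : mu.-integrable D2 (fun y => \int[mu]_(x in D1) (h x y)%:E)%E.
    by apply: eq_integrable i1 => // y /set_mem y2; rewrite E3.
  apply: le_integrable i2 => //.
    by apply/measurable_EFinP; apply: measurableT_comp mG.
  by move=> y _; exact: afine.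
Qed.

End integration_toolkit.

(** * Pointwise derivatives and special integrals *)

Section pointwise_derivatives.
Context {R : realType}.
Implicit Types (f g : R -> R) (x a b : R).

Lemma isD_cst (c x : R) : is_derive x 1 (fun=> c) 0.
Proof. exact: is_derive_cst. Qed.

Lemma isD_id x : is_derive x 1 (fun y : R => y) 1.
Proof. exact: is_derive_id. Qed.

Lemma isD_add f g x a b : is_derive x 1 f a -> is_derive x 1 g b ->
  is_derive x 1 (fun y => f y + g y) (a + b).
Proof. by move=> ? ?; exact: is_deriveD. Qed.

Lemma isD_opp f x a : is_derive x 1 f a -> is_derive x 1 (fun y => - f y) (- a).
Proof. by move=> ?; exact: is_deriveN. Qed.

Lemma isD_mul f g x a b : is_derive x 1 f a -> is_derive x 1 g b ->
  is_derive x 1 (fun y => f y * g y) (a * g x + f x * b).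
Proof.
move=> fa gb; apply: (is_derive_eq (is_deriveM fa gb)).
by rewrite /GRing.scale/= addrC mulrC.
Qed.

Lemma isD_X f x a n : is_derive x 1 f a ->
  is_derive x 1 (fun y => f y ^+ n) (n%:R * f x ^+ n.-1 * a).
Proof.
move=> fa; have -> : (fun y => f y ^+ n) = f ^+ n.
  by apply/funext => y; rewrite exprfctE.
exact: (is_derive_eq (is_deriveX n fa)).
Qed.

Lemma isD_inv f x a : f x != 0 -> is_derive x 1 f a ->
  is_derive x 1 (fun y => (f y)^-1) (- a * (f x) ^- 2).
Proof.
move=> f0 fa; apply: (is_derive_eq (is_deriveV f0 fa)).
by rewrite /GRing.scale/= !mulNr mulrC.
Qed.

Lemma isD_comp f g x a b : is_derive (g x) 1 f a -> is_derive x 1 g b ->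
  is_derive x 1 (fun y => f (g y)) (a * b).
Proof. by move=> fa gb; exact: is_derive1_comp. Qed.

Lemma isD_expR g x b : is_derive x 1 g b ->
  is_derive x 1 (fun y => expR (g y)) (expR (g x) * b).
Proof. exact: isD_comp. Qed.

Lemma isD_ln g x b : 0 < g x -> is_derive x 1 g b ->
  is_derive x 1 (fun y => ln (g y)) ((g x)^-1 * b).
Proof. by move=> g0; apply: isD_comp; exact: is_derive1_ln. Qed.

Lemma isD_sqrt g x b : 0 < g x -> is_derive x 1 g b ->
  is_derive x 1 (fun y => Num.sqrt (g y)) ((2 * Num.sqrt (g x))^-1 * b).
Proof. by move=> g0; apply: isD_comp; exact: is_derive1_sqrt. Qed.

Lemma isD_atan g x b : is_derive x 1 g b ->
  is_derive x 1 (fun y => atan (g y)) ((1 + g x ^+ 2)^-1 * b).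
Proof. exact: isD_comp. Qed.

Lemma isD_continuous f x a : is_derive x 1 f a -> {for x, continuous f}.
Proof. by case=> df _; apply/differentiable_continuous/derivable1_diffP. Qed.

End pointwise_derivatives.

(** Differentiation directed by the syntax of the function: the derivative is built up as an
    unknown, and conditions such as nonzero denominators or positive radicands remain as goals.
    Functions that match no rule are looked up in the context, so their derivatives are introduced
    there before [isDeq] or [isDcont] is called. *)
Ltac isD_step :=
  lazymatch goal with
  | |- is_derive _ _ ?F _ =>
    lazymatch F with
    | (fun _ => ?c) => exact: isD_cst
    | (fun y => y) => exact: isD_id
    | (fun y => GRing.add (@?f y) (@?g y)) => eapply (@isD_add _ f g)
    | (fun y => GRing.opp (@?f y)) => eapply (@isD_opp _ f)
    | (fun y => GRing.mul (@?f y) (@?g y)) => eapply (@isD_mul _ f g)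
    | (fun y => GRing.exp (@?f y) ?n) => eapply (@isD_X _ f)
    | (fun y => GRing.inv (@?f y)) => eapply (@isD_inv _ f)
    | (fun y => expR (@?f y)) => eapply (@isD_expR _ f)
    | (fun y => ln (@?f y)) => eapply (@isD_ln _ f)
    | (fun y => Num.sqrt (@?f y)) => eapply (@isD_sqrt _ f)
    | (fun y => atan (@?f y)) => eapply (@isD_atan _ f)
    | _ => eassumption
    end
  end.
Ltac isD := repeat isD_step; cbv beta.
Ltac isDeq := eapply is_derive_eq; [isD|cbv beta].
Ltac isDcont := eapply isD_continuous; isD.

(** * Explicit integrals of inverse square roots *)

Section special_integrals.
Context {R : realType}.
Notation mu := (@lebesgue_measure R).
Implicit Types (s t c x y : R).

Lemma sqrt_cvg {T} (F : set_system T) {FF : Filter F} (u : T -> R) (l : R) :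
  u x @[x --> F] --> l -> Num.sqrt (u x) @[x --> F] --> Num.sqrt l.
Proof. by move=> ul; apply: (cvg_comp u Num.sqrt ul); exact: sqrt_continuous. Qed.

Lemma atan_cvg {T} (F : set_system T) {FF : Filter F} (u : T -> R) (l : R) :
  u x @[x --> F] --> l -> atan (u x) @[x --> F] --> atan l.
Proof. by move=> ul; apply: (cvg_comp u (@atan R) ul); exact: continuous_atan. Qed.

Lemma cvgy_div {T} (F : set_system T) {FF : Filter F} (u v : T -> R) (l : R) :
  0 < l -> u x @[x --> F] --> l -> v x @[x --> F] --> 0 ->
  (\forall x \near F, 0 < v x) -> u x / v x @[x --> F] --> +oo.
Proof.
move=> l0 ul v0 vp; apply/cvgryPge => A.
have e0 : 0 < l / 2 / (`|A| + 1) by rewrite divr_gt0 ?divr_gt0// ltr_wpDl.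
near=> x.
have ux : l / 2 <= u x by near: x; apply: (cvgr_ge _ ul); lra.
have vx : 0 < v x by near: x.
have ve : v x <= l / 2 / (`|A| + 1) by near: x; exact: (cvgr_le _ v0 _ e0).
rewrite ler_pdivlMr//; apply: le_trans ux.
rewrite (@le_trans _ _ ((`|A| + 1) * v x))// ?ler_pM2r//.
  by rewrite (le_trans (ler_norm A))// lerDl.
by rewrite -ler_pdivlMl ?ltr_wpDl// mulrC.
Unshelve. all: by end_near. Qed.

Lemma atan_div_cvg {T} (F : set_system T) {FF : Filter F} (u v : T -> R) (l : R) :
  0 < l -> u x @[x --> F] --> l -> v x @[x --> F] --> 0 ->
  (\forall x \near F, 0 < v x) -> atan (u x / v x) @[x --> F] --> pi / 2.
Proof.
move=> l0 ul v0 vp.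
exact: (cvg_comp _ (@atan R) (cvgy_div l0 ul v0 vp) (@cvgy_atan R)).
Qed.

Lemma cvgy_sqrt : Num.sqrt x @[x --> +oo] --> (+oo : set_system R).
Proof.
apply/cvgryPge => A; near=> x.
rewrite (le_trans (ler_norm A))// -sqrtr_sqr; apply: ler_wsqrtr.
near: x; apply: nbhs_pinfty_ge; exact: num_real.
Unshelve. all: by end_near. Qed.

(** The primitive is [2 / sqrt c * atan (sqrt s / sqrt c)]. This weight majorises most integrals
    over heat time below: a singularity [s^(-1/2)] at 0 combined with the decay [1 / (c + s)] of a
    time derivative. *)
Lemma integral_sqrt_cauchy c : 0 < c ->
  mu.-integrable `]0, +oo[ (EFin \o (fun s => (Num.sqrt s * (c + s))^-1)) /\
  \int[mu]_(s in `]0, +oo[) (Num.sqrt s * (c + s))^-1 = pi / Num.sqrt c.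
Proof.
move=> c0; have rc : 0 < Num.sqrt c by rewrite sqrtr_gt0.
have -> : pi / Num.sqrt c = 2 / Num.sqrt c * (pi / 2) - 0 by field; lra.
apply: (@ftc_oy R (fun s => (Num.sqrt s * (c + s))^-1)
  (fun s => 2 / Num.sqrt c * atan (Num.sqrt s / Num.sqrt c)) 0 0 _).
- move=> s s0; have rs : 0 < Num.sqrt s by rewrite sqrtr_gt0.
  isDeq; rewrite ?gt_eqF//.
  rewrite -[X in _ = (_ * (X + _))^-1](sqr_sqrtr (ltW c0)).
  rewrite -[X in _ = (_ * (_ + X))^-1](sqr_sqrtr (ltW s0)).
  field; rewrite !gt_eqF//=; nra.
- move=> s s0; have rs : 0 < Num.sqrt s by rewrite sqrtr_gt0.
  isDcont => //; rewrite gt_eqF//; nra.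
- rewrite -[0 in X in _ --> X](mulr0 (2 / Num.sqrt c)); apply: cvgMr.
  rewrite -[0 in X in _ --> X](@atan0 R); apply: atan_cvg.
  rewrite -[0 in X in _ --> X](mul0r (Num.sqrt c)^-1); apply: cvgMl.
  rewrite -[0 in X in _ --> X](@sqrtr0 R); apply: sqrt_cvg.
  exact: cvg_at_right_filter.
- apply: cvgMr; apply: (@cvg_comp _ _ _ (fun s => Num.sqrt s / Num.sqrt c) (@atan R)).
    by apply: gt0_cvgMly; [rewrite invr_gt0|exact: cvgy_sqrt].
  exact: cvgy_atan.
- left=> s s0; rewrite invr_ge0 mulr_ge0 ?sqrtr_ge0//; lra.
Qed.

Lemma integral_sqrtV t : 0 < t ->
  mu.-integrable `]0, t[ (EFin \o (fun s => (Num.sqrt (t - s))^-1)) /\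
  \int[mu]_(s in `]0, t[) (Num.sqrt (t - s))^-1 = 2 * Num.sqrt t.
Proof.
move=> t0; have -> : 2 * Num.sqrt t = 0 - (- 2 * Num.sqrt t) by ring.
apply: (@ftc_oo R (fun s => (Num.sqrt (t - s))^-1)
  (fun s => - 2 * Num.sqrt (t - s)) 0 t _ 0) => //.
- move=> s /andP[s0 st]; have rs : 0 < Num.sqrt (t - s) by rewrite sqrtr_gt0 subr_gt0.
  isDeq; rewrite ?subr_gt0//.
  field; rewrite !gt_eqF//=; nra.
- move=> s /andP[s0 st]; have rs : 0 < Num.sqrt (t - s) by rewrite sqrtr_gt0 subr_gt0.
  isDcont => //; rewrite ?gt_eqF// subr_gt0//.
- apply: cvgMr; apply: sqrt_cvg; rewrite -[X in _ --> X]subr0.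
  apply: cvgB; [exact: cvg_cst|exact: cvg_at_right_filter].
- rewrite -[X in _ --> X](mulr0 (- 2)); apply: cvgMr.
  rewrite -(@sqrtr0 R) -(subrr t); apply: sqrt_cvg.
  apply: cvgB; [exact: cvg_cst|exact: cvg_at_left_filter].
- by left=> s _; rewrite invr_ge0 sqrtr_ge0.
Qed.

Lemma integral_sqrtV_diff t : 0 < t ->
  mu.-integrable `]0, +oo[
    (EFin \o (fun s => (Num.sqrt s)^-1 - (Num.sqrt (t + s))^-1)) /\
  \int[mu]_(s in `]0, +oo[) ((Num.sqrt s)^-1 - (Num.sqrt (t + s))^-1) =
  2 * Num.sqrt t.
Proof.
move=> t0; have -> : 2 * Num.sqrt t = 0 - (- 2 * Num.sqrt t) by ring.
apply: (@ftc_oy R (fun s => (Num.sqrt s)^-1 - (Num.sqrt (t + s))^-1)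
  (fun s => 2 * (Num.sqrt s - Num.sqrt (t + s))) 0 _ 0).
- move=> s s0; have rs : 0 < Num.sqrt s by rewrite sqrtr_gt0.
  have ts : 0 < t + s by lra.
  have rts : 0 < Num.sqrt (t + s) by rewrite sqrtr_gt0.
  isDeq; rewrite ?gt_eqF//.
  field; rewrite !gt_eqF//=; nra.
- move=> s s0; have rs : 0 < Num.sqrt s by rewrite sqrtr_gt0.
  have ts : 0 < t + s by lra.
  have rts : 0 < Num.sqrt (t + s) by rewrite sqrtr_gt0.
  isDcont => //; rewrite gt_eqF//.
- rewrite mulNr -mulrN -[- Num.sqrt t]add0r; apply: cvgMr; apply: cvgB.
    rewrite -[X in _ --> X](@sqrtr0 R); apply: sqrt_cvg.
    exact: cvg_at_right_filter.
  apply: sqrt_cvg; rewrite -[X in _ --> X]addr0.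
  apply: cvgD; [exact: cvg_cst|exact: cvg_at_right_filter].
- rewrite -[0 in X in _ --> X](mulr0 2); apply: cvgMr.
  apply/cvgr0Pnorm_le => e e0; near=> s.
  have s0 : 0 < s by near: s; apply: nbhs_pinfty_gt; exact: num_real.
  have rs : 0 < Num.sqrt s by rewrite sqrtr_gt0.
  have rts : Num.sqrt s <= Num.sqrt (t + s) by rewrite ler_wsqrtr//; lra.
  rewrite ler0_norm ?subr_le0// opprB.
  (* The difference of the roots is [t / (sqrt (t + s) + sqrt s)], hence at most [t / sqrt s]. *)
  have : t / e <= Num.sqrt s.
    by near: s; move/cvgryPge : cvgy_sqrt; exact.
  rewrite ler_pdivrMr// => H.
  have : Num.sqrt (t + s) ^+ 2 = t + s by rewrite sqr_sqrtr//; lra.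
  have : Num.sqrt s ^+ 2 = s by rewrite sqr_sqrtr//; lra.
  nra.
- left=> s s0; rewrite subr_ge0 lef_pV2 ?posrE ?sqrtr_gt0//; last by lra.
  rewrite ler_wsqrtr//; lra.
Unshelve. all: by end_near. Qed.

(** Each summand has a primitive of the form [2 * atan (sqrt (a + s) / sqrt (c - s))], with [a = 0]
    or [a = t]. At the right end both arctangents tend to pi/2 and cancel, so only the second one at
    [s = 0] contributes. *)
Lemma integral_sqrt_theta t (c : R) : 0 < t -> 0 < c ->
  mu.-integrable `]0, c[
    (EFin \o (fun s => ((Num.sqrt s)^-1 - (Num.sqrt (t + s))^-1) / Num.sqrt (c - s))) /\
  \int[mu]_(s in `]0, c[) (((Num.sqrt s)^-1 - (Num.sqrt (t + s))^-1) / Num.sqrt (c - s)) =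
  2 * atan (Num.sqrt t / Num.sqrt c).
Proof.
move=> t0 c0; have rc : 0 < Num.sqrt c by rewrite sqrtr_gt0.
have -> : 2 * atan (Num.sqrt t / Num.sqrt c) =
   2 * (pi / 2 - pi / 2) - 2 * (0 - atan (Num.sqrt t / Num.sqrt c)) by ring.
apply: (@ftc_oo R
  (fun s => ((Num.sqrt s)^-1 - (Num.sqrt (t + s))^-1) / Num.sqrt (c - s))
  (fun s => 2 * (atan (Num.sqrt s / Num.sqrt (c - s)) -
   atan (Num.sqrt (t + s) / Num.sqrt (c - s)))) 0 c
  (2 * (0 - atan (Num.sqrt t / Num.sqrt c))) (2 * (pi / 2 - pi / 2))) => //.
- move=> s /andP[s0 sc].
  have rs : 0 < Num.sqrt s by rewrite sqrtr_gt0.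
  have cs : 0 < c - s by lra.
  have rcs : 0 < Num.sqrt (c - s) by rewrite sqrtr_gt0.
  have ts : 0 < t + s by lra.
  have rts : 0 < Num.sqrt (t + s) by rewrite sqrtr_gt0.
  isDeq; rewrite ?gt_eqF//.
  have e1 : s = Num.sqrt s ^+ 2 by rewrite sqr_sqrtr//; lra.
  have e2 : Num.sqrt (c - s) ^+ 2 = c - s by rewrite sqr_sqrtr//; lra.
  have e3 : Num.sqrt (t + s) ^+ 2 = t + s by rewrite sqr_sqrtr//; lra.
  move: e1 e2 e3 rs rcs rts; move: (Num.sqrt s) (Num.sqrt (c - s)) (Num.sqrt (t + s)).
  move=> A B C e1 e2 e3 A0 B0 C0.
  have -> : 1 + (A / B) ^+ 2 = c / B ^+ 2.
    by rewrite expr_div_n -e1 e2; field; lra.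
  have -> : 1 + (C / B) ^+ 2 = (t + c) / B ^+ 2.
    by rewrite expr_div_n e3 e2; field; lra.
  have cE : c = B ^+ 2 + A ^+ 2 by lra.
  have tE : t + c = B ^+ 2 + C ^+ 2 by lra.
  rewrite tE cE; field; rewrite !gt_eqF//=; nra.
- move=> s /andP[s0 sc].
  have cs : 0 < c - s by lra.
  have ts : 0 < t + s by lra.
  by isDcont => //; rewrite gt_eqF// sqrtr_gt0.
- apply: cvgMr; apply: cvgB.
    have E : 0 = atan (Num.sqrt 0 / Num.sqrt (c - 0)) by rewrite sqrtr0 mul0r atan0.
    rewrite [X in _ --> X]E; apply: atan_cvg.
    apply: cvgM; first by apply: sqrt_cvg; exact: cvg_at_right_filter.
    apply: cvgV; first by rewrite subr0 gt_eqF.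
    by apply: sqrt_cvg; apply: cvgB; [exact: cvg_cst|exact: cvg_at_right_filter].
  apply: atan_cvg; rewrite -[in X in _ --> X](subr0 c) -[in X in _ --> X](addr0 t).
  apply: cvgM.
    by apply: sqrt_cvg; apply: cvgD; [exact: cvg_cst|exact: cvg_at_right_filter].
  apply: cvgV; first by rewrite subr0 gt_eqF.
  by apply: sqrt_cvg; apply: cvgB; [exact: cvg_cst|exact: cvg_at_right_filter].
- have v0 : Num.sqrt (c - s) @[s --> c^'-] --> 0.
    rewrite -[X in _ --> X](@sqrtr0 R) -(subrr c); apply: sqrt_cvg.
    apply: cvgB; [exact: cvg_cst|exact: cvg_at_left_filter].
  have vp : \forall s \near c^'-, 0 < Num.sqrt (c - s).
    by near=> s; rewrite sqrtr_gt0 subr_gt0.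
  have st : Num.sqrt s @[s --> c^'-] --> Num.sqrt c.
    by apply: sqrt_cvg; exact: cvg_at_left_filter.
  have stc : Num.sqrt (t + s) @[s --> c^'-] --> Num.sqrt (t + c).
    by apply: sqrt_cvg; apply: cvgD; [exact: cvg_cst|exact: cvg_at_left_filter].
  have rtc : 0 < Num.sqrt (t + c) by rewrite sqrtr_gt0 addr_gt0.
  apply: cvgMr; apply: cvgB; first exact: (atan_div_cvg rc st v0 vp).
  exact: (atan_div_cvg rtc stc v0 vp).
- left=> s /andP[s0 sc]; rewrite divr_ge0 ?sqrtr_ge0//.
  rewrite subr_ge0 lef_pV2 ?posrE ?sqrtr_gt0//; last by lra.
  rewrite ler_wsqrtr//; lra.
Unshelve. all: by end_near. Qed.

(** The substitution $w=\sqrt{r/(t-r)}$ makes the integrand rational; with $k^2=(t+s)/s$ it becomes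
    $2\,(1+w^2)^{-1}-2\,(1+k^2w^2)^{-1}$, whence the two arctangents. This integral is the
    convolution of [qk] with $T^{-1/2}$ up to a constant factor. *)
Lemma integral_sqrt_kernel (s t : R) : 0 < s -> 0 < t ->
  mu.-integrable `]0, t[
    (EFin \o (fun r => Num.sqrt r / ((s + r) * Num.sqrt (t - r)))) /\
  \int[mu]_(r in `]0, t[) (Num.sqrt r / ((s + r) * Num.sqrt (t - r))) =
  pi * (1 - Num.sqrt s / Num.sqrt (t + s)).
Proof.
move=> s0 t0; pose k := Num.sqrt ((t + s) / s).
have ts : 0 < t + s by lra.
have k0 : 0 < k by rewrite sqrtr_gt0 divr_gt0.
have k2 : k ^+ 2 = (t + s) / s by rewrite sqr_sqrtr// divr_ge0// ltW.
have kE : k^-1 = Num.sqrt s / Num.sqrt (t + s).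
  by rewrite /k sqrtrM ?(ltW ts)// sqrtrV ?(ltW s0)// invfM invrK mulrC.
rewrite -kE.
have -> : pi * (1 - k^-1) = 2 * (pi / 2 - k^-1 * (pi / 2)) - 2 * (0 - k^-1 * 0).
  by field; lra.
apply: (@ftc_oo R (fun r => Num.sqrt r / ((s + r) * Num.sqrt (t - r)))
  (fun r => 2 * (atan (Num.sqrt r / Num.sqrt (t - r)) -
   k^-1 * atan (k * Num.sqrt r / Num.sqrt (t - r)))) 0 t
  (2 * (0 - k^-1 * 0)) (2 * (pi / 2 - k^-1 * (pi / 2)))) => //.
- move=> r /andP[r0 rt].
  have rr : 0 < Num.sqrt r by rewrite sqrtr_gt0.
  have tr : 0 < t - r by lra.
  have rtr : 0 < Num.sqrt (t - r) by rewrite sqrtr_gt0.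
  isDeq; rewrite ?gt_eqF//.
  have e1 : r = Num.sqrt r ^+ 2 by rewrite sqr_sqrtr//; lra.
  have e2 : Num.sqrt (t - r) ^+ 2 = t - r by rewrite sqr_sqrtr//; lra.
  move: e1 e2 rr rtr; move: (Num.sqrt r) (Num.sqrt (t - r)).
  move=> A B e1 e2 A0 B0.
  have -> : 1 + (A / B) ^+ 2 = t / B ^+ 2.
    by rewrite expr_div_n -e1 e2; field; lra.
  have -> : 1 + (k * A / B) ^+ 2 = t * (s + r) / (s * B ^+ 2).
    by rewrite expr_div_n exprMn k2 -e1 e2; field; lra.
  have tE : t = B ^+ 2 + A ^+ 2 by lra.
  rewrite tE e1; field; rewrite !gt_eqF//=; nra.
- move=> r /andP[r0 rt].
  have rr : 0 < Num.sqrt r by rewrite sqrtr_gt0.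
  have tr : 0 < t - r by lra.
  have rtr : 0 < Num.sqrt (t - r) by rewrite sqrtr_gt0.
  by isDcont => //; rewrite gt_eqF// mulr_gt0//; lra.
- have h (j : R) : atan (j * Num.sqrt r / Num.sqrt (t - r)) @[r --> 0^'+] --> 0.
    have E : 0 = atan (j * Num.sqrt 0 / Num.sqrt (t - 0)).
      by rewrite sqrtr0 mulr0 mul0r atan0.
    rewrite [X in _ --> X]E; apply: atan_cvg.
    apply: cvgM.
      by apply: cvgMr; apply: sqrt_cvg; exact: cvg_at_right_filter.
    apply: cvgV; first by rewrite subr0 gt_eqF// sqrtr_gt0.
    by apply: sqrt_cvg; apply: cvgB; [exact: cvg_cst|exact: cvg_at_right_filter].
  apply: cvgMr; apply: cvgB; last by apply: cvgMr; exact: h.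
  by have := h 1; under eq_fun do rewrite mul1r.
- have v0 : Num.sqrt (t - r) @[r --> t^'-] --> 0.
    rewrite -[X in _ --> X](@sqrtr0 R) -(subrr t); apply: sqrt_cvg.
    apply: cvgB; [exact: cvg_cst|exact: cvg_at_left_filter].
  have vp : \forall r \near t^'-, 0 < Num.sqrt (t - r).
    by near=> r; rewrite sqrtr_gt0 subr_gt0.
  have st : Num.sqrt r @[r --> t^'-] --> Num.sqrt t.
    by apply: sqrt_cvg; exact: cvg_at_left_filter.
  have rt : 0 < Num.sqrt t by rewrite sqrtr_gt0.
  apply: cvgMr; apply: cvgB; first exact: atan_div_cvg st v0 vp.
  apply: cvgMr; apply: (@atan_div_cvg _ _ _ _ _ (k * Num.sqrt t)) => //.
    by rewrite mulr_gt0.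
  exact: cvgMr.
- left=> r /andP[r0 rt]; rewrite divr_ge0 ?sqrtr_ge0// mulr_ge0 ?sqrtr_ge0//; lra.
Unshelve. all: by end_near. Qed.

(** The substitution [u = sqrt (s * l)] turns this into the Gaussian integral; [E], the truncated
    Gaussian integral, supplies the primitive. *)
Lemma integral_laplace_sqrt s : 0 < s ->
  mu.-integrable `]0, +oo[ (EFin \o (fun l => (Num.sqrt l)^-1 * expR (- (l * s)))) /\
  \int[mu]_(l in `]0, +oo[) ((Num.sqrt l)^-1 * expR (- (l * s))) =
  Num.sqrt pi / Num.sqrt s.
Proof.
move=> s0; have rs : 0 < Num.sqrt s by rewrite sqrtr_gt0.
pose E (x : R) := \int[mu]_(u in `[0, x]) gauss_fun u.
have ig a b : mu.-integrable `[a, b] (EFin \o (@gauss_fun R)).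
  apply: integrableS integrableT_gauss => //.
have dE x : 0 < x -> is_derive x 1 E (gauss_fun x).
  move=> x0; have x1 : x < x + 1 by rewrite ltrDl.
  have [d1 d2] := continuous_FTC1_closed x1 (ig _ _) x0 (@continuous_gauss_fun R x).
  apply: DeriveDef; [exact: d1|by rewrite -derive1E; exact: d2].
have E0 : E x @[x --> 0^'+] --> 0.
  apply: cvg_at_right_filter.
  exact: (@parameterized_integral_cvg_left R 0 1 gauss_fun ltr01 (ig _ _)).
have Ey : E x @[x --> +oo] --> Num.sqrt pi / 2.
  have -> : Num.sqrt pi / 2 = Num.sqrt (pi / 4) :> R.
    rewrite sqrtrM ?pi_ge0//; congr (_ * _).
    have -> : 4^-1 = 2^-1 ^+ 2 :> R by field.
    by rewrite sqrtr_sqr ger0_norm// invr_ge0.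
  apply: cvg_trans (sqrt_cvg (@gauss_integral_proof.cvg_integral0_gauss_sqr R)).
  apply: near_eq_cvg; near=> x.
  by rewrite sqrtr_sqr ger0_norm//; exact: gauss_integral_proof.integral0_gauss_ge0.
have -> : Num.sqrt pi / Num.sqrt s = 2 / Num.sqrt s * (Num.sqrt pi / 2) -
   2 / Num.sqrt s * 0 by field; lra.
apply: (@ftc_oy R (fun l => (Num.sqrt l)^-1 * expR (- (l * s)))
  (fun l => 2 / Num.sqrt s * E (Num.sqrt s * Num.sqrt l)) 0
  (2 / Num.sqrt s * 0) (2 / Num.sqrt s * (Num.sqrt pi / 2))).
- move=> l l0; have rl : 0 < Num.sqrt l by rewrite sqrtr_gt0.
  have h1 : is_derive l 1 (fun l => Num.sqrt s * Num.sqrt l)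
      (Num.sqrt s * (2 * Num.sqrt l)^-1) by isDeq => //; ring.
  have hE := @isD_comp _ E (fun l => Num.sqrt s * Num.sqrt l) l _ _ (dE _ (mulr_gt0 rs rl)) h1.
  isDeq.
  rewrite /gauss_fun exprMn !sqr_sqrtr ?(ltW s0) ?(ltW l0)// [l * s]mulrC.
  by field; rewrite !gt_eqF.
- move=> l l0; have rl : 0 < Num.sqrt l by rewrite sqrtr_gt0.
  by isDcont => //; rewrite gt_eqF.
- apply: cvgMr; apply/cvg_at_rightP => u [u0 u0'].
  move/cvg_at_rightP : E0; apply; split.
    by move=> n; rewrite mulr_gt0// sqrtr_gt0.
  rewrite -[X in _ --> X](mulr0 (Num.sqrt s)); apply: cvgMr.
  by rewrite -[X in _ --> X](@sqrtr0 R); apply: sqrt_cvg.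
- apply: cvgMr; apply: (cvg_comp (fun l => Num.sqrt s * Num.sqrt l) E _ Ey).
  by apply: gt0_cvgMry => //; exact: cvgy_sqrt.
- by left=> l _; rewrite mulr_ge0 ?invr_ge0 ?sqrtr_ge0 ?expR_ge0.
Unshelve. all: by end_near. Qed.

Lemma Gamma_half : Gamma 2^-1 = Num.sqrt pi :> R.
Proof.
have := (integral_laplace_sqrt (@ltr01 R)).2; rewrite sqrtr1 divr1 => <-.
rewrite /Gamma; apply: eq_Rintegral => s /[!inE]/=; rewrite in_itv/= andbT => s0.
rewrite mulr1 (_ : 2^-1 - 1 = - 2^-1)//; last by field.
by rewrite powRN powR12_sqrt// ltW.
Qed.

End special_integrals.

(** * The exponential integral *)

Section exponential_integral.
Context {R : realType}.
Notation mu := (@lebesgue_measure R).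
Implicit Types (s t x z : R).

(** A zero integral would make the positive function vanish almost everywhere on a set of nonzero
    measure. The strict inequalities for [E1] come from here. *)
Lemma Rintegral_gt0 (D : set R) (f : R -> R) : measurable D ->
  mu D != 0%E -> mu.-integrable D (EFin \o f) -> (forall x, D x -> 0 < f x) ->
  0 < \int[mu]_(x in D) f x.
Proof.
move=> mD D0 jf f0; have jf' := jf; case/integrableP: jf' => mf _.
rewrite lt_neqAle; apply/andP; split; last first.
  by apply: Rintegral_ge0 => x Dx; rewrite ltW// f0.
apply/eqP => /esym I0.
have : (\int[mu]_(x in D) `|(EFin \o f) x| = 0)%E.
  rewrite -[RHS]/(0%:E) -I0 /Rintegral fineK; last exact: integrable_fin_num.
  apply: eq_integral => x /set_mem Dx /=; by rewrite gtr0_norm// f0.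
move/(ae_eq_integral_abs mu mD mf) => [N [mN N0 DN]].
move: D0; rewrite (@subset_measure0 _ _ _ mu D N)// ?eqxx// => x Dx.
apply: DN => /= /(_ Dx)[] fx0; move: (f0 _ Dx); by rewrite fx0 ltxx.
Qed.

Lemma lebesgue_measure_itvoy_neq0 z : mu `]z, +oo[ != 0%E.
Proof. by rewrite lebesgue_measure_itv/= ltry. Qed.

Lemma expRN_mulK z x : expR z * (expR (- z) * x) = x.
Proof. by rewrite mulrA -expRD subrr expR0 mul1r. Qed.

Lemma ln1V_gt x : 0 < x -> (x + 1)^-1 < ln (1 + x^-1).
Proof.
move=> x0; have y1 : 1 < 1 + x^-1 by rewrite ltrDl invr_gt0.
have w0 : - ln (1 + x^-1) != 0 by rewrite oppr_eq0 gt_eqF// ln_gt0.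
have := expR_gt1Dx w0; rewrite expRN lnK ?posrE; last by lra.
have -> : (1 + x^-1)^-1 = 1 - (x + 1)^-1 by field; lra.
lra.
Qed.

Lemma ln1V_le x : 0 < x -> ln (1 + x^-1) <= x^-1.
Proof. by move=> x0; apply: le_ln1Dx; rewrite (@lt_trans _ _ 0)// invr_gt0. Qed.

Lemma cvgV_y : x^-1 @[x --> +oo] --> (0 : R).
Proof. by apply/gtr0_cvgV0 => //; near=> x; near: x; exact: nbhs_pinfty_gt.
Unshelve. all: by end_near. Qed.

Lemma cvg_expRN : expR (- x) @[x --> +oo] --> (0 : R).
Proof. exact: cvgr_expR. Qed.

(** By convexity of 1/s the trapezoidal rule overestimates the integral of 1/s over [x, x + 2],
    which is the logarithm. The error tends to 0 at infinity and its derivative is, up to sign, the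
    square [f]. *)
Lemma ln_lt_trapezoid x : 0 < x -> ln (1 + 2 / x) < x^-1 + (x + 2)^-1.
Proof.
move=> x0.
pose f s := (s^-1 - (s + 2)^-1) ^+ 2.
pose F s := ln (1 + 2 / s) - (s^-1 + (s + 2)^-1).
have [jf fE] : mu.-integrable `]x, +oo[ (EFin \o f) /\
    \int[mu]_(s in `]x, +oo[) f s = 0 - F x.
  have xs s : x < s -> 0 < s by move=> /(lt_trans x0).
  have dF s : 0 < s -> is_derive s 1 F (f s).
    move=> s0; have s1 : 0 < 1 + 2 / s by rewrite addr_gt0// divr_gt0.
    rewrite /F; isDeq; rewrite ?gt_eqF//; first by lra.
    by rewrite /f; field; rewrite !gt_eqF//; lra.
  apply: (@ftc_oy R f F x (F x) 0).
  - by move=> s /xs; exact: dF.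
  - move=> s /xs s0; rewrite /f; isDcont; rewrite gt_eqF//; lra.
  - by apply: cvg_at_right_filter; exact: isD_continuous (dF _ x0).
  - have v0 := cvgV_y.
    have -> : 0 = ln (1 + 2 * 0) - (0 + 0) :> R by rewrite mulr0 !addr0 ln1 subr0.
    have v2 : (s + 2)^-1 @[s --> +oo] --> (0 : R).
      apply: (cvg_comp (fun s => s + 2) GRing.inv _ v0); exact: cvg_addrr.
    apply: cvgB; last by apply: cvgD.
    have w : 1 + 2 / s @[s --> +oo] --> (1 + 2 * 0 : R).
      by apply: cvgD; [exact: cvg_cst|apply: cvgMr].
    apply: (cvg_comp (fun s => 1 + 2 / s) (@ln R) w).
    by apply: continuous_ln; lra.
  - by left=> s _; exact: sqr_ge0.
have : 0 < \int[mu]_(s in `]x, +oo[) f s.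
  apply: Rintegral_gt0 => //; first exact: lebesgue_measure_itvoy_neq0.
  move=> s /=; rewrite in_itv/= andbT => xs.
  have s0 : 0 < s by lra.
  rewrite exprn_even_gt0//= subr_eq0; apply/eqP => /invr_inj; lra.
by rewrite fE /F; lra.
Qed.

(** Writing the upper bound as the integral of minus its derivative reduces the comparison with [E1]
    to integrands: these differ by [exp (- x) * (ln (1 + 1/x) - 1/(x + 1))], which is positive by
    [ln1V_gt]. *)
Let upper_ftc z : 0 < z ->
  mu.-integrable `]z, +oo[ (EFin \o (fun x =>
     expR (- x) * (ln (1 + x^-1) + x^-1 - (x + 1)^-1))) /\
  \int[mu]_(x in `]z, +oo[)
     (expR (- x) * (ln (1 + x^-1) + x^-1 - (x + 1)^-1)) =
  expR (- z) * ln (1 + z^-1).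
Proof.
move=> z0; pose F x := - (expR (- x) * ln (1 + x^-1)).
have zx x : z < x -> 0 < x by move=> /(lt_trans z0).
have p1 x : 0 < x -> 0 < 1 + x^-1 by move=> x0; rewrite addr_gt0// invr_gt0.
have dF x : 0 < x -> is_derive x 1 F
    (expR (- x) * (ln (1 + x^-1) + x^-1 - (x + 1)^-1)).
  move=> x0; rewrite /F; isDeq; rewrite ?gt_eqF//; first exact: p1.
  by field; rewrite !gt_eqF//; lra.
have -> : expR (- z) * ln (1 + z^-1) = 0 - F z by rewrite /F; lra.
apply: (@ftc_oy R (fun x => expR (- x) * (ln (1 + x^-1) + x^-1 - (x + 1)^-1))
  F z (F z) 0).
- by move=> x /zx; exact: dF.
- by move=> x /zx x0; isDcont; rewrite ?gt_eqF ?p1//; lra.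
- by apply: cvg_at_right_filter; exact: isD_continuous (dF _ z0).
- have -> : 0 = - (0 * ln (1 + 0)) :> R by rewrite mul0r oppr0.
  apply: cvgN; apply: cvgM; first exact: cvg_expRN.
  have w : 1 + s^-1 @[s --> +oo] --> (1 + 0 : R).
    by apply: cvgD; [exact: cvg_cst|exact: cvgV_y].
  apply: (cvg_comp (fun s => 1 + s^-1) (@ln R) w).
  by apply: continuous_ln; lra.
- left=> x /zx x0; rewrite mulr_ge0 ?expR_ge0//.
  have := ln1V_gt x0; have : 0 < x^-1 by rewrite invr_gt0.
  lra.
Qed.

(** The same device for the lower bound. Here the difference of the integrands is half of
    [exp (- x)] times the trapezoidal error of [ln_lt_trapezoid]. *)
Let lower_ftc z : 0 < z ->
  mu.-integrable `]z, +oo[ (EFin \o (fun x =>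
     expR (- x) * (2^-1 * (ln (1 + 2 / x) + x^-1 - (x + 2)^-1)))) /\
  \int[mu]_(x in `]z, +oo[)
     (expR (- x) * (2^-1 * (ln (1 + 2 / x) + x^-1 - (x + 2)^-1))) =
  expR (- z) * (2^-1 * ln (1 + 2 / z)).
Proof.
move=> z0; pose F x := - (expR (- x) * (2^-1 * ln (1 + 2 / x))).
have zx x : z < x -> 0 < x by move=> /(lt_trans z0).
have p1 x : 0 < x -> 0 < 1 + 2 / x by move=> x0; rewrite addr_gt0// divr_gt0.
have dF x : 0 < x -> is_derive x 1 F
    (expR (- x) * (2^-1 * (ln (1 + 2 / x) + x^-1 - (x + 2)^-1))).
  move=> x0; rewrite /F; isDeq; rewrite ?gt_eqF//; first exact: p1.
  by field; rewrite !gt_eqF//; lra.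
have -> : expR (- z) * (2^-1 * ln (1 + 2 / z)) = 0 - F z by rewrite /F; lra.
apply: (@ftc_oy R
  (fun x => expR (- x) * (2^-1 * (ln (1 + 2 / x) + x^-1 - (x + 2)^-1)))
  F z (F z) 0).
- by move=> x /zx; exact: dF.
- by move=> x /zx x0; isDcont; rewrite ?gt_eqF ?p1//; lra.
- by apply: cvg_at_right_filter; exact: isD_continuous (dF _ z0).
- have -> : 0 = - (0 * (2^-1 * ln (1 + 2 * 0))) :> R by rewrite mul0r oppr0.
  apply: cvgN; apply: cvgM; first exact: cvg_expRN.
  have w : 1 + 2 / s @[s --> +oo] --> (1 + 2 * 0 : R).
    by apply: cvgD; [exact: cvg_cst|apply: cvgMr; exact: cvgV_y].
  apply: cvgMr; apply: (cvg_comp (fun s => 1 + 2 / s) (@ln R) w).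
  by apply: continuous_ln; lra.
- left=> x /zx x0; rewrite mulr_ge0 ?expR_ge0// mulr_ge0//.
  have : 0 <= ln (1 + 2 / x) by rewrite ln_ge0// lerDl divr_ge0// ltW.
  have : (x + 2)^-1 < x^-1 by rewrite ltf_pV2 ?posrE; lra.
  lra.
Qed.

Lemma E1_integrable z : 0 < z ->
  mu.-integrable `]z, +oo[ (EFin \o (fun x => expR (- x) / x)).
Proof.
move=> z0; apply: le_intble (upper_ftc z0).1 _ => //.
  apply: open_continuous_measurable_fun; first exact: itv_open_ends_open.
  move=> x; rewrite inE/= in_itv/= andbT => zx.
  by isDcont; rewrite gt_eqF//; lra.
move=> x /=; rewrite in_itv/= andbT => zx; have x0 : 0 < x by lra.
rewrite ger0_norm ?divr_ge0 ?expR_ge0 ?(ltW x0)// ler_wpM2l ?expR_ge0//.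
have := ln1V_gt x0; lra.
Qed.

Lemma E1E z : 0 < z -> E1 z = \int[mu]_(x in `]z, +oo[) (expR (- x) / x).
Proof.
move=> z0; rewrite /E1 Rintegral_itv_obnd_cbnd//.
exact: E1_integrable z0.
Qed.

Lemma E1_lt z : 0 < z -> E1 z < expR (- z) * ln (1 + z^-1).
Proof.
move=> z0; have [ju uE] := upper_ftc z0; have je := E1_integrable z0.
rewrite -uE E1E// -subr_gt0 -RintegralB//.
apply: Rintegral_gt0 => //; first exact: lebesgue_measure_itvoy_neq0.
  by have := integrableB _ ju je; apply.
move=> x /=; rewrite in_itv/= andbT => zx; have x0 : 0 < x by lra.
have -> : expR (- x) * (ln (1 + x^-1) + x^-1 - (x + 1)^-1) - expR (- x) / x =
  expR (- x) * (ln (1 + x^-1) - (x + 1)^-1) by lra.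
by rewrite mulr_gt0 ?expR_gt0// subr_gt0 ln1V_gt.
Qed.

Lemma E1_gt z : 0 < z -> expR (- z) * (2^-1 * ln (1 + 2 / z)) < E1 z.
Proof.
move=> z0; have [ju uE] := lower_ftc z0; have je := E1_integrable z0.
rewrite -uE E1E// -subr_gt0 -RintegralB//.
apply: Rintegral_gt0 => //; first exact: lebesgue_measure_itvoy_neq0.
  by have := integrableB _ je ju; apply.
move=> x /=; rewrite in_itv/= andbT => zx; have x0 : 0 < x by lra.
have -> : expR (- x) / x - expR (- x) * (2^-1 * (ln (1 + 2 / x) + x^-1 - (x + 2)^-1)) =
  expR (- x) * (2^-1 * (x^-1 + (x + 2)^-1 - ln (1 + 2 / x))) by lra.
by rewrite mulr_gt0 ?expR_gt0// mulr_gt0// subr_gt0 ln_lt_trapezoid.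
Qed.

Lemma E1_gt0 z : 0 < z -> 0 < E1 z.
Proof.
move=> z0; apply: le_lt_trans (E1_gt z0); rewrite mulr_ge0 ?expR_ge0//.
by rewrite mulr_ge0// ln_ge0// lerDl divr_ge0// ltW.
Qed.

Lemma is_derive_E1 z : 0 < z -> is_derive z 1 (@E1 R) (- (expR (- z) / z)).
Proof.
(* A fixed base point below [z]: for [x] near [z], [E1 x] is [E1 c] minus the integral over
   [[c, x]], to which the fundamental theorem applies. *)
move=> z0; pose c := z / 2; have c0 : 0 < c by rewrite divr_gt0.
have cz : c < z by rewrite /c; lra.
pose f x : R := expR (- x) / x.
have jc := E1_integrable c0.
have jc' : mu.-integrable `[c, z + 1] (EFin \o f).
  have : mu.-integrable `]c / 2, +oo[ (EFin \o f) by apply: E1_integrable; lra.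
  apply: integrableS => // x; rewrite /= !in_itv/= andbT => /andP[cx _]; lra.
have cf : {for z, continuous f} by rewrite /f; isDcont; rewrite gt_eqF.
have z1 : z < z + 1 by lra.
have [d1 d2] := continuous_FTC1_closed z1 jc' cz cf.
have dP : is_derive z 1 (fun x => \int[mu]_(t in `[c, x]) f t) (f z).
  by apply: DeriveDef; [exact: d1|rewrite -derive1E; exact: d2].
have dE : is_derive z 1 (fun x => E1 c - \int[mu]_(t in `[c, x]) f t) (- f z).
  by isDeq; rewrite add0r.
apply: near_eq_is_derive dE.
near=> x.
have cx : c < x by near: x; exact: lt_nbhsr.
have x0 : 0 < x by lra.
have jcx : mu.-integrable `[c, +oo[ (EFin \o f).
  have : mu.-integrable `]c / 2, +oo[ (EFin \o f) by apply: E1_integrable; lra.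
  apply: integrableS => // y; rewrite /= !in_itv/= !andbT => cy; lra.
rewrite (E1E x0) /E1.
have -> : (`[c, +oo[%classic : set R) = `[c, x] `|` `]x, +oo[.
  by rewrite -itv_bndbnd_setU// ?bnd_simp// ltW.
rewrite Rintegral_setU//=; first by rewrite addrC addKr.
- by rewrite -itv_bndbnd_setU// ?bnd_simp// ltW.
- apply/disj_setPS => y [] /=; rewrite !in_itv/= andbT => /andP[_ yx] xy; lra.
Unshelve. all: by end_near. Qed.

Lemma cvgy_E1 : E1 z @[z --> +oo] --> (0 : R).
Proof.
apply: (@squeeze_cvgr _ _ _ _ (fun=> 0) (fun z => expR (- z))) => //.
- near=> z; have z1 : 1 <= z by near: z; apply: nbhs_pinfty_ge; exact: num_real.
  have z0 : 0 < z by lra.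
  rewrite ltW ?E1_gt0//= ltW// (lt_le_trans (E1_lt z0))//.
  rewrite ler_piMr ?expR_ge0// (le_trans (ln1V_le z0))// invf_le1//.
- exact: cvg_cst.
- exact: cvg_expRN.
Unshelve. all: by end_near. Qed.

(** The function [E1 + ln] has derivative [(1 - exp (- x)) / x], at most 1, so it increases by at
    most 1 on [z, 1] up to the value [E1 1 > 0]. The crude constant is harmless, since [- ln z]
    tends to infinity at 0. *)
Lemma E1_ge_ln z : 0 < z < 1 -> - ln z - 1 <= E1 z.
Proof.
move=> /andP[z0 z1].
have dE x : 0 < x -> is_derive x 1 (fun x => E1 x + ln x) (x^-1 - expR (- x) / x).
  by move=> x0; have := is_derive_E1 x0 => ?; isDeq => //; rewrite mulr1 addrC.
have [| |c /andP[zc c1]] := @MVT R (fun x => E1 x + ln x)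
  (fun x => x^-1 - expR (- x) / x) z 1 z1.
- by move=> x; rewrite in_itv/= => /andP[zx x1]; apply: dE; lra.
- apply: continuous_in_subspaceT => x; rewrite inE/= in_itv/= => /andP[zx _].
  by apply: (isD_continuous (dE x _)); lra.
move: zc c1; rewrite !bnd_simp => zc c1; rewrite ln1 addr0 => EE.
have c0 : 0 < c by lra.
have h1 : c^-1 - expR (- c) / c <= 1.
  rewrite -[X in X - _]mul1r -mulrBl ler_pdivrMr// mul1r.
  by have := expR_ge1Dx (- c); lra.
have := @E1_gt0 1 ltr01.
nra.
Qed.

(** The logarithmic bounds already give the limit: the upper one with [ln (1 + 1/z) <= 1/z], the
    lower one with [ln1V_gt] at [z / 2]. *)
Lemma E1_asymp_y : z * (expR z * E1 z) @[z --> +oo] --> (1 : R).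
Proof.
apply: (@squeeze_cvgr _ _ _ _ (fun z => (1 + 2 / z)^-1) (fun=> 1)).
- near=> z; have z0 : 0 < z by near: z; apply: nbhs_pinfty_gt; exact: num_real.
  apply/andP; split.
    have /ltW := E1_gt z0; rewrite -(ler_pM2l (expR_gt0 z)) expRN_mulK.
    rewrite -(ler_pM2l z0); apply: le_trans.
    have z2 : 0 < z / 2 by lra.
    have := ln1V_gt z2; rewrite invf_div => H.
    have -> : (1 + 2 / z)^-1 = z * (2^-1 * (z / 2 + 1)^-1) by field; lra.
    by rewrite ler_pM2l// ler_pM2l// ltW.
  have /ltW := E1_lt z0; rewrite -(ler_pM2l (expR_gt0 z)) expRN_mulK.
  move=> /le_trans/(_ (ln1V_le z0)); rewrite -(ler_pM2l z0) divff//; lra.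
- rewrite -[X in _ --> X]invr1; apply: cvgV => //.
  rewrite -[X in _ --> X]addr0 -[X in _ --> _ + X](mulr0 2).
  by apply: cvgD; [exact: cvg_cst|apply: cvgMr; exact: cvgV_y].
- exact: cvg_cst.
Unshelve. all: by end_near. Qed.

Lemma cvg_lnV0 : (- ln z)^-1 @[z --> 0^'+] --> (0 : R).
Proof.
apply/gtr0_cvgV0.
  by near=> z; rewrite oppr_gt0 ln_lt0//; apply/andP; split.
apply/cvgryPge => A; near=> z.
have z0 : 0 < z by [].
rewrite lerNr -ler_expR lnK//; near: z; apply: nbhs_right_le; exact: expR_gt0.
Unshelve. all: by end_near. Qed.

Lemma E1_asymp_0 : expR z * E1 z / (- ln z) @[z --> 0^'+] --> (1 : R).
Proof.
apply: (@squeeze_cvgr _ _ _ _ (fun z => 1 - (- ln z)^-1) (fun z => 1 + z * (- ln z)^-1)).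
- near=> z.
  have z0 : 0 < z by [].
  have z1 : z < 1 by near: z; exact: nbhs_right_lt.
  have l0 : 0 < - ln z by rewrite oppr_gt0 ln_lt0// z0.
  apply/andP; split.
    rewrite -[X in X - _](divff (lt0r_neq0 l0)) -[X in _ - X]mul1r -mulrBl.
    rewrite ler_pM2r ?invr_gt0// (le_trans (@E1_ge_ln z _)) ?z0//.
    by rewrite ler_peMl ?ltW ?E1_gt0// expR_gt1.
  rewrite -[X in X + _](divff (lt0r_neq0 l0)) -mulrDl ler_pM2r ?invr_gt0//.
  have /ltW := E1_lt z0; rewrite -(ler_pM2l (expR_gt0 z)) expRN_mulK.
  move=> /le_trans; apply.
  (* Splits the upper bound as [ln (1 + z) - ln z], whose first term is at most [z]. *)
  have -> : 1 + z^-1 = (1 + z) * z^-1 by field; lra.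
  rewrite lnM ?posrE ?invr_gt0//; last by lra.
  rewrite lnV ?posrE// addrC lerD2l; apply: le_ln1Dx; lra.
- rewrite -[X in _ --> X]subr0; apply: cvgB; [exact: cvg_cst|exact: cvg_lnV0].
- rewrite -[X in _ --> X]addr0 -[X in _ --> _ + X](mulr0 0); apply: cvgD.
    exact: cvg_cst.
  by apply: cvgM; [exact: cvg_at_right_filter|exact: cvg_lnV0].
Unshelve. all: by end_near. Qed.

End exponential_integral.

(** * The heat kernel *)

Definition hk {R : realType} (t y : R) : R :=
  (Num.sqrt (4 * pi * t))^-1 * expR (- (y ^+ 2 / (4 * t))).

(** By the heat equation this is both the second space derivative and the time derivative of [hk];
    see [is_derive_hk1] and [is_derive_hk_time]. *)
Definition hk2 {R : realType} (t y : R) : R :=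
  (y ^+ 2 / (4 * t ^+ 2) - (2 * t)^-1) * hk t y.

Section heat_kernel.
Context {R : realType}.
Notation mu := (@lebesgue_measure R).
Implicit Types (s t x y a b : R).

Let c0 t : 0 < t -> 0 < 4 * pi * t.
Proof. by move=> t0; rewrite !mulr_gt0// pi_gt0. Qed.

Lemma hk_gt0 t y : 0 < t -> 0 < hk t y.
Proof. by move=> t0; rewrite mulr_gt0 ?expR_gt0// invr_gt0 sqrtr_gt0 c0. Qed.

Lemma hk_ge0 t y : 0 < t -> 0 <= hk t y.
Proof. by move=> t0; rewrite ltW// hk_gt0. Qed.

Lemma is_derive_hk t y : 0 < t -> is_derive y 1 (hk t) (- (y / (2 * t)) * hk t y).
Proof.
move=> t0; rewrite /hk; isDeq.
by field; rewrite !gt_eqF// ?sqrtr_gt0 ?c0.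
Qed.

Lemma is_derive_hk1 t y : 0 < t ->
  is_derive y 1 (fun y => - (y / (2 * t)) * hk t y) (hk2 t y).
Proof.
move=> t0; have := is_derive_hk y t0 => ?.
have h : is_derive y 1 (fun y => hk t y) (- (y / (2 * t)) * hk t y) by [].
isDeq; rewrite /hk2; field; lra.
Qed.

Lemma is_derive_hk_time t y : 0 < t -> is_derive t 1 (hk^~ y) (hk2 t y).
Proof.
move=> t0; have rt : 0 < Num.sqrt (4 * pi * t) by rewrite sqrtr_gt0 c0.
rewrite /hk; isDeq; rewrite ?gt_eqF ?c0//; first by lra.
rewrite /hk2 /hk.
have e : t = Num.sqrt (4 * pi * t) ^+ 2 / (4 * pi).
  by rewrite sqr_sqrtr ?ltW ?c0//; field; have := @pi_gt0 R; lra.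
have p0 := @pi_gt0 R.
move: (expR _) e rt => E; move: (Num.sqrt _) => A e A0.
move: (pi : R) p0 e => P p0 e; rewrite e; field.
by rewrite (gt_eqF A0) (gt_eqF p0).
Qed.

Lemma continuous_hk t : 0 < t -> continuous (hk t).
Proof. by move=> t0 y; exact: isD_continuous (is_derive_hk y t0). Qed.

Lemma continuous_hk_shift t b : 0 < t -> continuous (fun y => hk t (y - b)).
Proof.
move=> t0 y; apply: (@continuous_comp _ _ _ (fun y => y - b) (hk t)).
  by isDcont.
exact: continuous_hk.
Qed.

Lemma measurable_hk t b : 0 < t -> measurable_fun setT (fun y => hk t (y - b)).
Proof. by move=> t0; apply: continuous_measurable_fun; exact: continuous_hk_shift. Qed.

Lemma measurable_hk2 t b : 0 < t -> measurable_fun setT (fun y => hk2 t (y - b)).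
Proof.
move=> t0; apply: measurable_funM; last exact: measurable_hk.
by apply: continuous_measurable_fun => y; isDcont; rewrite gt_eqF.
Qed.

Lemma hk_normal t b y : 0 < t -> hk t (y - b) = normal_pdf b (Num.sqrt (2 * t)) y.
Proof.
move=> t0; have t2 : 0 < 2 * t by lra.
rewrite normal_pdfE ?gt_eqF ?sqrtr_gt0// /normal_peak /normal_fun.
rewrite sqr_sqrtr ?ltW// /hk; congr (_ * _).
  by congr ((Num.sqrt _)^-1); ring.
by congr expR; rewrite -mulr_natr; field; lra.
Qed.

Lemma integrable_hk t b : 0 < t -> mu.-integrable setT (EFin \o (fun y => hk t (y - b))).
Proof.
move=> t0; have := @integrable_normal_pdf R b (Num.sqrt (2 * t)).
by apply: eq_integrable => // y _ /=; rewrite hk_normal.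
Qed.

Lemma integral_hk t b : 0 < t -> \int[mu]_y hk t (y - b) = 1.
Proof.
move=> t0; rewrite /Rintegral.
under eq_integral do rewrite hk_normal//.
by rewrite integral_normal_pdf.
Qed.

(** Completing the square: a product of two Gaussians is a Gaussian around the weighted mean, times
    the Gaussian of the distance of the centres. The semigroup law follows by integrating in [y]. *)
Lemma hk_mul s t a b y : 0 < s -> 0 < t ->
  hk s (y - a) * hk t (y - b) =
  hk (s + t) (a - b) * hk (s * t / (s + t)) (y - (t * a + s * b) / (s + t)).
Proof.
move=> s0 t0; have st0 : 0 < s + t by lra.
have stt : 0 < s * t / (s + t) by rewrite divr_gt0// mulr_gt0.
rewrite /hk mulrACA [RHS]mulrACA; congr (_ * _).
  rewrite -!invfM -!sqrtrM ?ltW ?c0//; congr ((Num.sqrt _)^-1).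
  by field; lra.
rewrite -!expRD; congr expR.
by field; rewrite !gt_eqF//=.
Qed.

Lemma hk_semigroup s t a b : 0 < s -> 0 < t ->
  \int[mu]_y (hk s (y - a) * hk t (y - b)) = hk (s + t) (a - b).
Proof.
move=> s0 t0; have stt : 0 < s * t / (s + t) by rewrite divr_gt0 ?mulr_gt0 ?addr_gt0.
under eq_Rintegral do rewrite hk_mul//.
rewrite RintegralZl//; last exact: integrable_hk.
by rewrite integral_hk// mulr1.
Qed.

Lemma hk_le_peak t y : 0 < t -> hk t y <= (Num.sqrt (4 * pi * t))^-1.
Proof.
move=> t0; rewrite ler_piMr ?invr_ge0 ?sqrtr_ge0//.
by rewrite -expR0 ler_expR oppr_le0 divr_ge0 ?sqr_ge0// mulr_ge0// ltW.
Qed.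

Lemma hk_le_time s t y : 0 < s -> s <= t -> hk s y <= Num.sqrt (t / s) * hk t y.
Proof.
move=> s0 st; have t0 : 0 < t by lra.
have -> : Num.sqrt (t / s) * hk t y =
    (Num.sqrt (4 * pi * s))^-1 * expR (- (y ^+ 2 / (4 * t))).
  rewrite /hk mulrA; congr (_ * _).
  have rs := c0 s0; have rt := c0 t0.
  have ts : 0 < t / s by rewrite divr_gt0.
  have -> : Num.sqrt (4 * pi * t) = Num.sqrt (4 * pi * s) * Num.sqrt (t / s).
    by rewrite -sqrtrM ?(ltW rs)//; congr Num.sqrt; field; lra.
  by field; rewrite !gt_eqF ?sqrtr_gt0.
rewrite ler_wpM2l ?invr_ge0 ?sqrtr_ge0// ler_expR lerN2.
rewrite ler_wpM2l ?sqr_ge0// lef_pV2 ?posrE; lra.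
Qed.

(** Half of the exponent absorbs the polynomial: [u + 1/2 <= 2 * (1 + u/2) <= 2 * exp (u/2)]. *)
Let expR_half (u : R) : 0 <= u -> (u + 2^-1) * expR (- u) <= 2 * expR (- (u / 2)).
Proof.
move=> u0; have -> : - u = - (u / 2) - u / 2 by lra.
rewrite expRD mulrCA mulrC ler_wpM2r ?expR_ge0//.
rewrite expRN ler_pdivrMr ?expR_gt0//.
have := expR_ge1Dx (u / 2); lra.
Qed.

(** The quadratic factor is absorbed by doubling the width of the Gaussian. The constant is 2 from
    [expR_half] times 2, a bound for the ratio [sqrt 2] of the normalisations. *)
Lemma hk2_le t y : 0 < t -> `|hk2 t y| <= 4 / t * hk (2 * t) y.
Proof.
move=> t0; have t2 : 0 < 2 * t by lra.
pose u := y ^+ 2 / (4 * t).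
have u0 : 0 <= u by rewrite divr_ge0 ?sqr_ge0//; lra.
rewrite /hk2 normrM (ger0_norm (hk_ge0 y t0)).
have h1 : `|y ^+ 2 / (4 * t ^+ 2) - (2 * t)^-1| <= t^-1 * (u + 2^-1).
  have -> : y ^+ 2 / (4 * t ^+ 2) - (2 * t)^-1 = t^-1 * (u - 2^-1).
    by rewrite /u; field; lra.
  rewrite normrM gtr0_norm ?invr_gt0// ler_pM2l ?invr_gt0// ler_norml; lra.
apply: le_trans (ler_wpM2r (hk_ge0 y t0) h1) _.
have -> : 4 / t * hk (2 * t) y = t^-1 * (4 * hk (2 * t) y) by ring.
rewrite -mulrA ler_pM2l ?invr_gt0//.
rewrite /hk -/u mulrCA.
have -> : y ^+ 2 / (4 * (2 * t)) = u / 2 by rewrite /u; field; lra.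
have h2 : (Num.sqrt (4 * pi * t))^-1 <= 2 * (Num.sqrt (4 * pi * (2 * t)))^-1.
  have -> : 4 * pi * (2 * t) = 2 * (4 * pi * t) by ring.
  have r0 : 0 < Num.sqrt (4 * pi * t) by rewrite sqrtr_gt0 c0.
  have -> : Num.sqrt (2 * (4 * pi * t)) = Num.sqrt 2 * Num.sqrt (4 * pi * t).
    by rewrite sqrtrM.
  rewrite invfM mulrA ler_peMl ?invr_ge0 ?(ltW r0)//.
  rewrite ler_pdivlMr ?sqrtr_gt0// mul1r.
  have : Num.sqrt 2 <= Num.sqrt (2 ^+ 2) :> R by rewrite ler_wsqrtr//; lra.
  by rewrite sqrtr_sqr ger0_norm.
have := expR_half u0 => h3.
apply: le_trans (ler_wpM2l _ h3) _; first by rewrite invr_ge0 sqrtr_ge0.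
apply: le_trans (ler_wpM2r _ h2) _; first by rewrite mulr_ge0 ?expR_ge0.
by rewrite le_eqVlt; apply/orP; left; apply/eqP; ring.
Qed.

(** One Gaussian of time [4 * t] serves for all [s] near [t], as differentiation under the integral
    requires. The constant combines [4 / s <= 8 / t] with [sqrt (4 t / (2 s)) <= 2]. *)
Lemma hk2_le_local s t y : 0 < t -> t / 2 < s < 2 * t ->
  `|hk2 s y| <= 16 / t * hk (4 * t) y.
Proof.
move=> t0 /andP[ts st]; have s0 : 0 < s by lra.
have s2 : 0 < 2 * s by lra.
apply: le_trans (hk2_le y s0) _.
have h : hk (2 * s) y <= 2 * hk (4 * t) y.
  have st4 : 2 * s <= 4 * t by lra.
  apply: le_trans (hk_le_time y s2 st4) _.
  rewrite ler_wpM2r ?hk_ge0//; first by lra.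
  rewrite -[leRHS](@ger0_norm R)// -sqrtr_sqr ler_wsqrtr// ler_pdivrMr//; lra.
have h' : 4 / s <= 8 / t.
  rewrite ler_pdivrMr// mulrAC ler_pdivlMr//; lra.
apply: le_trans (ler_pM _ _ h' h) _; rewrite ?hk_ge0// ?divr_ge0//; first by lra.
by rewrite le_eqVlt; apply/orP; left; apply/eqP; ring.
Qed.

(** Multiplying out, [|y| * hk t y] is at most 1 because [u <= exp (u^2)] for
    [u = |y| / sqrt (4 t)], and [hk t y] is at most the peak at the smaller time [s]. The bound is
    uniform for [t >= s]. *)
Lemma hk_le_inv s t y : 0 < s -> s <= t ->
  hk t y <= (1 + (Num.sqrt (4 * pi * s))^-1) / (1 + `|y|).
Proof.
move=> s0 st; have t0 : 0 < t by lra.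
rewrite ler_pdivlMr ?ltr_wpDr// mulrDr mulr1 addrC; apply: lerD.
  have rt : 0 < Num.sqrt (4 * pi * t) by rewrite sqrtr_gt0 c0.
  rewrite /hk mulrAC -mulrA mulrC ler_pdivrMr// mul1r mulrC.
  pose u := `|y| / Num.sqrt (4 * t).
  have r4 : 0 < Num.sqrt (4 * t) by rewrite sqrtr_gt0; lra.
  have yE : `|y| = u * Num.sqrt (4 * t) by rewrite /u divfK// gt_eqF.
  have -> : y ^+ 2 / (4 * t) = u ^+ 2.
    rewrite expr_div_n sqr_sqrtr; last by lra.
    by rewrite real_normK// num_real.
  rewrite yE; apply: (@le_trans _ _ (Num.sqrt (4 * t))).
    rewrite mulrA ler_piMl ?ltW//.
    rewrite mulrC expRN ltr_pdivrMr ?expR_gt0// mul1r.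
    apply: lt_le_trans (expR_ge1Dx _); have := sqr_ge0 (u - 1); nra.
  rewrite ler_wsqrtr//.
  have : 1 <= pi :> R by apply: le_trans (@pi_ge2 R); lra.
  nra.
apply: le_trans (hk_le_peak y t0) _.
by rewrite lef_pV2 ?posrE ?sqrtr_gt0 ?c0// ler_wsqrtr// ler_pM2l// mulr_gt0// pi_gt0.
Qed.

(** Integrability is assumed at every time because the majorant for times near [t] is a Gaussian of
    time [4 * t]. *)
Lemma is_derive_integral_hk b (v : R -> R) : measurable_fun setT v ->
  (forall t, 0 < t -> mu.-integrable setT (EFin \o (fun y => hk t (y - b) * v y))) ->
  forall t, 0 < t ->
  mu.-integrable setT (EFin \o (fun y => hk2 t (y - b) * v y)) /\
  is_derive t 1 (fun t => \int[mu]_y (hk t (y - b) * v y))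
    (\int[mu]_y (hk2 t (y - b) * v y)).
Proof.
move=> mv iv t t0.
pose G y := 16 / t * (hk (4 * t) (y - b) * `|v y|).
have t4 : 0 < 4 * t by lra.
have iG : mu.-integrable setT (EFin \o G).
  have := integrableZl measurableT (16 / t) (integrable_norm (iv _ t4)).
  apply: eq_integrable => // y _ /=.
  by rewrite /G normrM (ger0_norm (hk_ge0 _ t4)).
have It : t \in `]t / 2, 2 * t[ by rewrite in_itv/=; lra.
pose f s y := hk s (y - b) * v y.
have df s y : 0 < s -> is_derive s 1 (f^~ y) (hk2 s (y - b) * v y).
  move=> s0; have := is_derive_hk_time (y - b) s0 => ?.
  have h : is_derive s 1 (fun s => hk s (y - b)) (hk2 s (y - b)) by [].
  by rewrite /f; isDeq; rewrite mulr0 addr0.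
have pE s y : 0 < s -> partial1of2 f s y = hk2 s (y - b) * v y.
  by move=> s0; rewrite partial1of2E; have [_ ->] := df s y s0.
have I0 s : s \in `]t / 2, 2 * t[ -> 0 < s by rewrite in_itv/=; lra.
have G0 y : 0 <= G y.
  by rewrite /G !mulr_ge0 ?hk_ge0 ?invr_ge0 ?(ltW t0).
have fG s y : s \in `]t / 2, 2 * t[ -> `|hk2 s (y - b) * v y| <= G y.
  rewrite in_itv/= => ts; rewrite normrM /G mulrA ler_wpM2r//.
  exact: hk2_le_local.
split.
  apply: le_intble iG _ => //; last by move=> y _; exact: fG.
  by apply: measurable_funM => //; exact: measurable_hk2.
have H1 : forall s, `]t / 2, 2 * t[%classic s -> mu.-integrable setT (EFin \o f s).
  by move=> s /I0; exact: iv.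
have H2 : forall s y, `]t / 2, 2 * t[%classic s -> setT y -> derivable (f^~ y) s 1.
  by move=> s y /I0 s0 _; have [] := df s y s0.
have H3 : forall s y, `]t / 2, 2 * t[%classic s -> setT y -> `|partial1of2 f s y| <= G y.
  by move=> s y ts _; rewrite pE ?I0//; exact: fG.
apply: DeriveDef.
  exact: (derivable_under_integral measurableT It H1 H2 G0 iG H3).
rewrite -derive1E (differentiation_under_integral measurableT It H1 H2 G0 iG H3).
by apply: eq_Rintegral => y _; rewrite pE.
Qed.

End heat_kernel.

(** * Test functions and distributional second derivatives *)

(** Recursion through the derivative of [f] lets closure under sums, products and affine changes go
    by induction on [n]. The index is shifted: [Ck n] asks for n + 1 derivatives. *)
Fixpoint Ck {R : realType} (n : nat) (f : R -> R) : Prop :=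
  (forall x, derivable f x 1) /\ if n is n'.+1 then Ck n' (derive1 f) else True.

(* The powers of 1/x make the family stable under differentiation. *)
Definition flat {R : realType} (k : nat) (x : R) : R :=
  if 0 < x then x^-1 ^+ k * expR (- x^-1) else 0.

Section smooth_functions.
Context {R : realType}.
Implicit Types (f g : R -> R) (x : R).

Lemma is_derive_eq1 f f' : (forall x, is_derive x 1 f (f' x)) -> (derive1 f) = f'.
Proof. by move=> df; apply/funext => x; rewrite derive1E; have [_ ->] := df x. Qed.

Lemma CkS n f f' : (forall x, is_derive x 1 f (f' x)) -> Ck n f' -> Ck n.+1 f.
Proof.
by move=> df cf'; split => [x|]; [have [] := df x|rewrite (is_derive_eq1 df)].
Qed.

Lemma Ck0 f : (forall x, derivable f x 1) -> Ck 0 f.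
Proof. by []. Qed.

Lemma Ck_derivable n f x : Ck n f -> derivable f x 1.
Proof. by case: n => [|n] []. Qed.

Lemma Ck_is_derive n f x : Ck n f -> is_derive x 1 f ((derive1 f) x).
Proof. by move=> /Ck_derivable fx; rewrite derive1E; exact/derivableP/fx. Qed.

Lemma CkW n f : Ck n.+1 f -> Ck n f.
Proof.
by elim: n f => [|n ih] f [df [d1 d2]]; split => //; apply: ih; split.
Qed.

Lemma Ck_add n f g : Ck n f -> Ck n g -> Ck n (fun x => f x + g x).
Proof.
elim: n f g => [|n ih] f g cf cg.
  by apply: Ck0 => x; have [] := isD_add (Ck_is_derive x cf) (Ck_is_derive x cg).
apply: (@CkS _ _ (fun x => (derive1 f) x + (derive1 g) x)).
  by move=> x; exact: isD_add (Ck_is_derive x cf) (Ck_is_derive x cg).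
by apply: ih; [case: cf|case: cg].
Qed.

Lemma Ck_mul n f g : Ck n f -> Ck n g -> Ck n (fun x => f x * g x).
Proof.
elim: n f g => [|n ih] f g cf cg.
  by apply: Ck0 => x; have [] := isD_mul (Ck_is_derive x cf) (Ck_is_derive x cg).
apply: (@CkS _ _ (fun x => (derive1 f) x * g x + f x * (derive1 g) x)).
  by move=> x; exact: isD_mul (Ck_is_derive x cf) (Ck_is_derive x cg).
by apply: Ck_add; apply: ih; [case: cf|exact: CkW|exact: CkW|case: cg].
Qed.

Lemma Ck_cst n (c : R) : Ck n (fun=> c).
Proof.
elim: n c => [|n ih] c; first by apply: Ck0 => x; have [] := isD_cst c x.
by apply: (@CkS _ _ (fun=> 0)) => // x; exact: isD_cst.
Qed.

Lemma Ck_id n : Ck n (fun x : R => x).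
Proof.
case: n => [|n]; first by apply: Ck0 => x; have [] := isD_id x.
by apply: (@CkS _ _ (fun=> 1)); exact: Ck_cst.
Qed.

Lemma isD_affine f (c d x a : R) : is_derive (c * x + d) 1 f a ->
  is_derive x 1 (fun x => f (c * x + d)) (a * c).
Proof.
move=> df; apply: (@isD_comp _ f (fun x => c * x + d)) => //.
by isDeq; ring.
Qed.

Lemma Ck_affine n f (c d : R) : Ck n f -> Ck n (fun x => f (c * x + d)).
Proof.
elim: n f => [|n ih] f cf.
  by apply: Ck0 => x; have [] := isD_affine (Ck_is_derive (c * x + d) cf).
apply: (@CkS _ _ (fun x => (derive1 f) (c * x + d) * c)).
  by move=> x; exact: isD_affine (Ck_is_derive (c * x + d) cf).
by apply: Ck_mul; [apply: ih; case: cf|exact: Ck_cst].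
Qed.

Lemma Ck_derive1n f : (forall n, Ck n f) -> forall n x, derivable (derive1n n f) x 1.
Proof.
move=> cf n; elim: n f cf => [|n ih] f cf x; first by have [] := cf 0%N.
by rewrite derive1Sn; apply: ih => m; have [] := cf m.+1.
Qed.

Lemma derive1n_Ck f : (forall n x, derivable (derive1n n f) x 1) -> forall n, Ck n f.
Proof.
move=> df n; elim: n f df => [|n ih] f df; first by split => // x; exact: (df 0%N).
split; first by move=> x; exact: (df 0%N).
by apply: ih => m x; rewrite -derive1Sn.
Qed.

(** With [y = 1/x], the exponential series gives [exp y >= y^(k+1) / (k+1)!], so [y^k * exp (- y)]
    is at most [(k+1)! / y]. This linear bound yields continuity at 0 for every [k]. *)
Lemma flat_le k x : `|flat k x| <= (k.+1)`!%:R * `|x|.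
Proof.
rewrite /flat; case: ifPn => x0; last by rewrite normr0 mulr_ge0.
have y0 : 0 < x^-1 by rewrite invr_gt0.
rewrite ger0_norm ?mulr_ge0 ?expR_ge0 ?exprn_ge0 ?(ltW y0)// gtr0_norm//.
rewrite expRN ler_pdivrMr ?expR_gt0//.
have F0 : 0 < (k.+1)`!%:R :> R by rewrite ltr0n fact_gt0.
have := expR_ge1Dxn k (ltW y0) => h.
have h2 : x^-1 ^+ k.+1 / (k.+1)`!%:R <= expR x^-1 by lra.
rewrite -mulrA -ler_pdivrMl//; apply: le_trans (ler_wpM2l (ltW x0) h2).
rewrite exprS le_eqVlt; apply/orP; left; apply/eqP; field.
by rewrite !gt_eqF.
Qed.

Lemma is_derive_flat k x :
  is_derive x 1 (flat k) (- k%:R * flat k.+1 x + flat k.+2 x).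
Proof.
have [x0|x0|->] := ltgtP x 0.
- have -> : - k%:R * flat k.+1 x + flat k.+2 x = 0.
    by rewrite /flat ifF ?ifF ?mulr0 ?addr0//; apply/negbTE; rewrite -leNgt ltW.
  apply: near_eq_is_derive (isD_cst 0 x); near=> y.
  by rewrite /flat ifF//; apply/negbTE; rewrite -leNgt ltW//; near: y; exact: lt_nbhsl.
- have -> : - k%:R * flat k.+1 x + flat k.+2 x =
     k%:R * x^-1 ^+ k.-1 * (- 1 * x ^- 2) * expR (- x^-1) +
     x^-1 ^+ k * (expR (- x^-1) * - (- 1 * x ^- 2)).
    rewrite /flat x0; case: k => [|k] /=; rewrite !exprS; field; lra.
  have d : is_derive x 1 (fun x => x^-1 ^+ k * expR (- x^-1))
     (k%:R * x^-1 ^+ k.-1 * (- 1 * x ^- 2) * expR (- x^-1) +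
     x^-1 ^+ k * (expR (- x^-1) * - (- 1 * x ^- 2))).
    by isDeq => //; rewrite gt_eqF.
  apply: near_eq_is_derive d; near=> y.
  by rewrite /flat ifT//; near: y; exact: lt_nbhsr.
(* Since [flat k x = x * flat k.+1 x], the next member of the family is the slope function at 0; it
   is continuous there with value 0. *)
- apply/is_derive1_caratheodory; exists (flat k.+1); split.
  + move=> z; rewrite subr0 /flat ltxx subr0; case: ifPn => z0; last by rewrite mul0r.
    by rewrite exprS; field; lra.
  + apply/cvgrPdist_le => e e0; near=> z.
    rewrite [flat _ 0]/flat ltxx sub0r normrN; apply: le_trans (flat_le _ _) _.
    rewrite -ler_pdivlMl ?ltr0n ?fact_gt0//.
    near: z; apply/nbhs_ballP; exists (((k.+2)`!%:R)^-1 * e).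
      by rewrite /= mulr_gt0// invr_gt0 ltr0n fact_gt0.
    by move=> z /=; rewrite /ball/= sub0r normrN => /ltW.
  + by rewrite /flat ltxx mulr0 addr0.
Unshelve. all: by end_near. Qed.

Lemma Ck_flat n k : Ck n (@flat R k).
Proof.
elim: n k => [|n ih] k; first by apply: Ck0 => x; have [] := is_derive_flat k x.
apply: (@CkS _ _ (fun x => - k%:R * flat k.+1 x + flat k.+2 x)).
  exact: is_derive_flat.
by apply: Ck_add => //; apply: Ck_mul => //; exact: Ck_cst.
Qed.

(** This is [exp (- 1/(1+x)) * exp (- 1/(1-x))] inside ]-1, 1[ and 0 outside, with the arguments
    written in the form that [Ck_affine] expects. *)
Definition bump x : R := flat 0 (1 * x + 1) * flat 0 (-1 * x + 1).

Lemma test_bump : test_function bump.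
Proof.
split.
  apply: Ck_derive1n => n; apply: Ck_mul; apply: Ck_affine; exact: Ck_flat.
exists 1 => x; rewrite /bump lter_normr => /orP[] x1.
  by rewrite [flat 0 (-1 * x + 1)]/flat ifF ?mulr0//; apply/negbTE; rewrite -leNgt; lra.
by rewrite /flat ifF ?mul0r//; apply/negbTE; rewrite -leNgt; lra.
Qed.

Lemma bump0 : bump 0 != 0.
Proof.
by rewrite /bump !mulr0 !add0r /flat ltr01 gt_eqF// !mulr_gt0 ?expR_gt0// ?exprn_gt0 ?invr_gt0.
Qed.

Lemma test_derive f : test_function f -> test_function (derive1 f).
Proof.
move=> [df [M fM]]; split; first by move=> n x; rewrite -derive1Sn.
exists M => x Mx; rewrite derive1E.
have -> : 'D_1 f x = 'D_1 (fun=> 0 : R) x.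
  apply: near_eq_derive; near=> y; apply: fM; near: y.
  have := @norm_continuous _ _ x => /cvgr_gt; apply; exact: Mx.
by rewrite derive_cst.
Unshelve. all: by end_near. Qed.

Lemma test_is_derive f x : test_function f -> is_derive x 1 f ((derive1 f) x).
Proof. by move=> [/derive1n_Ck cf _]; exact: Ck_is_derive (cf 0%N). Qed.

Lemma test_continuous f : test_function f -> continuous f.
Proof. by move=> tf x; exact: isD_continuous (test_is_derive x tf). Qed.

Lemma test_bounded f : test_function f -> exists C : R, forall x, `|f x| <= C.
Proof.
move=> tf; have [_ [M fM]] := tf.
have M0 : 0 <= `|M| + 1 by rewrite addr_ge0.
have [||c _ cmax] := @EVT_max R (fun x => `|f x|) (- (`|M| + 1)) (`|M| + 1).
- lra.
- by apply: continuous_subspaceT => x; apply: cvg_norm; exact: test_continuous.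
exists `|f c| => x; have [xM|xM] := lerP `|x| (`|M| + 1).
  by apply: cmax; rewrite in_itv/= -ler_norml.
by rewrite fM ?normr0//; have := ler_norm M; lra.
Qed.

Lemma test_integrable f : test_function f ->
  (@lebesgue_measure R).-integrable setT (EFin \o f).
Proof.
move=> tf; have [C fC] := test_bounded tf; have [_ [M fM]] := tf.
have C0 : 0 <= C := le_trans (normr_ge0 _) (fC 0).
have i1 : (@lebesgue_measure R).-integrable setT
    (EFin \o (fun x => C * \1_(`[- (`|M| + 1), `|M| + 1]%classic : set R) x)).
  have := @integrable_indic_itv R (- (`|M| + 1)) (`|M| + 1) true false.
  by move=> /(integrableZl measurableT C); apply.
apply: le_intble i1 _ => //.
  by apply: continuous_measurable_fun; exact: test_continuous.
move=> x _; have [xM|xM] := lerP `|x| (`|M| + 1).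
  by rewrite indicE mem_set ?mulr1//= in_itv/= -ler_norml.
by rewrite fM ?normr0 ?mulr_ge0//; have := ler_norm M; lra.
Qed.

Lemma test_cutoff (K : R -> R) (n : nat) : (forall m, Ck m K) ->
  test_function (fun x => bump (n.+1%:R^-1 * x + 0) * K x).
Proof.
move=> cK; have [/derive1n_Ck cb [M bM]] := test_bump; split.
  by apply: Ck_derive1n => m; apply: Ck_mul => //; exact: Ck_affine.
exists (n.+1%:R * M) => x Mx; by rewrite bM ?mul0r// addr0 normrM normfV normr_nat ltr_pdivlMl.
Qed.

(* Cut off K by bump(x/n) and let n tend to infinity. *)
Lemma weak_laplacian_ext (r a K K1 K2 : R -> R) :
  (forall phi, test_function phi ->
    \int[@lebesgue_measure R]_x (r x * derive1n 2 phi x) =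
    - \int[@lebesgue_measure R]_x (a x * phi x)) ->
  measurable_fun setT r -> measurable_fun setT a ->
  (forall x, is_derive x 1 K (K1 x)) -> (forall x, is_derive x 1 K1 (K2 x)) ->
  (forall m, Ck m K) ->
  (@lebesgue_measure R).-integrable setT (EFin \o (fun x => r x * K x)) ->
  (@lebesgue_measure R).-integrable setT (EFin \o (fun x => r x * K1 x)) ->
  (@lebesgue_measure R).-integrable setT (EFin \o (fun x => r x * K2 x)) ->
  (@lebesgue_measure R).-integrable setT (EFin \o (fun x => a x * K x)) ->
  \int[@lebesgue_measure R]_x (r x * K2 x) = - \int[@lebesgue_measure R]_x (a x * K x).
Proof.
move=> weak mr ma dK dK1 cK iK iK1 iK2 iaK.
have tb := test_bump; have tb1 := test_derive tb; have tb2 := test_derive tb1.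
have [C0 bC0] := test_bounded tb; have [C1 bC1] := test_bounded tb1.
have [C2 bC2] := test_bounded tb2.
set b0 := bump in tb tb1 tb2 bC0 bC1 bC2.
pose b1 := (derive1 b0); pose b2 := (derive1 b1).
rewrite -/b1 in tb1 tb2 bC1 bC2; rewrite -/b2 in tb2 bC2.
pose h n : R := n.+1%:R^-1.
have h0 n : 0 < h n by rewrite /h.
have h1 n : h n <= 1 by rewrite invf_le1 ?ler1n.
pose psi n x := b0 (h n * x + 0) * K x.
pose psi2 n x := b0 (h n * x + 0) * K2 x +
  2 * h n * b1 (h n * x + 0) * K1 x + h n ^+ 2 * b2 (h n * x + 0) * K x.
have db0 n x := isD_affine (test_is_derive (h n * x + 0) tb).
have db1 n x := isD_affine (test_is_derive (h n * x + 0) tb1).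
have psi2E n : derive1n 2 (psi n) = psi2 n.
  have e1 : derive1 (psi n) = (fun x =>
      b1 (h n * x + 0) * h n * K x + b0 (h n * x + 0) * K1 x).
    by apply: is_derive_eq1 => x; exact: isD_mul (db0 n x) (dK x).
  rewrite derive1nS derive1n1 e1.
  apply: is_derive_eq1 => x; rewrite /psi2.
  have d := isD_add (isD_mul (isD_mul (db1 n x) (isD_cst (h n) x)) (dK x))
    (isD_mul (db0 n x) (dK1 x)).
  apply: is_derive_eq d _; rewrite -/b1 -/b2; ring.
have mb f n : test_function f -> measurable_fun setT (fun x => f (h n * x + 0)).
  move=> tf; apply: continuous_measurable_fun => x.
  exact: isD_continuous (isD_affine (test_is_derive (h n * x + 0) tf)).
have mD f f' : (forall x, is_derive x 1 f (f' x)) -> measurable_fun setT f.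
  by move=> df; apply: continuous_measurable_fun => x; exact: isD_continuous (df x).
have mK2 : measurable_fun setT K2.
  have [_ [_ cK2]] := cK 2; rewrite (is_derive_eq1 dK) (is_derive_eq1 dK1) in cK2.
  apply: continuous_measurable_fun => x; exact: isD_continuous (@Ck_is_derive 0 _ x cK2).
have hn0 : h n @[n --> \oo] --> 0 by exact: cvg_harmonic.
have bcvg f x : test_function f -> f (h n * x + 0) @[n --> \oo] --> f 0.
  move=> tf; have w : h n * x + 0 @[n --> \oo] --> (0 : R).
    rewrite -[X in _ --> X]addr0 -[X in _ --> X + _](mul0r x).
    by apply: cvgD; [exact: cvgMl|exact: cvg_cst].
  have cf0 : f y @[y --> (0 : R)] --> f 0 by move: (test_continuous tf) => /(_ 0).
  exact: (cvg_comp (fun n => h n * x + 0) f w cf0).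
have L1 : \int[lebesgue_measure]_x (r x * psi2 n x) @[n --> \oo] -->
    \int[@lebesgue_measure R]_x (r x * (b0 0 * K2 x)).
  apply: (@Rintegral_dct _ _ _ _ (fun x => C0 * `|r x * K2 x| +
     (2 * C1) * `|r x * K1 x| + C2 * `|r x * K x|)) => //.
  - move=> n; apply: measurable_funM => //; rewrite -psi2E.
    apply: continuous_measurable_fun; apply: test_continuous.
    by apply: test_derive; apply: test_derive; exact: test_cutoff.
  - apply: measurable_funM => //; exact: measurable_funM.
  - move=> x _; apply: cvgMr; rewrite /psi2.
    have -> : b0 0 * K2 x = b0 0 * K2 x + 2 * 0 * b1 0 * K1 x + 0 ^+ 2 * b2 0 * K x.
      by rewrite mulr0 expr0n/= !mul0r !addr0.
    apply: cvgD; first apply: cvgD.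
    + by apply: cvgMl; exact: bcvg.
    + by apply: cvgMl; apply: cvgM; [exact: cvgMr|exact: bcvg].
    + by apply: cvgMl; apply: cvgM; [exact: (cvgM hn0 hn0)|exact: bcvg].
  - have j0 := integrableZl measurableT C2 (integrable_norm iK).
    have j1 := integrableZl measurableT (2 * C1) (integrable_norm iK1).
    have j2 := integrableZl measurableT C0 (integrable_norm iK2).
    exact: (integrableD measurableT (integrableD measurableT j2 j1) j0).
  - move=> n x _; rewrite normrM /psi2.
    apply: (@le_trans _ _ (`|r x| * (C0 * `|K2 x| + 2 * C1 * `|K1 x| + C2 * `|K x|))); last first.
      by rewrite !normrM le_eqVlt; apply/orP; left; apply/eqP; ring.
    rewrite ler_wpM2l//; apply: le_trans (ler_normD _ _) _; apply: lerD.
      apply: le_trans (ler_normD _ _) _; apply: lerD.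
        by rewrite normrM ler_wpM2r.
      rewrite !normrM ler_wpM2r// ler_pM// ?mulr_ge0//.
      by rewrite (ger0_norm (ltW (h0 n))) ger0_norm// ler_piMr.
    rewrite !normrM ler_wpM2r// -[leRHS]mul1r ler_pM//.
    by rewrite (ger0_norm (ltW (h0 n))) -expr2 exprn_ile1// ltW.
have L2 : \int[lebesgue_measure]_x (a x * psi n x) @[n --> \oo] -->
    \int[@lebesgue_measure R]_x (a x * (b0 0 * K x)).
  apply: (@Rintegral_dct _ _ _ _ (fun x => C0 * `|a x * K x|)) => //.
  - move=> n; apply: measurable_funM => //; apply: measurable_funM; first exact: mb.
    exact: mD dK.
  - apply: measurable_funM => //; apply: measurable_funM => //; exact: mD dK.
  - move=> x _; apply: cvgMr; apply: cvgMl; exact: bcvg.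
  - exact: (integrableZl measurableT C0 (integrable_norm iaK)).
  - move=> n x _; rewrite /psi; move: (b0 _) (bC0 (h n * x + 0)) => z hz.
    by rewrite !normrM mulrCA ler_wpM2r ?mulr_ge0.
have EE n : \int[lebesgue_measure]_x (r x * psi2 n x) =
    - \int[@lebesgue_measure R]_x (a x * psi n x).
  by rewrite -psi2E; apply: weak; exact: test_cutoff.
have L1' : (- \int[lebesgue_measure]_x (a x * psi n x)) @[n --> \oo] -->
    \int[@lebesgue_measure R]_x (r x * (b0 0 * K2 x)).
  by apply: cvg_trans L1; apply: near_eq_cvg; near=> n; rewrite EE.
have := cvg_unique (@Rhausdorff R) L1' (cvgN L2).
have e1 : \int[lebesgue_measure]_x (r x * (b0 0 * K2 x)) =
   b0 0 * \int[@lebesgue_measure R]_x (r x * K2 x).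
  by rewrite -RintegralZl//; apply: eq_Rintegral => x _; ring.
have e2 : \int[lebesgue_measure]_x (a x * (b0 0 * K x)) =
   b0 0 * \int[@lebesgue_measure R]_x (a x * K x).
  by rewrite -RintegralZl//; apply: eq_Rintegral => x _; ring.
(* The cutoff is not normalised to 1 at 0, so both limits carry the factor [bump 0]. The terms
   containing a derivative of the cutoff have disappeared through their factors 1/(n+1). *)
rewrite e1 e2 -mulrN => H; apply: (mulfI bump0); exact: H.
Unshelve. all: by end_near. Qed.

Lemma Ck_hk n (t b : R) : 0 < t -> Ck n (fun y => hk t (y - b)).
Proof.
move=> t0; have cn m : Ck m (hk t); last first.
  have := @Ck_affine n (hk t) 1 (- b) (cn n).
  by under eq_fun do rewrite mul1r.
elim: m => [|m ih]; first by apply: Ck0 => y; have [] := is_derive_hk y t0.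
apply: (@CkS _ _ (fun y => - (2 * t)^-1 * y * hk t y)).
  by move=> y; apply: is_derive_eq (is_derive_hk y t0) _; ring.
by apply: Ck_mul => //; apply: Ck_mul; [exact: Ck_cst|exact: Ck_id].
Qed.

End smooth_functions.

(** * The spaces X *)

Section function_spaces.
Context {R : realType}.
Notation mu := (@lebesgue_measure R).
Implicit Types (X : Xspace R) (u v f g psi : R -> R) (c : R).

Lemma Xforall_ae X (P : R -> Prop) : Xforall X P -> {ae mu, forall x, P x}.
Proof. by case: X => [p p1|]//= H; exact: aeW. Qed.

Lemma Xforall_imp X (P Q : R -> Prop) : (forall x, P x -> Q x) ->
  Xforall X P -> Xforall X Q.
Proof. by move=> PQ; case: X => [p p1|]/=; [exact: ae_imp|move=> H x; exact: PQ]. Qed.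

(** The line is not a null set. This extracts one point from the almost everywhere information on
    the Green function. *)
Lemma Xforall_ex X (P : R -> Prop) : Xforall X P -> exists x, P x.
Proof.
move=> /Xforall_ae[N [mN N0 PN]]; apply: contrapT => nP.
have : (mu [set: R] <= mu N)%E.
  apply: le_measure; rewrite ?inE// => x _; apply: PN => /= Px.
  by apply: nP; exists x.
rewrite N0; have := @lebesgue_measure_itvoy_neq0 R 0.
move=> h1 h2; move: h1; rewrite -measure_le0 => /negP; apply.
by apply: le_trans h2; apply: le_measure; rewrite ?inE.
Qed.

Lemma C0_bounded f : Xmem C0 f -> exists M : R, forall x, `|f x| <= M.
Proof.
move=> [cf fy fNy].
have [A1 [A1r hA1]] : \forall x \near +oo, `|f x| < 1.
  by move/cvgr0Pnorm_lt : fy; apply.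
have [A2 [A2r hA2]] : \forall x \near -oo, `|f x| < 1.
  by move/cvgr0Pnorm_lt : fNy; apply.
pose A := `|A1| + `|A2|.
have [||z _ zmax] := @EVT_max R (fun x => `|f x|) (- A) A.
- by have := normr_ge0 A1; have := normr_ge0 A2; rewrite /A; lra.
- by apply: continuous_subspaceT => x; apply: cvg_norm; exact: cf.
exists (Num.max `|f z| 1) => x; rewrite le_max.
have [xA|xA] := lerP `|x| A; first by rewrite zmax// in_itv/= -ler_norml.
apply/orP; right; move: xA; rewrite lter_normr => /orP[] xA.
  apply/ltW/hA1; have := ler_norm A1; have := normr_ge0 A2; rewrite /A in xA; lra.
apply/ltW/hA2; have := ler_norm (- A2); have := normr_ge0 A1.
by rewrite normrN /A in xA *; lra.
Qed.

Lemma C0_norm_le f (M : R) : (forall x, `|f x| <= M) -> (Xnorm C0 f <= M%:E)%E.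
Proof. by move=> fM; apply: ub_ereal_sup => _ [x _ <-]; rewrite lee_fin. Qed.

Lemma C0_le_norm f x : (`|f x|%:E <= Xnorm C0 f)%E.
Proof. by apply: ereal_sup_ubound; exists x. Qed.

Lemma Xmem_meas X f : Xmem X f -> measurable_fun setT f.
Proof.
case: X => [p p1|] /=; first by rewrite inE => /andP[]; rewrite inE.
by case=> cf _ _; exact: continuous_measurable_fun.
Qed.

Lemma Xnorm_ge0 X f : (0 <= Xnorm X f)%E.
Proof.
case: X => [p p1|]; first exact: Lnorm_ge0.
by apply: le_trans (C0_le_norm f 0); rewrite lee_fin.
Qed.

Lemma Xnorm_lty X f : Xmem X f -> (Xnorm X f < +oo)%E.
Proof.
case: X => [p p1|] /=; first by rewrite inE => /andP[_]; rewrite !inE.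
by move=> /C0_bounded[M fM]; apply: le_lt_trans (C0_norm_le fM) _; rewrite ltry.
Qed.

Lemma Xmem_lin X f g c : Xmem X f -> Xmem X g -> Xmem X (fun x => c * f x + g x).
Proof.
case: X => [p p1|] /=.
  move=> fX gX; have p1' : (1 <= p%:E)%E by rewrite lee_fin ltW.
  have := Lfun_submod_closed mu p1' => -[_ H]; exact: (H c f g fX gX).
move=> [cf fy fNy] [cg gy gNy]; split.
- move=> x; apply: cvgD; last exact: cg.
  by apply: cvgMr; exact: cf.
- by rewrite -[X in _ --> X]addr0 -[X in _ --> X + _](mulr0 c); apply: cvgD => //; exact: cvgMr.
- by rewrite -[X in _ --> X]addr0 -[X in _ --> X + _](mulr0 c); apply: cvgD => //; exact: cvgMr.
Qed.

Lemma Xmem0 X : Xmem X (fun=> 0).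
Proof.
case: X => [p p1|] /=; last first.
  by split; [move=> x; exact: cvg_cst|exact: cvg_cst|exact: cvg_cst].
have p1' : (1 <= p%:E)%E by rewrite lee_fin ltW.
by have [H _] := Lfun_submod_closed mu p1'.
Qed.

Lemma Xmem_scale X f c : Xmem X f -> Xmem X (fun x => c * f x).
Proof.
move=> fX; have := Xmem_lin c fX (Xmem0 X).
by under eq_fun do rewrite addr0.
Qed.

Lemma Xmem_sub X f g : Xmem X f -> Xmem X g -> Xmem X (f \- g).
Proof.
move=> fX gX; have := Xmem_lin (- 1) gX fX.
by congr Xmem; apply/funext => x /=; ring.
Qed.

Lemma Xmem_sum X k (a : nat -> R) (h : nat -> R -> R) :
  (forall i, (i < k)%N -> Xmem X (h i)) ->
  Xmem X (fun x => \sum_(i < k) a i * h i x).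
Proof.
elim: k => [|k ih] hX; first by under eq_fun do rewrite big_ord0; exact: Xmem0.
under eq_fun do rewrite big_ord_recr/= addrC.
by apply: Xmem_lin; [exact: hX|apply: ih => i ik; apply: hX; rewrite ltnS ltnW].
Qed.

Lemma Xnorm_triangle X f g : Xmem X f -> Xmem X g ->
  (Xnorm X (f \+ g)%R <= Xnorm X f + Xnorm X g)%E.
Proof.
case: X => [p p1|] fX gX.
  by apply: minkowski_EFin; rewrite ?ltW//; [exact: Xmem_meas fX|exact: Xmem_meas gX].
apply: ub_ereal_sup => _ [x _ <-].
apply: (@le_trans _ _ (`|f x|%:E + `|g x|%:E)%E).
  by rewrite -EFinD lee_fin ler_normD.
by apply: leeD; exact: C0_le_norm.
Qed.

Lemma Xnorm_sub0 X f : Xnorm X (f \- f) = 0%E.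
Proof.
have -> : f \- f = (fun=> 0) by apply/funext => x /=; rewrite subrr.
case: X => [p p1|]; first by apply: Lnorm0; rewrite eqe gt_eqF//; lra.
by apply/eqP; rewrite eq_le (Xnorm_ge0 C0) andbT; apply: C0_norm_le => x; rewrite normr0.
Qed.

Lemma Xcvg_cst X f : Xcvg X (fun=> f) f.
Proof. by rewrite /Xcvg Xnorm_sub0; exact: cvg_cst. Qed.

(** Monotonicity common to the L^p and the supremum norm; through it, norm estimates in X reduce to
    pointwise comparison with [env]. *)
Lemma Xnorm_bigger_env X f g c : measurable_fun setT f -> Xmem X g ->
  (forall x, `|f x| <= c * g x) -> 0 <= c -> (Xnorm X f <= c%:E * Xnorm X g)%E.
Proof.
case: X => [p p1|] mf gX fg c0.
  have p1' : (1 <= p%:E)%E by rewrite lee_fin ltW.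
  have p0 : 0 < p by lra.
  have <- : ('N[mu]_p%:E[EFin \o (fun x => (c * g x)%R)] = c%:E * Xnorm (Lp p1) g)%E.
    by have := LnormZ (Lfun_Sub p1' gX) c; rewrite ger0_norm.
  rewrite /Xnorm unlock; apply: gt0_ler_poweR.
  - by rewrite invr_ge0 ltW.
  - by rewrite in_itv/= leey andbT integral_ge0// => x _; rewrite poweR_ge0.
  - by rewrite in_itv/= leey andbT integral_ge0// => x _; rewrite poweR_ge0.
  apply: ge0_le_integral => //.
  - by move=> x _; rewrite poweR_ge0.
  - apply/measurable_EFinP; apply: (@measurableT_comp _ _ _ _ _ _ (@powR R ^~ p)) => //.
    exact: measurableT_comp.
  - apply/measurable_EFinP; apply: (@measurableT_comp _ _ _ _ _ _ (@powR R ^~ p)) => //.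
    apply: measurableT_comp => //; apply: measurable_funM => //; exact: Xmem_meas gX.
  - move=> x _ /=; rewrite lee_fin ge0_ler_powR ?nnegrE ?(ltW p0)//.
    by apply: le_trans (fg x) _; exact: ler_norm.
apply: ub_ereal_sup => _ [x _ <-].
apply: (@le_trans _ _ (c%:E * `|g x|%:E)%E).
  rewrite -EFinM lee_fin (le_trans (fg x))// ler_wpM2l//; exact: ler_norm.
by apply: lee_wpmul2l; [rewrite lee_fin|exact: C0_le_norm].
Qed.

(** One envelope for every X: it vanishes at infinity, and its p-th power is integrable for each p >
    1. Gaussians lie below multiples of it with constants that are explicit in time. *)
Definition env (x : R) : R := (1 + `|x|)^-1.

Lemma env_gt0 x : 0 < env x.
Proof. by rewrite invr_gt0 ltr_wpDr. Qed.

Lemma continuous_env : continuous env.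
Proof.
move=> x; apply: cvgV; first by rewrite gt_eqF// ltr_wpDr.
by apply: cvgD; [exact: cvg_cst|apply: cvg_norm; exact: cvg_id].
Qed.

Lemma cvgy_env : env x @[x --> +oo] --> 0 /\ env x @[x --> -oo] --> 0.
Proof.
have h e x : 0 < e -> e^-1 <= `|x| -> `|env x| <= e.
  move=> e0 ex; rewrite gtr0_norm ?env_gt0// /env invf_ple ?posrE ?ltr_wpDr//.
  by rewrite (le_trans ex)// lerDr.
split; apply/cvgr0Pnorm_le => e e0; near=> x; apply: h => //.
  by rewrite (@le_trans _ _ x)// ?ler_norm//; near: x; apply: nbhs_pinfty_ge; exact: num_real.
rewrite (@le_trans _ _ (- x))//; last by rewrite -normrN ler_norm.
by rewrite lerNr; near: x; apply: nbhs_ninfty_le; exact: num_real.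
Unshelve. all: by end_near. Qed.

Let integrable_env_pow (p : R) : 1 < p ->
  mu.-integrable `]0, +oo[ (EFin \o (fun x => (1 + x) `^ (- p))).
Proof.
move=> p1; pose F x := (1 - p)^-1 * (1 + x) `^ (1 - p).
have dF (x : R) : 0 < 1 + x -> is_derive x 1 F ((1 + x) `^ (- p)).
  move=> x0; have h := is_derive1_powR (1 - p) x0.
  have hd : is_derive x 1 (fun x : R => 1 + x) (0 + 1) by isDeq.
  have h2 := @isD_comp _ (@powR R ^~ (1 - p)) (fun x => 1 + x) _ _ _ h hd.
  rewrite /F; isDeq; rewrite add0r mul0r add0r !mulr1 mulrA mulVf ?mul1r; last by lra.
  by congr (_ `^ _); lra.
have [] := @ftc_oy R (fun x => (1 + x) `^ (- p)) F 0 (F 0) 0 => //.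
- by move=> x x0; apply: dF; lra.
- move=> x x0; have x1 : 0 < 1 + x by lra.
  have h := is_derive1_powR (- p) x1.
  have hd : is_derive x 1 (fun x : R => 1 + x) (0 + 1) by isDeq.
  exact: isD_continuous (@isD_comp _ (@powR R ^~ (- p)) (fun x => 1 + x) _ _ _ h hd).
- by apply: cvg_at_right_filter; apply: (isD_continuous (dF 0 _)); lra.
- rewrite -[X in _ --> X](mulr0 (1 - p)^-1); apply: cvgMr.
  have e : \forall x \near +oo, (1 + x)^-1 `^ (p - 1) = (1 + x) `^ (1 - p).
    near=> x; have x0 : 0 < x by near: x; apply: nbhs_pinfty_gt; exact: num_real.
    rewrite -powR_inv1; last by lra.
    by rewrite -powRrM mulN1r opprB.
  apply: cvg_trans (near_eq_cvg e) _.
  have v : (1 + x)^-1 @[x --> +oo] --> (0 : R).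
    apply: (cvg_comp (fun x => 1 + x) GRing.inv _ (@cvgV_y R)); exact: cvg_addrl.
  apply/cvgr0Pnorm_le => e' e0.
  have ee : 0 < e' `^ (p - 1)^-1 by rewrite powR_gt0.
  near=> x.
  have x0 : 0 < x by near: x; apply: nbhs_pinfty_gt; exact: num_real.
  rewrite ger0_norm ?powR_ge0//.
  have -> : e' = (e' `^ (p - 1)^-1) `^ (p - 1).
    by rewrite -powRrM mulVf ?powRr1 ?ltW//; lra.
  apply: ge0_ler_powR; rewrite ?nnegrE ?invr_ge0 ?powR_ge0//; [lra|lra|].
  near: x; exact: (cvgr_le _ v _ ee).
- by left=> x _; exact: powR_ge0.
Unshelve. all: by end_near. Qed.

Lemma Xmem_env X : Xmem X env.
Proof.
case: X => [p p1|] /=; last first.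
  by have [h1 h2] := cvgy_env; split => //; exact: continuous_env.
have p0 : 0 < p by lra.
have menv : measurable_fun setT env by exact: (continuous_measurable_fun continuous_env).
rewrite inE; apply/andP; split; rewrite inE//=.
rewrite /finite_norm unlock; apply: poweR_lty.
pose g (x : R) : \bar R := ((1 + `|x|) `^ (- p))%:E.
have cg : continuous (fun x : R => (1 + `|x|) `^ (- p)).
  move=> x; have x1 : 0 < 1 + `|x| by rewrite ltr_wpDr.
  apply: (cvg_comp (fun x => 1 + `|x|) (@powR R ^~ (- p))).
    by apply: cvgD; [exact: cvg_cst|apply: cvg_norm; exact: cvg_id].
  exact: isD_continuous (is_derive1_powR (- p) x1).
rewrite (_ : (\int[mu]_x _)%E = (\int[mu]_x g x)%E); last first.
  apply: eq_integral => x _; rewrite /g /= gtr0_norm ?env_gt0// /env.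
  by rewrite -powR_inv1 ?addr_ge0// -powRrM mulN1r.
rewrite (_ : (\int[mu]_x g x)%E = 2%:E * \int[mu]_(x in (`[0%R, +oo[ : set R)) g x)%E; last first.
  rewrite (@ge0_symfun_integralT R (fun x => (1 + `|x|) `^ (- p))).
  - congr (_ * _)%E; congr (integral _ _ _).
    by apply/seteqP; split => x /=; rewrite in_itv/= andbT.
  - by move=> x; exact: powR_ge0.
  - exact: cg.
  - by move=> x /=; rewrite normrN.
rewrite lte_mul_pinfty// ?lee_fin//.
have := integrable_env_pow p1 => /integrableP[mm].
rewrite (_ : (\int[mu]_(x in (`[0%R, +oo[ : set R)) g x)%E =
   \int[mu]_(x in (`]0%R, +oo[ : set R)) `|(EFin \o (fun x : R => ((1 + x) `^ (- p))%R)) x|)%E//.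
rewrite -integral_itv_obnd_cbnd//.
  apply: eq_integral => x; rewrite inE/= in_itv/= andbT => x0.
  by rewrite /g (gtr0_norm x0) ger0_norm ?powR_ge0.
apply/measurable_EFinP; apply: measurable_funTS.
exact: (continuous_measurable_fun cg).
Qed.

Lemma Xmem_le_env X f c : continuous f -> (forall x, `|f x| <= c * env x) -> Xmem X f.
Proof.
move=> cf fe.
have c0 : 0 <= c.
  have := fe 0; rewrite /env normr0 addr0 invr1 mulr1; exact: le_trans.
case: X => [p p1|]; last first.
  have [h1 h2] := cvgy_env; split => //; apply: norm_cvg0.
    apply: (@squeeze_cvgr _ _ _ _ (fun=> 0) (fun x => c * env x)).
    - by near=> x; rewrite normr_ge0 fe.
    - exact: cvg_cst.
    - by rewrite -[X in _ --> X](mulr0 c); exact: cvgMr.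
  apply: (@squeeze_cvgr _ _ _ _ (fun=> 0) (fun x => c * env x)).
  - by near=> x; rewrite normr_ge0 fe.
  - exact: cvg_cst.
  - by rewrite -[X in _ --> X](mulr0 c); exact: cvgMr.
have mf := continuous_measurable_fun cf.
rewrite /= inE; apply/andP; split; rewrite inE//= /finite_norm.
have := Xnorm_bigger_env mf (Xmem_env (Lp p1)) fe c0.
move=> /le_lt_trans; apply; rewrite lte_mul_pinfty ?lee_fin//.
exact: (Xnorm_lty (Xmem_env (Lp p1))).
Unshelve. all: by end_near. Qed.

(** A single constant [c] bounds both the supremum and the L^1 norm of [psi]. It then bounds the
    norm in L^q for the conjugate exponent, since the integral of |psi|^q is at most c^(q-1) times
    that of |psi|; Hölder concludes, without [p] entering the constant. *)
Lemma Xpair X u psi c : Xmem X u -> mu.-integrable setT (EFin \o psi) ->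
  (forall x, `|psi x| <= c) -> \int[mu]_x `|psi x| <= c ->
  mu.-integrable setT (EFin \o (fun x => psi x * u x)) /\
  ((`|\int[mu]_x (psi x * u x)|)%:E <= c%:E * Xnorm X u)%E.
Proof.
move=> uX ipsi psic Ipsi; have mu_ := Xmem_meas uX; have mpsi := intble_meas ipsi.
have c0 : 0 <= c := le_trans (normr_ge0 _) (psic 0).
have mpu : measurable_fun setT (fun x => psi x * u x) by exact: measurable_funM.
have key : (\int[mu]_x `|(psi x * u x)%:E| <= c%:E * Xnorm X u)%E.
  case: X uX => [p p1|] uX; last first.
    have [M uM] := C0_bounded uX.
    apply: (@le_trans _ _ (\int[mu]_x (`|psi x|%:E * Xnorm C0 u))%E).
      apply: ge0_le_integral => //.
      - by apply/measurable_EFinP; exact: measurableT_comp.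
      - have -> : Xnorm C0 u = (fine (Xnorm C0 u))%:E.
          by rewrite fineK// ge0_fin_numE ?Xnorm_ge0// Xnorm_lty.
        under eq_fun do rewrite -EFinM.
        apply/measurable_EFinP; apply: measurable_funM => //; exact: measurableT_comp.
      - move=> x _; rewrite /= normrM EFinM lee_wpmul2l ?lee_fin//; exact: C0_le_norm.
    rewrite ge0_integralZr//; last first.
    - exact: Xnorm_ge0.
    - by apply/measurable_EFinP; exact: measurableT_comp.
    apply: lee_wpmul2r; first exact: Xnorm_ge0.
    have := Ipsi; rewrite -lee_fin /Rintegral fineK//.
    apply: integrable_fin_num => //; exact: integrable_norm ipsi.
  pose q := p / (p - 1); have p0 : 0 < p by lra.
  have p10 : 0 < p - 1 by lra.
  have q0 : 0 < q by rewrite divr_gt0.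
  have pq : q^-1 + p^-1 = 1 by rewrite /q; field; lra.
  have := hoelder mu mpsi mu_ q0 p0 pq; rewrite Lnorm1 => /le_trans; apply.
  apply: lee_wpmul2r; first exact: Lnorm_ge0.
  rewrite unlock.
  have q1 : 0 < q - 1 by rewrite /q (_ : _ - 1 = (p - 1)^-1) ?invr_gt0//; field; lra.
  have I : (\int[mu]_x `|(psi x)%:E| `^ q <= (c `^ q)%:E)%E.
    apply: (@le_trans _ _ (\int[mu]_x ((c `^ (q - 1))%:E * `|psi x|%:E))%E).
      apply: ge0_le_integral => //.
      - by move=> x _; rewrite poweR_ge0.
      - apply/measurable_EFinP; apply: (@measurableT_comp _ _ _ _ _ _ (@powR R ^~ q)) => //.
        exact: measurableT_comp.
      - under eq_fun do rewrite -EFinM; apply/measurable_EFinP.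
        by apply: measurable_funM => //; exact: measurableT_comp.
      - move=> x _ /=; rewrite lee_fin -mulr_powRB1// mulrC ler_wpM2r//.
        by rewrite ge0_ler_powR ?nnegrE ?(ltW q1).
    rewrite ge0_integralZl//; last first.
    - by rewrite lee_fin powR_ge0.
    - by apply/measurable_EFinP; exact: measurableT_comp.
    have -> : c `^ q = c `^ (q - 1) * c by rewrite mulrC mulr_powRB1.
    rewrite EFinM lee_wpmul2l ?lee_fin ?powR_ge0//.
    have := Ipsi; rewrite -lee_fin /Rintegral fineK//.
    apply: integrable_fin_num => //; exact: integrable_norm ipsi.
  have -> : (c%:E = (c `^ q)%:E `^ q^-1)%E.
    by rewrite poweR_EFin -powRrM divff ?gt_eqF// powRr1.
  apply: gt0_ler_poweR => //.
  - by rewrite invr_ge0 ltW.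
  - by rewrite in_itv/= leey andbT integral_ge0// => x _; rewrite poweR_ge0.
  - by rewrite in_itv/= leey andbT lee_fin powR_ge0.
have ipu : mu.-integrable setT (EFin \o (fun x => psi x * u x)).
  apply/integrableP; split; first exact/measurable_EFinP.
  apply: le_lt_trans key _.
  by rewrite lte_mul_pinfty ?lee_fin// Xnorm_lty.
split => //; apply: le_trans key.
rewrite (le_trans _ (le_abse_integral mu measurableT _))//.
  by rewrite /Rintegral -EFin_normr_Rintegral.
by exact/measurable_EFinP.
Qed.

End function_spaces.

(** * Pairing with the heat kernel *)

Section heat_pairing.
Context {R : realType}.
Notation mu := (@lebesgue_measure R).
Implicit Types (X : Xspace R) (u v w psi : R -> R) (b t s l : R).

Lemma eps_lt (e : R) (x : nat -> \bar R) : x n @[n --> \oo] --> 0%E -> 0 < e ->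
  \forall n \near \oo, (x n < e%:E)%E.
Proof.
move=> x0 e0; apply: (x0 [set y | (y < e%:E)%E]).
by rewrite /= /nbhs /=; near=> y; rewrite lte_fin; near: y; exact: lt_nbhsl.
Unshelve. all: by end_near. Qed.

Lemma intbleZ (D : set R) (c : R) (f : R -> R) : measurable D ->
  mu.-integrable D (EFin \o f) -> mu.-integrable D (EFin \o (fun x => c * f x)).
Proof.
move=> mD i.
rewrite (_ : EFin \o _ = (fun x => c%:E * (EFin \o f) x)%E); last exact/funext.
by apply: integrableZl.
Qed.

Lemma intbleD (D : set R) (f g : R -> R) : measurable D ->
  mu.-integrable D (EFin \o f) -> mu.-integrable D (EFin \o g) ->
  mu.-integrable D (EFin \o (fun x => f x + g x)).
Proof. move=> mD i j.
rewrite (_ : EFin \o _ = (EFin \o f) \+ (EFin \o g))%E; last exact/funext.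
by apply: integrableD. Qed.

Lemma RintegralcM (D : set R) (c : R) (f : R -> R) : measurable D ->
  mu.-integrable D (EFin \o f) -> \int[mu]_(x in D) (c * f x) = c * \int[mu]_(x in D) f x.
Proof. by move=> mD i; apply: RintegralZl. Qed.

Lemma measurable_fst_on (D1 D2 : set R) (g : R -> R) : measurable D1 -> measurable D2 ->
  measurable_fun D1 g -> measurable_fun (D1 `*` D2) (fun z : R * R => g z.1).
Proof.
move=> m1 m2 mg; apply: (eq_measurable_fun (fun z : R * R => (g \_ D1) z.1)).
  by move=> z /set_mem [z1 _] /=; rewrite patchE mem_set.
apply: measurable_funTS; apply: measurableT_comp => //.
exact/(measurable_restrictT _ m1).
Qed.

Lemma measurable_snd_on (D1 D2 : set R) (g : R -> R) : measurable D1 -> measurable D2 ->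
  measurable_fun D2 g -> measurable_fun (D1 `*` D2) (fun z : R * R => g z.2).
Proof.
move=> m1 m2 mg; apply: (eq_measurable_fun (fun z : R * R => (g \_ D2) z.2)).
  by move=> z /set_mem [_ z2] /=; rewrite patchE mem_set.
apply: measurable_funTS; apply: measurableT_comp => //.
exact/(measurable_restrictT _ m2).
Qed.

Definition nrm X u : R := fine (Xnorm X u).

Lemma nrmE X u : Xmem X u -> Xnorm X u = (nrm X u)%:E.
Proof. by move=> uX; rewrite fineK// ge0_fin_numE ?Xnorm_ge0 ?Xnorm_lty. Qed.

Lemma nrm_ge0 X u : 0 <= nrm X u.
Proof. by rewrite fine_ge0 ?Xnorm_ge0. Qed.

Lemma Xcvg_nrm X (u_ : nat -> R -> R) u : Xcvg X u_ u ->
  nrm X (u_ n \- u) @[n --> \oo] --> 0.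
Proof. by move=> /fine_cvg. Qed.

(** The mass of the heat kernel plus its peak: a common bound for its L^1 and supremum norms, as
    [Xpair] asks, and also the numerator in [hk_le_inv]. *)
Definition amp t : R := 1 + (Num.sqrt (4 * pi * t))^-1.

Lemma amp_gt0 t : 0 < amp t.
Proof. by rewrite ltr_wpDr ?invr_ge0 ?sqrtr_ge0. Qed.

Lemma amp_le s t : 0 < s -> s <= t -> amp t <= amp s.
Proof.
move=> s0 st; rewrite lerD2l lef_pV2 ?posrE ?sqrtr_gt0 ?mulr_gt0 ?pi_gt0//; last by lra.
by rewrite ler_wsqrtr// ler_wpM2l// mulr_ge0// pi_ge0.
Qed.

Lemma Xpair_hk X u psi t b (K : R) : Xmem X u -> 0 < t -> 0 <= K ->
  measurable_fun setT psi -> (forall y, `|psi y| <= K * hk t (y - b)) ->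
  mu.-integrable setT (EFin \o (fun y => psi y * u y)) /\
  `|\int[mu]_y (psi y * u y)| <= K * amp t * nrm X u.
Proof.
move=> uX t0 K0 mpsi psiK.
have ihk := integrableZl measurableT K (integrable_hk b t0).
have [||//|i h] := @Xpair R X u psi (K * amp t) uX.
- exact: le_intble ihk _.
- move=> y; apply: le_trans (psiK y) _; rewrite ler_wpM2l// ler_wpDl//.
  exact: hk_le_peak.
- have h1 : \int[mu]_y (K * hk t (y - b)) = K.
    by rewrite RintegralZl ?integral_hk ?mulr1//; exact: integrable_hk.
  apply: (@le_trans _ _ K); last by rewrite ler_peMr// lerDl invr_ge0 sqrtr_ge0.
  rewrite -[leRHS]h1; apply: le_trans (ler_norm _) _.
  apply: Rintegral_le_norm => //; first exact: measurableT_comp.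
  by move=> y _; rewrite normr_id.
by split => //; rewrite -lee_fin EFinM -nrmE.
Qed.

Definition hp u b t : R := \int[mu]_y (hk t (y - b) * u y).
(** The time derivative of [hp u b]; for [u] in D(A) it is the pairing of [- A u] with the heat
    kernel, see [is_A_hp2]. *)
Definition hp2 u b t : R := \int[mu]_y (hk2 t (y - b) * u y).

Lemma hp_intble X u b t : Xmem X u -> 0 < t ->
  mu.-integrable setT (EFin \o (fun y => hk t (y - b) * u y)).
Proof.
move=> uX t0.
have [] // := @Xpair_hk X u (fun y => hk t (y - b)) t b 1 uX t0 ler01 (measurable_hk b t0).
by move=> y; rewrite mul1r ger0_norm// hk_ge0.
Qed.

Lemma hp_le X u b t : Xmem X u -> 0 < t -> `|hp u b t| <= amp t * nrm X u.
Proof.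
move=> uX t0.
have [] // := @Xpair_hk X u (fun y => hk t (y - b)) t b 1 uX t0 ler01 (measurable_hk b t0).
  by move=> y; rewrite mul1r ger0_norm// hk_ge0.
by rewrite mul1r.
Qed.

Lemma hp2_intble X u b t : Xmem X u -> 0 < t ->
  mu.-integrable setT (EFin \o (fun y => hk2 t (y - b) * u y)).
Proof.
move=> uX t0.
by have [] // := @is_derive_integral_hk R b u (Xmem_meas uX) (fun t => hp_intble b uX) t t0.
Qed.

Lemma is_derive_hp X u b t : Xmem X u -> 0 < t ->
  is_derive t 1 (hp u b) (hp2 u b t).
Proof.
move=> uX t0.
by have [] // := @is_derive_integral_hk R b u (Xmem_meas uX) (fun t => hp_intble b uX) t t0.
Qed.

Lemma hp2_le X u b t : Xmem X u -> 0 < t ->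
  `|hp2 u b t| <= 4 / t * amp (2 * t) * nrm X u.
Proof.
move=> uX t0; have t2 : 0 < 2 * t by lra.
have [] // := @Xpair_hk X u (fun y => hk2 t (y - b)) (2 * t) b (4 / t) uX t2.
- by rewrite divr_ge0 ?ltW.
- exact: measurable_hk2.
- by move=> y; exact: hk2_le.
Qed.

Lemma hp2_le_shift X u b t s : Xmem X u -> 0 < t -> 0 <= s ->
  `|hp2 u b (t + s)| <= 4 * amp t * nrm X u / (t + s).
Proof.
move=> uX t0 s0; have ts : 0 < t + s by lra.
apply: le_trans (hp2_le b uX ts) _.
rewrite mulrAC [leRHS]mulrAC -!mulrA ler_wpM2l// [leRHS]mulrCA ler_wpM2l ?invr_ge0 ?(ltW ts)//.
by rewrite mulrC ler_wpM2r ?nrm_ge0// amp_le//; lra.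
Qed.

Lemma hp_lin X u v b t (c : R) : Xmem X u -> Xmem X v -> 0 < t ->
  hp (fun y => c * u y + v y) b t = c * hp u b t + hp v b t.
Proof.
move=> uX vX t0; rewrite /hp.
have iu := hp_intble b uX t0; have iv := hp_intble b vX t0.
rewrite -RintegralZl// -RintegralD//; last exact: (integrableZl measurableT c iu).
by apply: eq_Rintegral => y _; ring.
Qed.

Lemma hp_scale X u b t (c : R) : Xmem X u -> 0 < t ->
  hp (fun y => c * u y) b t = c * hp u b t.
Proof.
move=> uX t0; rewrite /hp -RintegralZl//; last exact: (hp_intble b uX).
by apply: eq_Rintegral => y _; ring.
Qed.

Lemma hp_sub X u v b t : Xmem X u -> Xmem X v -> 0 < t ->
  hp (u \- v) b t = hp u b t - hp v b t.
Proof.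
move=> uX vX t0; rewrite /hp -RintegralB//; [|exact: (hp_intble b uX)|exact: (hp_intble b vX)].
by apply: eq_Rintegral => y _ /=; ring.
Qed.

Lemma hp2_sub X u v b t : Xmem X u -> Xmem X v -> 0 < t ->
  hp2 (u \- v) b t = hp2 u b t - hp2 v b t.
Proof.
move=> uX vX t0; rewrite /hp2 -RintegralB//; [|exact: (hp2_intble b uX)|exact: (hp2_intble b vX)].
by apply: eq_Rintegral => y _ /=; ring.
Qed.

Lemma hp_sum X k (c : nat -> R) (h : nat -> R -> R) b t : 0 < t ->
  (forall i, (i < k)%N -> Xmem X (h i)) ->
  hp (fun x => \sum_(i < k) c i * h i x) b t = \sum_(i < k) c i * hp (h i) b t.
Proof.
move=> t0; elim: k => [|k ih] hX.
  rewrite big_ord0 /hp; under eq_Rintegral do rewrite big_ord0 mulr0.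
  by rewrite /Rintegral integral0.
have hX' i : (i < k)%N -> Xmem X (h i) by move=> ik; apply: hX; rewrite ltnS ltnW.
rewrite big_ord_recr/= -ih//.
rewrite (_ : (fun x => _) = (fun x => c k * h k x + \sum_(i < k) c i * h i x)); last first.
  by apply/funext => x; rewrite big_ord_recr addrC.
rewrite (@hp_lin X)//; [by rewrite addrC|exact: hX|exact: Xmem_sum].
Qed.

Lemma hp_eq X u v b t : Xmem X u -> Xmem X v -> Xeq X u v -> 0 < t ->
  hp u b t = hp v b t.
Proof.
move=> uX vX uv t0; apply: Rintegral_ae_eq => //.
- by apply: measurable_funM; [exact: measurable_hk|exact: Xmem_meas uX].
- by apply: measurable_funM; [exact: measurable_hk|exact: Xmem_meas vX].
- by apply: ae_imp (Xforall_ae uv) => y -> .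
Qed.

Lemma hp_cvg X (u_ : nat -> R -> R) u b t : 0 < t -> (forall n, Xmem X (u_ n)) ->
  Xmem X u -> Xcvg X u_ u -> hp (u_ n) b t @[n --> \oo] --> hp u b t.
Proof.
move=> t0 unX uX /Xcvg_nrm un0; apply/subr_cvg0.
apply: norm_cvg0.
apply: (@squeeze_cvgr _ _ _ _ (fun=> 0) (fun n => amp t * nrm X (u_ n \- u))).
- near=> n; rewrite normr_ge0/= -(@hp_sub X)//; apply: hp_le => //; exact: Xmem_sub.
- exact: cvg_cst.
- by rewrite -[X in _ --> X](mulr0 (amp t)); exact: cvgMr.
Unshelve. all: by end_near. Qed.

Lemma continuous_hp2 X u b t : Xmem X u -> 0 < t -> {for t, continuous (hp2 u b)}.
Proof.
move=> uX t0; have t4 : 0 < 4 * t by lra.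
have := @continuity_under_integral R _ _ mu (fun s y => hk2 s (y - b) * u y) setT
  measurableT (t / 2) (2 * t).
move=> /(_ _ _ (fun y => 16 / t * (hk (4 * t) (y - b) * `|u y|))); apply.
- move=> s; rewrite /= in_itv/= => /andP[s1 s2]; apply: hp2_intble uX _; lra.
- apply: aeW => y _ s; rewrite inE/= in_itv/= => /andP[s1 s2].
  have s0 : s != 0 by rewrite gt_eqF//; lra.
  have s4 : 0 < 4 * pi * s by rewrite !mulr_gt0 ?pi_gt0//; lra.
  have s00 : 0 < s by lra.
  rewrite /hk2 /hk; isDcont; by rewrite ?mulf_neq0 ?sqrf_eq0 ?gt_eqF ?sqrtr_gt0.
- have := integrable_norm (hp_intble b uX t4) => /(integrableZl measurableT (16 / t)).
  apply: eq_integrable => // y _ /=; rewrite normrM ger0_norm ?hk_ge0//.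
- move=> s; rewrite /= in_itv/= => st; apply: aeW => y _.
  by rewrite normrM mulrA ler_wpM2r// hk2_le_local.
- by rewrite inE/= in_itv/=; lra.
Qed.

(** The weak identity defining A is tested with a heat kernel, which has no compact support;
    [weak_laplacian_ext] allows this once the products with the kernel and its first two derivatives
    are integrable. *)
Lemma is_A_hp2 X r a b t : is_A X r a -> 0 < t -> hp2 r b t = - hp a b t.
Proof.
move=> [rX aX weak] t0; rewrite /hp /hp2.
have ir := hp_intble b rX t0; have ir2 := hp2_intble b rX t0.
have ia := hp_intble b aX t0.
have isub (f : R -> R) (x d : R) : is_derive (x - b) 1 f d ->
    is_derive x 1 (fun y => f (y - b)) d.
  move=> df; have d1 : is_derive x 1 (fun y : R => y - b) 1 by isDeq; ring.
  by apply: is_derive_eq (@isD_comp _ f (fun y : R => y - b) x _ _ df d1) _; ring.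
pose K1 y := - ((y - b) / (2 * t)) * hk t (y - b).
have dK1 (y : R) : is_derive y 1 K1 (hk2 t (y - b)).
  exact: (isub (fun y => - (y / (2 * t)) * hk t y)) (is_derive_hk1 _ t0).
have := @weak_laplacian_ext R r a (fun y => hk t (y - b)) K1 (fun y => hk2 t (y - b)).
move=> H; transitivity (\int[mu]_x (r x * hk2 t (x - b))).
  by apply: eq_Rintegral => y _; rewrite mulrC.
transitivity (- \int[mu]_x (a x * hk t (x - b))); last first.
  by congr (- _); apply: eq_Rintegral => y _; rewrite mulrC.
apply: H => //.
- exact: Xmem_meas rX.
- exact: Xmem_meas aX.
- by move=> y; apply: isub; exact: is_derive_hk.
- by move=> m; exact: Ck_hk.
- by apply: eq_integrable ir => // y _ /=; rewrite mulrC.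
(* The first derivative of the kernel is controlled by the other two: with [q = |z / (2 t)|],
   [q <= 1 + q^2] and [hk2 = (q^2 - 1/(2 t)) * hk]. *)
- have i1 := integrableD measurableT
    (integrableZl measurableT (1 + (2 * t)^-1) (integrable_norm ir)) (integrable_norm ir2).
  apply: le_intble i1 _ => //.
    apply: measurable_funM; first exact: Xmem_meas rX.
    by apply: continuous_measurable_fun => y; exact: isD_continuous (dK1 y).
  move=> y _; rewrite /K1 /=; set z := y - b.
  rewrite (_ : hk2 t z = (z ^+ 2 / (4 * t ^+ 2) - (2 * t)^-1) * hk t z)//.
  move: (hk t z) (hk_ge0 z t0) => h h0.
  rewrite mulrC !normrM normrN (ger0_norm h0) !mulrA -mulrDl ler_wpM2r//.
  rewrite -mulrDl ler_wpM2r//.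
  have -> : z ^+ 2 / (4 * t * t) = `|z / (2 * t)| ^+ 2.
    by rewrite real_normK ?num_real//; field; lra.
  set q := `|z / (2 * t)|; set k := (2 * t)^-1.
  have k0 : 0 < k by rewrite invr_gt0; lra.
  have := ler_norm (q ^+ 2 - k).
  have q0 : 0 <= q := normr_ge0 _.
  have q2 : q <= 1 + q ^+ 2 by nra.
  lra.
- by apply: eq_integrable ir2 => // y _ /=; rewrite mulrC.
- by apply: eq_integrable ia => // y _ /=; rewrite mulrC.
Qed.

Lemma integrable_expRN l : 0 < l ->
  mu.-integrable `]0, +oo[ (EFin \o (fun s => expR (- (l * s)))).
Proof.
move=> l0; pose F s := - l^-1 * expR (- (l * s)).
have dF (s : R) : is_derive s 1 F (expR (- (l * s))).
  by rewrite /F; isDeq; field; lra.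
have [] // := @ftc_oy R (fun s => expR (- (l * s))) F 0 (F 0) 0 => //.
- by move=> x _; isDcont.
- by apply: cvg_at_right_filter; exact: isD_continuous (dF 0).
- rewrite -[X in _ --> X](mulr0 (- l^-1)); apply: cvgMr.
  apply: (cvg_comp (fun s => l * s) (fun y => expR (- y)) _ (@cvg_expRN R)).
  by apply: gt0_cvgMry.
- by left => x _; rewrite expR_ge0.
Qed.

(** After pairing, the resolvent is the Laplace transform of the heat semigroup:
    [hp a = l * hp r - hp2 r], so the integrand is the derivative of
    [- exp (- l s) * hp r b (t + s)], which vanishes at infinity. *)
Lemma resolvent_hp X l a r b t : is_resolvent X l a r -> Xmem X a -> 0 < l -> 0 < t ->
  mu.-integrable `]0, +oo[ (EFin \o (fun s => expR (- (l * s)) * hp a b (t + s))) /\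
  \int[mu]_(s in `]0, +oo[) (expR (- (l * s)) * hp a b (t + s)) = hp r b t.
Proof.
move=> [a' Aa' rE] aX l0 t0; have [rX a'X _] := Aa'.
have E s : 0 < s -> hp a b s = l * hp r b s - hp2 r b s.
  move=> s0; rewrite (is_A_hp2 b Aa' s0) opprK -(@hp_lin X)//.
  by apply: (@hp_eq X) => //; [exact: Xmem_lin|exact: (Xforall_imp _ rE)].
have dsh (u : R -> R) (s : R) : Xmem X u -> 0 < t + s ->
    is_derive s 1 (fun s => hp u b (t + s)) (hp2 u b (t + s)).
  move=> uX ts; have d1 : is_derive s 1 (fun s : R => t + s) (0 + 1) by isD.
  have := @isD_comp _ (hp u b) (fun s => t + s) s _ _ (is_derive_hp b uX ts) d1.
  by move/is_derive_eq; apply; ring.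
pose F s := - (expR (- (l * s)) * hp r b (t + s)).
have dF s : 0 < t + s -> is_derive s 1 F (expR (- (l * s)) * hp a b (t + s)).
  move=> ts; have d0 := dsh r s rX ts; rewrite /F; isDeq.
  by rewrite E//; ring.
have cf s : 0 < t + s -> {for s, continuous (fun s => expR (- (l * s)) * hp a b (t + s))}.
  by move=> ts; have d0 := dsh a s aX ts; isDcont.
have F0 : 0 - F 0 = hp r b t by rewrite /F mulr0 oppr0 expR0 mul1r addr0 sub0r opprK.
rewrite -F0; apply: (@ftc_oy R (fun s => expR (- (l * s)) * hp a b (t + s)) F 0 (F 0) 0).
- by move=> x x0; apply: dF; lra.
- by move=> x x0; apply: cf; lra.
- by apply: cvg_at_right_filter; apply: isD_continuous (dF 0 _); lra.
- apply: norm_cvg0.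
  apply: (@squeeze_cvgr _ _ _ _ (fun=> 0) (fun s => expR (- (l * s)) * (amp t * nrm X r))).
  + near=> s; have s0 : 0 < s by near: s; apply: nbhs_pinfty_gt; exact: num_real.
    rewrite normr_ge0/= /F normrN normrM ger0_norm ?expR_ge0// ler_wpM2l ?expR_ge0//.
    apply: le_trans (hp_le b rX _) _; first by lra.
    by rewrite ler_wpM2r ?nrm_ge0// amp_le//; lra.
  + exact: cvg_cst.
  + rewrite -[X in _ --> X](mul0r (amp t * nrm X r)); apply: cvgMl.
    apply: (cvg_comp (fun s => l * s) (fun y => expR (- y)) _ (@cvg_expRN R)).
    by apply: gt0_cvgMry.
- right; have i1 : mu.-integrable `]0, +oo[
      (EFin \o (fun s => amp t * nrm X a * expR (- (l * s)))).
    by apply: intbleZ => //; exact: integrable_expRN.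
  apply: le_intble i1 _ => //.
    apply: open_continuous_measurable_fun => // s; rewrite inE/= in_itv/= andbT => s0.
    by apply: cf; lra.
  move=> s; rewrite /= in_itv/= andbT => s0.
  rewrite normrM ger0_norm ?expR_ge0// mulrC ler_wpM2r ?expR_ge0//.
  apply: le_trans (hp_le b aX _) _; first by lra.
  by rewrite ler_wpM2r ?nrm_ge0// amp_le//; lra.
Unshelve. all: by end_near. Qed.

Lemma continuous_hp2_shift X u b t s : Xmem X u -> 0 < t -> 0 <= s ->
  {for s, continuous (fun s => hp2 u b (t + s))}.
Proof.
move=> uX t0 s0; have ts : 0 < t + s by lra.
have c2 : hp2 u b y @[y --> t + s] --> hp2 u b (t + s) := @continuous_hp2 X u b _ uX ts.
have c1 : t + s' @[s' --> s] --> t + s by apply: cvgD; [exact: cvg_cst|exact: cvg_id].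
exact: (cvg_comp (fun s' => t + s') (hp2 u b) c1 c2).
Qed.

Lemma measurable_hp2_shift X u b t : Xmem X u -> 0 < t ->
  measurable_fun (`]0, +oo[ : set R) (fun s => hp2 u b (t + s)).
Proof.
move=> uX t0; apply: open_continuous_measurable_fun => // s.
rewrite inE/= in_itv/= andbT => s0; apply: continuous_hp2_shift uX t0 _; exact: ltW.
Qed.

Lemma measurable_sqrtV : measurable_fun (`]0, +oo[ : set R) (fun s => (Num.sqrt s)^-1).
Proof.
apply: open_continuous_measurable_fun => // s; rewrite inE/= in_itv/= andbT => s0.
by isDcont; rewrite ?gt_eqF ?sqrtr_gt0.
Qed.

(** For [t > 0] the integral converges for every [u] in X, not only on D(A^(1/2)): the decay 1/(t+s)
    of [hp2] leads back to [integral_sqrt_cauchy]. Hence [hA] is a bounded functional on X. *)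
Lemma Ahalf_kernel_intble X u b t : Xmem X u -> 0 < t ->
  mu.-integrable `]0, +oo[ (EFin \o (fun s => (Num.sqrt s)^-1 * hp2 u b (t + s))) /\
  `|\int[mu]_(s in `]0, +oo[) ((Num.sqrt s)^-1 * hp2 u b (t + s))| <=
  4 * amp t * (pi / Num.sqrt t) * nrm X u.
Proof.
move=> uX t0; have [i e] := integral_sqrt_cauchy t0.
set g := fun s => 4 * amp t * nrm X u * (Num.sqrt s * (t + s))^-1.
have ig : mu.-integrable `]0, +oo[ (EFin \o g) by exact: intbleZ.
have m : measurable_fun (`]0, +oo[ : set R) (fun s => (Num.sqrt s)^-1 * hp2 u b (t + s)).
  by apply: measurable_funM; [exact: measurable_sqrtV|exact: (measurable_hp2_shift b uX)].
have le s : (`]0, +oo[%classic : set R) s ->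
    `|(Num.sqrt s)^-1 * hp2 u b (t + s)| <= g s.
  rewrite /= in_itv/= andbT => s0; rewrite normrM ger0_norm ?invr_ge0 ?sqrtr_ge0//.
  apply: (le_trans (ler_wpM2l _ (hp2_le_shift b uX t0 (ltW s0)))).
    by rewrite invr_ge0 sqrtr_ge0.
  by rewrite /g invfM mulrCA.
split; first exact: le_intble ig le.
apply: le_trans (Rintegral_le_norm _ m ig le) _ => //.
by rewrite /g RintegralZl// e mulrAC.
Qed.

(* Pairing of A^(1/2) u with the heat kernel, see [Ahalf_hp]. *)
Definition hA u b t : R :=
  - ((Num.sqrt pi)^-1 * \int[mu]_(s in `]0, +oo[) ((Num.sqrt s)^-1 * hp2 u b (t + s))).

Lemma simple_intble D k (E : nat -> set R) (p : nat -> R) : measurable D ->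
  (forall i, (i < k)%N -> [/\ measurable (E i), E i `<=` D & (mu (E i) < +oo)%E]) ->
  mu.-integrable D (EFin \o (fun l => \sum_(i < k) \1_(E i) l * p i)) /\
  \int[mu]_(l in D) (\sum_(i < k) \1_(E i) l * p i) =
  \sum_(i < k) fine (mu (E i)) * p i.
Proof.
move=> mD; elim: k => [|k ih] HE.
  rewrite big_ord0; split.
    apply: eq_integrable (integrable0 mu D) => // x _ /=.
    by rewrite big_ord0.
  under eq_Rintegral do rewrite big_ord0.
  by rewrite /Rintegral integral0.
have [i1 e1] := ih (fun i ik => HE i (leqW ik)).
have [mE ED Efin] := HE k (ltnSn k).
have iE : mu.-integrable D (EFin \o \1_(E k)).
  apply/integrableP; split; first by apply/measurable_EFinP; exact: measurable_indic.
  under eq_integral do rewrite /= ger0_norm//.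
  by rewrite integral_indic// setIidl.
have iEp : mu.-integrable D (EFin \o (fun l => \1_(E k) l * p k)).
  by under eq_fun do rewrite mulrC; exact: intbleZ.
rewrite big_ord_recr /= -e1; split.
  by under eq_fun do rewrite big_ord_recr /=; exact: intbleD.
transitivity (\int[mu]_(l in D) (\sum_(i < k) \1_(E i) l * p i + \1_(E k) l * p k)).
  by apply: eq_Rintegral => l _; rewrite big_ord_recr.
rewrite RintegralD//; congr (_ + _).
rewrite RintegralZr//; congr (_ * _).
by rewrite /Rintegral integral_indic// setIidl.
Qed.

(** Pairing is a bounded functional of norm at most [amp t], so it commutes with the Bochner
    integral. The simple functions are paired term by term, and their scalar integrals converge to
    both sides. *)
Lemma Bochner_hp X D (f : R -> R -> R) w b t : measurable D -> 0 < t ->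
  is_Bochner X D f w -> measurable_fun D (fun l => hp (f l) b t) ->
  mu.-integrable D (EFin \o (fun l => hp (f l) b t)) /\
  \int[mu]_(l in D) hp (f l) b t = hp w b t.
Proof.
move=> mD t0 [fX [wX [k [E [c /= [HE _ H3 H4]]]]]] mF.
set F := fun l => hp (f l) b t.
pose sg n l := \sum_(i < k n) \1_(E n i) l * hp (c n i) b t.
have cX n i : (i < k n)%N -> Xmem X (c n i) by case/HE.
have sgP n := @simple_intble D (k n) (E n) (fun i => hp (c n i) b t) mD
  (fun i ik => let: And4 h1 h2 h3 _ := HE n i ik in And3 h1 h2 h3).
set eps := fun n => (\int[mu]_(l in D) Xnorm X (f l \- _)%R)%E in H3.
have A0 := amp_gt0 t.
(* The scalar error in L^1 is at most the Bochner error, compared without measurability of the norm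
   in [l]. *)
have key n : (\int[mu]_(l in D) `|F l - sg n l|%:E <= (amp t)%:E * eps n)%E.
  have mFs : measurable_fun D (fun l => `|F l - sg n l|).
    apply: measurableT_comp => //; apply: measurable_funB => //.
    exact: intble_meas (sgP n).1.
  rewrite -lee_pdivrMl// -ge0_integralZl//=; last 2 first.
  - exact/measurable_EFinP.
  - by rewrite lee_fin invr_ge0 ltW.
  apply: ge0_le_integral_nomeas => //.
  - by move=> l _; rewrite -EFinM lee_fin mulr_ge0// invr_ge0 ltW.
  - move=> l Dl; have sX : Xmem X (fun x => \sum_(i < k n) \1_(E n i) l * c n i x).
      by apply: (Xmem_sum (fun i => \1_(E n i) l)); exact: cX.
    have dX := Xmem_sub (fX _ Dl) sX.
    rewrite (nrmE dX) -EFinM lee_fin ler_pdivrMl//.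
    rewrite /F /sg -(@hp_sum X (k n) (fun i => \1_(E n i) l) (c n))//; last exact: cX.
    rewrite -(@hp_sub X)//; last exact: fX.
    exact: hp_le.
have mFs n : measurable_fun D (fun l => F l - sg n l).
  by apply: measurable_funB => //; exact: intble_meas (sgP n).1.
have ev (e : R) : 0 < e -> \forall n \near \oo,
    mu.-integrable D (EFin \o (fun l => F l - sg n l)) /\
    `|\int[mu]_(l in D) (F l - sg n l)| < e.
  move=> e0; have e1 : 0 < (amp t)^-1 * e by rewrite mulr_gt0 ?invr_gt0.
  have := eps_lt H3 e1; apply: filterS => n en.
  have lt : (\int[mu]_(l in D) `|F l - sg n l|%:E < e%:E)%E.
    apply: le_lt_trans (key n) _.
    by rewrite muleC -lte_pdivlMr// muleC -EFinM.
  have i1 : mu.-integrable D (EFin \o (fun l => F l - sg n l)).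
    apply/integrableP; split; first by apply/measurable_EFinP; exact: mFs.
    by apply: lt_trans lt _; rewrite ltry.
  split => //; rewrite -lte_fin; apply: le_lt_trans lt.
  apply: (@le_trans _ _ (\int[mu]_(l in D) `|F l - sg n l|)%:E).
    by rewrite lee_fin le_normr_Rintegral.
  rewrite /Rintegral fineK//; apply: integrable_fin_num => //.
  exact: integrable_norm i1.
have iF : mu.-integrable D (EFin \o F).
  have [n [i1 _]] := filter_ex (ev 1 ltr01).
  have := intbleD mD i1 (sgP n).1.
  by under eq_fun do rewrite subrK.
split => //.
have c1 : \int[mu]_(l in D) sg n l @[n --> \oo] --> \int[mu]_(l in D) F l.
  apply/cvgrPdist_lt => e e0; have := ev e e0; apply: filterS => n [_].
  by rewrite RintegralB//; exact: (sgP n).1.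
have c2 : \int[mu]_(l in D) sg n l @[n --> \oo] --> hp w b t.
  have IX n : Xmem X (fun x => \sum_(i < k n) fine (mu (E n i)) * c n i x).
    by apply: (Xmem_sum (fun i => fine (mu (E n i)))); exact: cX.
  have c3 := @hp_cvg X _ w b t t0 IX wX H4.
  rewrite (_ : (fun n => \int[mu]_(l in D) sg n l) = (fun n =>
    hp (fun x => \sum_(i < k n) fine (mu (E n i)) * c n i x) b t))//.
  by apply/funext => n; rewrite (sgP n).2 (@hp_sum X (k n) (fun i => fine (mu (E n i))) (c n))//; exact: cX.
exact: (cvg_unique (@Rhausdorff R) c1 c2).
Qed.

Lemma powRN_half (l : R) : 0 < l -> l `^ (- 2^-1) = (Num.sqrt l)^-1.
Proof. by move=> l0; rewrite powRN powR12_sqrt// ltW. Qed.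

Lemma divr_sqrt (x : R) : 0 < x -> x^-1 * Num.sqrt x = (Num.sqrt x)^-1.
Proof.
move=> x0; rewrite -[X in X^-1 * _](sqr_sqrtr (ltW x0)) expr2 invfM -mulrA mulVf ?mulr1//.
by rewrite gt_eqF// sqrtr_gt0.
Qed.

(** Pairing replaces each resolvent by a Laplace integral in s. After Fubini, the l-integral of
    [l^(-1/2) * exp (- l s)] is [sqrt pi / sqrt s], and the prefactor 1/pi becomes 1/sqrt pi. The
    minus sign in [hA] comes from [hp (A v) = - hp2 v]. *)
Lemma Balakrishnan_hp X v w b t : is_Balakrishnan X v w -> 0 < t -> hp w b t = hA v b t.
Proof.
move=> [a [r [I [Aa rl HB wX wI]]]] t0.
have [vX aX _] := Aa; have [_ [IX _]] := HB.
have -> : hp w b t = pi^-1 * hp I b t.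
  by rewrite -(@hp_scale X)//; apply: (@hp_eq X) => //; exact: Xmem_scale.
pose h s l := (Num.sqrt l)^-1 * expR (- (l * s)) * hp a b (t + s).
have m0 : measurable (`]0, +oo[%classic : set R) by [].
have hpa s : 0 <= s -> hp a b (t + s) = - hp2 v b (t + s).
  by move=> s0; rewrite (is_A_hp2 b Aa) ?opprK//; lra.
have mha : measurable_fun (`]0, +oo[ : set R) (fun s => hp a b (t + s)).
  apply: (eq_measurable_fun (fun s => -1 * hp2 v b (t + s))).
    by move=> s; rewrite inE/= in_itv/= andbT => s0; rewrite hpa ?mulN1r// ltW.
  by apply: measurable_funM => //; exact: (measurable_hp2_shift b vX t0).
have [ik ek] := Ahalf_kernel_intble b vX t0.
have inner s : 0 < s -> mu.-integrable `]0, +oo[ (EFin \o h s) /\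
    forall c, \int[mu]_(l in `]0, +oo[) ((Num.sqrt l)^-1 * expR (- (l * s)) * c) =
    Num.sqrt pi / Num.sqrt s * c.
  move=> s0; have [i e] := integral_laplace_sqrt s0; split.
    have -> : h s = (fun l => hp a b (t + s) * ((Num.sqrt l)^-1 * expR (- (l * s)))).
      by apply/funext => l; rewrite mulrC.
    exact: intbleZ.
  by move=> c; rewrite RintegralZr// e.
have [|||s|||i1 i2 FE] := @Rintegral_Fubini R `]0, +oo[ `]0, +oo[ h
    (fun s => Num.sqrt pi * `|(Num.sqrt s)^-1 * hp2 v b (t + s)|).
- by [].
- by [].
- rewrite /h; apply: measurable_funM; last exact: (measurable_fst_on m0 m0 mha).
  apply: measurable_funM; first exact: (measurable_snd_on m0 m0 measurable_sqrtV).
  apply: measurable_funTS; apply: measurableT_comp => //; apply: measurableT_comp => //.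
  exact: measurable_funM.
- by rewrite /= in_itv/= andbT => s0; case: (inner s s0).
- move=> s; rewrite /= in_itv/= andbT => s0; have [_ e] := inner s s0.
  rewrite le_eqVlt; apply/orP; left; apply/eqP.
  transitivity (\int[mu]_(l in `]0, +oo[) ((Num.sqrt l)^-1 * expR (- (l * s)) *
     `|hp2 v b (t + s)|)); last first.
    rewrite e normrM (ger0_norm (_ : 0 <= (Num.sqrt s)^-1)) ?invr_ge0 ?sqrtr_ge0//.
    by rewrite mulrA.
  apply: eq_Rintegral.
  move=> l _; rewrite /h hpa ?(ltW s0)// normrM normrN ger0_norm//.
- by apply: intbleZ => //; exact: integrable_norm ik.
set F := fun l => hp (fun x => l `^ (- 2^-1) * r l x) b t.
have FE' l : 0 < l -> F l = \int[mu]_(s in `]0, +oo[) h s l.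
  move=> l0; have [a' Aa' _] := rl _ l0; have [rX _ _] := Aa'.
  have [j e] := resolvent_hp b (rl _ l0) aX l0 t0.
  have e1 : F l = (Num.sqrt l)^-1 * hp (r l) b t.
    rewrite -(powRN_half l0); exact: (@hp_scale X (r l) b t _ rX t0).
  rewrite e1 -e.
  transitivity (\int[mu]_(s in `]0, +oo[) ((Num.sqrt l)^-1 * (expR (- (l * s)) * hp a b (t + s)))).
    by rewrite RintegralZl.
  by apply: eq_Rintegral => s _; rewrite /h mulrA.
have mF : measurable_fun (`]0, +oo[ : set R) F.
  apply: eq_measurable_fun (intble_meas i2) => l; rewrite inE/= in_itv/= andbT => l0.
  by rewrite FE'.
have [_ eI] := Bochner_hp m0 t0 HB mF; rewrite -eI.
have -> : \int[mu]_(l in `]0, +oo[) F l = \int[mu]_(l in `]0, +oo[) \int[mu]_(s in `]0, +oo[) h s l.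
  by apply: eq_Rintegral => l; rewrite inE/= in_itv/= andbT => l0; rewrite -FE'.
rewrite -FE.
have -> : \int[mu]_(s in `]0, +oo[) \int[mu]_(l in `]0, +oo[) h s l =
    \int[mu]_(s in `]0, +oo[) (- Num.sqrt pi * ((Num.sqrt s)^-1 * hp2 v b (t + s))).
  apply: eq_Rintegral => s; rewrite inE/= in_itv/= andbT => s0; have [_ e] := inner s s0.
  rewrite /h (e (hp a b (t + s))) (hpa _ (ltW s0)).
  by move: (hp2 v b (t + s)) => z; rewrite mulrN mulNr mulrA.
rewrite (RintegralcM (- Num.sqrt pi) m0 ik) /hA.
move: (\int[mu]_(s in _) _) => z; rewrite mulNr mulrN; congr (- _); rewrite mulrA; congr (_ * z).
exact: divr_sqrt (pi_gt0 R).
Qed.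

Lemma hA_sub X u v b t : Xmem X u -> Xmem X v -> 0 < t ->
  hA (u \- v) b t = hA u b t - hA v b t.
Proof.
move=> uX vX t0; rewrite /hA opprK addrC -opprB -mulrBr.
have [iu _] := Ahalf_kernel_intble b uX t0; have [iv _] := Ahalf_kernel_intble b vX t0.
rewrite -RintegralB//; congr (- (_ * _)); apply: eq_Rintegral => s; rewrite inE/= in_itv/= andbT => s0.
by rewrite (@hp2_sub X)//; [ring|lra].
Qed.

Lemma hA_le X u b t : Xmem X u -> 0 < t ->
  `|hA u b t| <= (Num.sqrt pi)^-1 * (4 * amp t * (pi / Num.sqrt t)) * nrm X u.
Proof.
move=> uX t0; have [_ le] := Ahalf_kernel_intble b uX t0.
by rewrite /hA normrN normrM ger0_norm ?invr_ge0 ?sqrtr_ge0// -mulrA ler_wpM2l.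
Qed.

(** Both sides are continuous in the norm of X, so the identity passes to the closure of the
    graph. *)
Lemma Ahalf_hp X v w b t : is_Ahalf X v w -> 0 < t -> hp w b t = hA v b t.
Proof.
move=> [vX wX [v_ [w_ [HB cv cw]]]] t0.
have vnX n : Xmem X (v_ n) by have [a [r [I [[? _ _] _ _ _ _]]]] := HB n.
have wnX n : Xmem X (w_ n) by have [a [r [I [_ _ _ ? _]]]] := HB n.
have c1 := @hp_cvg X w_ w b t t0 wnX wX cw.
have c2 : hA (v_ n) b t @[n --> \oo] --> hA v b t.
  apply/subr_cvg0; apply: norm_cvg0.
  set C := (Num.sqrt pi)^-1 * (4 * amp t * (pi / Num.sqrt t)).
  apply: (@squeeze_cvgr _ _ _ _ (fun=> 0) (fun n => C * nrm X (v_ n \- v))).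
  - near=> n; rewrite normr_ge0/= -(@hA_sub X)//; apply: hA_le => //; exact: Xmem_sub.
  - exact: cvg_cst.
  - by rewrite -[X in _ --> X](mulr0 C); apply: cvgMr; exact: Xcvg_nrm.
rewrite (_ : (fun n => hA (v_ n) b t) = (fun n => hp (w_ n) b t)) in c2.
  exact: (cvg_unique (@Rhausdorff R) c1 c2).
by apply/funext => n; rewrite (Balakrishnan_hp b (HB n)).
Unshelve. all: by end_near. Qed.

End heat_pairing.

(** * Heat kernels belong to the domain of the square root of A *)

Section Bochner_riemann.
Context {R : realType}.
Notation mu := (@lebesgue_measure R).

Lemma cvge0_le (u : nat -> \bar R) (c : nat -> R) : (forall n, 0 <= u n)%E ->
  (forall n, u n <= (c n)%:E)%E -> c n @[n --> \oo] --> 0 -> u n @[n --> \oo] --> 0%E.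
Proof.
move=> u0 uc c0; apply: (@squeeze_cvge _ _ _ _ (fun=> 0%E) _ (fun n => (c n)%:E)).
- by near=> n; rewrite u0 uc.
- exact: cvg_cst.
- by apply: cvg_EFin c0; near=> n.
Unshelve. all: by end_near. Qed.

Lemma intbleB (D : set R) (f g : R -> R) : measurable D ->
  mu.-integrable D (EFin \o f) -> mu.-integrable D (EFin \o g) ->
  mu.-integrable D (EFin \o (fun x => f x - g x)).
Proof.
move=> mD i j; have := intbleD mD i (intbleZ (- 1) mD j).
by under eq_fun do rewrite mulN1r.
Qed.

(** The first (n+1)^2 cells partition ]0, n+1], so the mesh shrinks while the range exhausts the
    half-line. Sampling at right ends avoids the singular point 0. *)
Definition cell (n i : nat) : set R := `]i%:R / n.+1%:R, i.+1%:R / n.+1%:R].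

Lemma cell_sum (n : nat) (l : R) : 0 < l ->
  (exists i, [/\ (i < n.+1 * n.+1)%N, l <= i.+1%:R / n.+1%:R,
     i.+1%:R / n.+1%:R <= l + n.+1%:R^-1 & forall g : nat -> R,
     \sum_(j < n.+1 * n.+1) \1_(cell n j) l * g j = g i]) \/
  (n.+1%:R <= l /\ forall g : nat -> R,
     \sum_(j < n.+1 * n.+1) \1_(cell n j) l * g j = 0).
Proof.
move=> l0; have N0 : 0 < n.+1%:R :> R by rewrite ltr0n.
(* The least such [m], positive because [l > 0], is one more than the index of the cell containing
   [l]. *)
have ex : exists m : nat, l * n.+1%:R <= m%:R.
  exists (Num.bound (l * n.+1%:R)); apply/ltW; apply: archi_boundP.
  by rewrite mulr_ge0 ?ltW.
case: (ex_minnP ex) => m hm mmin.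
case: m hm mmin => [|i] hm mmin; first by move: hm; rewrite pmulr_lle0// leNgt l0.
have il : i%:R / n.+1%:R < l.
  rewrite ltr_pdivrMr// ltNge; apply/negP => /mmin; by rewrite ltnn.
have li : l <= i.+1%:R / n.+1%:R by rewrite ler_pdivlMr.
have out j : (i.+1 <= j)%N -> \1_(cell n j) l = 0 :> R.
  move=> ij; rewrite indicE memNset// /cell /= in_itv/= => /andP[jl _].
  move: jl; apply/negP; rewrite -leNgt; apply: le_trans li _.
  by rewrite ler_wpM2r ?invr_ge0 ?ler_nat.
have out' j : (j < i)%N -> \1_(cell n j) l = 0 :> R.
  move=> ij; rewrite indicE memNset// /cell /= in_itv/= => /andP[_ lj].
  move: lj; apply/negP; rewrite -ltNge; apply: le_lt_trans il.
  by rewrite ler_wpM2r ?invr_ge0 ?ler_nat.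
case: (ltnP i (n.+1 * n.+1)) => iN.
  left; exists i; split => //.
    by rewrite -[i.+1]addn1 natrD mulrDl mul1r lerD2r ltW.
  move=> g; rewrite (bigD1 (Ordinal iN))//= big1 ?addr0.
    by rewrite indicE mem_set ?mul1r// /cell /= in_itv/= il.
  move=> j ji; have [ij|ij|ij] := ltngtP j i.
  - by rewrite out' ?mul0r.
  - by rewrite out ?mul0r.
  - by move: ji; rewrite -val_eqE/= ij eqxx.
right; split.
  apply/ltW; apply: le_lt_trans il; rewrite ler_pdivlMr// -natrM ler_nat//.
move=> g; rewrite big1// => j _; rewrite out' ?mul0r//.
exact: leq_trans (ltn_ord j) iN.
Qed.

(* Riemann sums converge because the increments of f are dominated by those of
   the decreasing integrable function D. *)
Lemma Bochner_riemann (X : Xspace R) (f : R -> R -> R) (D : R -> R) :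
  (forall l, 0 < l -> continuous (f l)) ->
  (forall l l' x, 0 < l -> l <= l' -> `|f l x - f l' x| <= (D l - D l') * env x) ->
  (forall l x, 0 < l -> `|f l x| <= D l * env x) ->
  (forall l, 0 < l -> {for l, continuous D}) ->
  mu.-integrable `]0, +oo[ (EFin \o D) ->
  is_Bochner X `]0, +oo[ f (fun x => \int[mu]_(l in `]0, +oo[) f l x).
Proof.
move=> cf fD f0 cD iD.
pose m0 : measurable (`]0, +oo[%classic : set R) := measurable_itv _.
have in0 (l : R) : (`]0, +oo[%classic : set R) l -> 0 < l by rewrite /= in_itv/= andbT.
have fX l : 0 < l -> Xmem X (f l).
  by move=> l0; apply: (@Xmem_le_env _ X (f l) (D l)) => [|x]; [exact: cf|exact: f0].
have env1 (x : R) : env x <= 1 by rewrite /env invf_le1 ?lerDl// ltr_wpDr.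
have D0 l : 0 < l -> 0 <= D l.
  move=> l0; have := f0 l 0 l0; rewrite -(pmulr_lge0 _ (env_gt0 0)) mulrC.
  exact: le_trans.
have cfl x l : 0 < l -> {for l, continuous (f ^~ x)}.
  move=> l0; apply/cvgrPdist_le => e e0.
  have /cvgrPdist_le/(_ e e0) := cD l l0; apply: filterS2 (lt_nbhsr l0) => l' l'0 De.
  apply: (@le_trans _ _ (`|D l - D l'| * env x)); last first.
    by rewrite (le_trans _ De)// ler_piMr.
  have [ll'|/ltW ll'] := leP l l'.
    by apply: le_trans (fD _ _ x l0 ll') _; rewrite ler_wpM2r ?ler_norm// ltW ?env_gt0.
  rewrite distrC (distrC (D l)); apply: le_trans (fD _ _ x l'0 ll') _.
  by rewrite ler_wpM2r ?ler_norm// ltW ?env_gt0.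
have mfl x : measurable_fun (`]0, +oo[ : set R) (f ^~ x).
  by apply: open_continuous_measurable_fun => // l; rewrite inE => /in0; exact: cfl.
have ifl x : mu.-integrable `]0, +oo[ (EFin \o (f ^~ x)).
  apply: le_intble (iD) _ => // l /in0 l0; apply: le_trans (f0 l x l0) _.
  by rewrite ler_piMr ?D0.
pose I x := \int[mu]_(l in `]0, +oo[) f l x.
have cI : continuous I.
  move=> x; have := @continuity_under_integral R _ _ mu (fun x l => f l x) `]0, +oo[ m0
    (x - 1) (x + 1) _ _ D iD _ x.
  apply.
  - by move=> y _; exact: ifl.
  - by apply: aeW => l /in0 l0 y _; exact: cf.
  - move=> y _; apply: aeW => l /in0 l0; apply: le_trans (f0 l y l0) _.
    by rewrite ler_piMr ?D0.
  - by rewrite inE/= in_itv/=; lra.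
have IX : Xmem X I.
  apply: (@Xmem_le_env _ X I (\int[mu]_(l in `]0, +oo[) D l)) => // x.
  have iDe : mu.-integrable `]0, +oo[ (EFin \o (fun l => env x * D l)) by exact: intbleZ.
  apply: (@le_trans _ _ (\int[mu]_(l in `]0, +oo[) (env x * D l))).
    apply: (Rintegral_le_norm m0 (mfl x) iDe) => l /in0 l0.
    by rewrite mulrC; exact: f0.
  by rewrite (RintegralcM _ m0 iD) mulrC.
pose p n i : R := i.+1%:R / n.+1%:R.
have p0 n i : 0 < p n i by rewrite divr_gt0 ?ltr0n.
pose K n := (n.+1 * n.+1)%N.
pose s n l x := \sum_(i < K n) \1_(cell n i) l * f (p n i) x.
pose DN n l := \sum_(i < K n) \1_(cell n i) l * D (p n i).
(* Right-end sampling keeps the step function [DN] below the decreasing [D]. The scalar error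
   [D - DN] thus lies between 0 and [D], tends to 0 pointwise, and by dominated convergence controls
   all the norms required. *)
have key n l x : 0 < l -> `|f l x - s n l x| <= (D l - DN n l) * env x.
  move=> l0; have [[i [_ li _ E]]|[_ E]] := cell_sum n l0.
    by rewrite /s /DN (E (fun i => f (p n i) x)) (E (fun i => D (p n i))); exact: fD.
  by rewrite /s /DN (E (fun i => f (p n i) x)) (E (fun i => D (p n i))) !subr0; exact: f0.
have DN0 n l : 0 <= DN n l.
  apply: sumr_ge0 => i _; rewrite mulr_ge0 ?D0//; by rewrite indicE ler0n.
have DDN n l : 0 < l -> 0 <= D l - DN n l.
  move=> l0; rewrite -(pmulr_lge0 _ (env_gt0 0)).
  exact: le_trans (normr_ge0 _) (key n l 0 l0).
have DNcvg l : 0 < l -> D l - DN n l @[n --> \oo] --> 0.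
  move=> l0; apply/cvgr0Pnorm_le => e e0.
  have /cvgrPdist_le/(_ e e0)/nbhs_ballP[d /= d0 dD] := cD l l0.
  have c1 : n.+1%:R^-1 @[n --> \oo] --> (0 : R) by exact: cvg_harmonic.
  have c3 : \forall n \near \oo, n.+1%:R^-1 < d by exact: (cvgr_lt _ c1 _ d0).
  have c2 : \forall n \near \oo, l < n.+1%:R.
    have [N lN] : exists N : nat, l < N%:R.
      by exists (Num.bound l); apply: archi_boundP; exact: ltW.
    by exists N => // n /= Nn; apply: lt_le_trans lN _; rewrite ler_nat leqW.
  apply: filterS2 c2 c3 => n ln nd.
  have [[i [_ li il E]]|[nl _]] := cell_sum n l0; last by move: nl; rewrite leNgt ln.
  rewrite /DN (E (fun i => D (p n i))); apply: dD => /=; rewrite /ball/= ler0_norm ?opprB; last by rewrite subr_le0.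
  by apply: le_lt_trans nd; rewrite lerBlDl.
have cellP n i : [/\ measurable (cell n i), cell n i `<=` `]0, +oo[ & (mu (cell n i) < +oo)%E].
  split; first exact: measurable_itv.
    move=> l; rewrite /cell /= !in_itv/= andbT => /andP[il _]; apply: le_lt_trans il.
    by rewrite divr_ge0.
  by rewrite /cell lebesgue_measure_itv; case: ifP => _; rewrite ?ltry// -EFinB ltry.
have iDN n := (@simple_intble R _ (K n) (cell n) (fun i => D (p n i)) m0
  (fun i _ => cellP n i)).1.
have iDDN n : mu.-integrable `]0, +oo[ (EFin \o (fun l => D l - DN n l)).
  apply: le_intble (iD) _ => //.
    by apply: measurable_funB; [exact: intble_meas iD|exact: intble_meas (iDN n)].
  by move=> l /in0 l0; rewrite ger0_norm ?DDN// lerBlDr lerDl.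
pose T n := \int[mu]_(l in `]0, +oo[) (D l - DN n l).
have T0 : T n @[n --> \oo] --> 0.
  have -> : 0 = \int[mu]_(l in `]0, +oo[) 0 :> R by rewrite /Rintegral integral0.
  apply: (@Rintegral_dct R `]0, +oo[ (fun n l => D l - DN n l) (fun=> 0) D) => //.
  - by move=> n; exact: intble_meas (iDDN n).
  - by move=> l /in0; exact: DNcvg.
  - by move=> n l /in0 l0; rewrite ger0_norm ?DDN// lerBlDr lerDl.
have sX n l : Xmem X (s n l).
  apply: (@Xmem_sum _ X (K n) (fun i => \1_(cell n i) l) (fun i => f (p n i))) => i _; exact: fX.
have fsX n l : 0 < l -> Xmem X (f l \- s n l) by move=> l0; apply: Xmem_sub => //; exact: fX.
have nrm_fs n l : 0 < l ->
    (Xnorm X (f l \- s n l)%R <= ((D l - DN n l) * nrm X env)%:E)%E.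
  move=> l0; rewrite EFinM -(nrmE (Xmem_env X)); apply: Xnorm_bigger_env.
  - exact: Xmem_meas (fsX n l l0).
  - exact: Xmem_env.
  - by move=> x; exact: key.
  - exact: DDN.
split; first by move=> l /in0; exact: fX.
split; first exact: IX.
exists K, cell, (fun n i => f (p n i)); split.
- by move=> n i _; have [h1 h2 h3] := cellP n i; split => //; exact: fX.
- apply: aeW => l /in0 l0; apply: (@cvge0_le _ (fun n => (D l - DN n l) * nrm X env)).
  + by move=> n; exact: Xnorm_ge0.
  + move=> n; rewrite EFinM -(nrmE (Xmem_env X)); apply: Xnorm_bigger_env.
    * by apply: Xmem_meas (Xmem_sub (sX n l) (fX l l0)).
    * exact: Xmem_env.
    * by move=> x; rewrite distrC; exact: key.
    * exact: DDN.
  + by rewrite -[X in _ --> X](mul0r (nrm X env)); apply: cvgMl; exact: DNcvg.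
- apply: (@cvge0_le _ (fun n => nrm X env * T n)).
  + by move=> n; apply: integral_ge0 => l _; exact: Xnorm_ge0.
  + move=> n.
    have i1 : mu.-integrable `]0, +oo[ (EFin \o (fun l => nrm X env * (D l - DN n l))).
      exact: intbleZ.
    rewrite /T -(RintegralcM _ m0 (iDDN n)) /Rintegral fineK; last exact: integrable_fin_num.
    apply: ge0_le_integral_nomeas => //; first by move=> l _; exact: Xnorm_ge0.
    by move=> l /in0 l0; rewrite mulrC; exact: nrm_fs.
  + by rewrite -[X in _ --> X](mulr0 (nrm X env)); apply: cvgMr.
- apply: (@cvge0_le _ (fun n => T n * nrm X env)).
  + by move=> n; exact: Xnorm_ge0.
  + move=> n; rewrite EFinM -(nrmE (Xmem_env X)).
    have InX : Xmem X (fun x => \sum_(i < K n) fine (mu (cell n i)) * f (p n i) x).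
      apply: (@Xmem_sum _ X (K n) (fun i => fine (mu (cell n i))) (fun i => f (p n i))) => i _; exact: fX.
    apply: Xnorm_bigger_env.
    * by apply: Xmem_meas (Xmem_sub InX IX).
    * exact: Xmem_env.
    * move=> x /=; have [is_ es] := @simple_intble R _ (K n) (cell n) (fun i => f (p n i) x) m0
        (fun i _ => cellP n i).
      rewrite -es distrC /I -RintegralB//.
      have iT : mu.-integrable `]0, +oo[ (EFin \o (fun l => env x * (D l - DN n l))).
        exact: intbleZ.
      apply: (@le_trans _ _ (\int[mu]_(l in `]0, +oo[) (env x * (D l - DN n l)))).
        apply: (Rintegral_le_norm m0 _ iT) => [|l /in0 l0].
          by apply: measurable_funB => //; exact: intble_meas is_.
        by rewrite mulrC; exact: key.
      by rewrite (RintegralcM _ m0 (iDDN n)) mulrC.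
    * by apply: Rintegral_ge0 => l /in0; exact: DDN.
  + by rewrite -[X in _ --> X](mul0r (nrm X env)); apply: cvgMl.
Qed.

End Bochner_riemann.

(** * Explicit resolvents and the Balakrishnan integral of a heat kernel *)

Section heat_domain.
Context {R : realType}.
Notation mu := (@lebesgue_measure R).
Implicit Types (X : Xspace R) (e l s t x : R) (phi psi : R -> R).

Lemma XforallT X (P : R -> Prop) : (forall x, P x) -> Xforall X P.
Proof. by case: X => [p p1|] PT //=; exact: aeW. Qed.

Lemma test_Xmem phi : test_function phi -> Xmem C0 phi.
Proof.
move=> tphi; have [_ [M pM]] := tphi; split; first exact: test_continuous.
- apply: cvg_near_cst; near=> x; apply: pM; apply: lt_le_trans (ler_norm _).
  by near: x; apply: nbhs_pinfty_gt; exact: num_real.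
- apply: cvg_near_cst; near=> x; apply: pM; rewrite -normrN.
  apply: lt_le_trans (ler_norm _); rewrite ltrNr.
  by near: x; apply: nbhs_ninfty_lt; exact: num_real.
Unshelve. all: by end_near. Qed.

(** Both integrations by parts are done at once: [K * phi'' - K2 * phi] is the derivative of
    [K * phi' - K1 * phi], which has compact support. *)
Lemma parts_test (K K1 K2 : R -> R) (C : R) phi : test_function phi ->
  (forall x, is_derive x 1 K (K1 x)) -> (forall x, is_derive x 1 K1 (K2 x)) ->
  continuous K2 -> (forall x, `|K x| <= C) -> (forall x, `|K2 x| <= C) ->
  \int[mu]_x (K x * derive1n 2 phi x) = \int[mu]_x (K2 x * phi x).
Proof.
move=> tphi dK dK1 cK2 bK bK2.
have t1 := test_derive tphi; have t2 := test_derive t1.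
have -> : derive1n 2 phi = derive1 (derive1 phi) by rewrite derive1nS derive1n1.
have bdd (K' psi : R -> R) : continuous K' -> (forall x, `|K' x| <= C) -> test_function psi ->
    mu.-integrable setT (EFin \o (fun x => K' x * psi x)).
  move=> cK' bK' tpsi.
  have i1 : mu.-integrable setT (EFin \o (fun x => C * `|psi x|)).
    by apply: intbleZ => //; exact: integrable_norm (test_integrable tpsi).
  apply: le_intble i1 _ => //; last by move=> x _; rewrite normrM ler_wpM2r.
  apply: continuous_measurable_fun => x; apply: cvgM; first exact: cK'.
  exact: test_continuous.
have cK : continuous K by move=> x; exact: isD_continuous (dK x).
have i1 := bdd K _ cK bK t2; have i2 := bdd K2 _ cK2 bK2 tphi.
have [M pM] := tphi.2; have [M' pM'] := t1.2.
pose F x := K x * derive1 phi x - K1 x * phi x.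
have F0 x : `|M| + `|M'| < `|x| -> F x = 0.
  move=> Mx; rewrite /F pM ?pM' ?mulr0 ?subr0//.
    by apply: le_lt_trans Mx; apply: le_trans (ler_norm _) _; rewrite lerDr.
  by apply: le_lt_trans Mx; apply: le_trans (ler_norm _) _; rewrite lerDl.
have dF x : is_derive x 1 F (K x * derive1 (derive1 phi) x - K2 x * phi x).
  have d := isD_add (isD_mul (dK x) (test_is_derive x t1))
    (isD_opp (isD_mul (dK1 x) (test_is_derive x tphi))).
  by apply: is_derive_eq d _; ring.
suff : \int[mu]_x (K x * derive1 (derive1 phi) x - K2 x * phi x) = 0 - 0.
  by rewrite subr0 RintegralB// => /eqP; rewrite subr_eq0 => /eqP.
apply: (@ftc_T R (fun x => K x * derive1 (derive1 phi) x - K2 x * phi x) F 0 0 dF _ _ _ _).2.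
- move=> x; apply: cvgB; apply: cvgM; [exact: cK|exact: test_continuous|exact: cK2|exact: test_continuous].
- apply: cvg_near_cst; near=> x; apply: F0; rewrite -(normrN x).
  apply: lt_le_trans (ler_norm _); rewrite ltrNr.
  by near: x; apply: nbhs_ninfty_lt; exact: num_real.
- apply: cvg_near_cst; near=> x; apply: F0; apply: lt_le_trans (ler_norm _).
  by near: x; apply: nbhs_pinfty_gt; exact: num_real.
- by right; exact: intbleB.
Unshelve. all: by end_near. Qed.

Lemma continuous_hk2 t : 0 < t -> continuous (hk2 t).
Proof.
move=> t0 x; have t1 : 0 < 4 * pi * t by rewrite !mulr_gt0 ?pi_gt0.
by rewrite /hk2 /hk; isDcont.
Qed.

Lemma continuous_hk2_time e s x : 0 < e -> 0 <= s ->
  {for s, continuous (fun s => hk2 (e + s) x)}.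
Proof.
move=> e0 s0; have t0 : 0 < e + s by lra.
have t1 : 0 < 4 * pi * (e + s) by rewrite !mulr_gt0 ?pi_gt0.
rewrite /hk2 /hk; isDcont; by rewrite ?mulf_neq0 ?sqrf_eq0 ?gt_eqF ?sqrtr_gt0.
Qed.

Lemma hk2_env e s x : 0 < e -> 0 <= s ->
  `|hk2 (e + s) x| <= 4 * amp (2 * e) / (e + s) * env x.
Proof.
move=> e0 s0; have t0 : 0 < e + s by lra.
apply: le_trans (hk2_le x t0) _.
rewrite [4 * amp _ / _]mulrAC -[leRHS]mulrA ler_wpM2l ?divr_ge0 ?(ltW t0)//.
by apply: hk_le_inv; lra.
Qed.

Lemma hk_bounds t x : 0 < t -> `|hk t x| <= amp t * env x.
Proof. by move=> t0; rewrite ger0_norm ?hk_ge0//; exact: hk_le_inv. Qed.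

Lemma hk_is_A X e : 0 < e -> is_A X (hk e) (fun x => - hk2 e x).
Proof.
move=> e0; have b2 x : `|hk2 e x| <= 4 * amp (2 * e) / e * env x.
  by have := hk2_env x e0 (lexx 0); rewrite addr0.
split.
- apply: (@Xmem_le_env _ X _ (amp e)) => [|x]; first exact: continuous_hk.
  exact: hk_bounds.
- apply: (@Xmem_le_env _ X _ (4 * amp (2 * e) / e)) => [x|x].
    by apply: cvgN; exact: continuous_hk2.
  by rewrite normrN.
move=> phi tphi.
have env1 x : env x <= 1 by rewrite /env invf_le1 ?lerDl// ltr_wpDr.
have A0 := amp_gt0 e; have A20 := amp_gt0 (2 * e).
have c0 : 0 <= 4 * amp (2 * e) / e by rewrite divr_ge0 ?mulr_ge0 ?ltW.
transitivity (\int[mu]_x (hk2 e x * phi x)); last first.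
  transitivity (- - \int[mu]_x (hk2 e x * phi x)); first by rewrite opprK.
  congr (- _); rewrite -mulN1r -RintegralcM//.
    by apply: eq_Rintegral => x _; rewrite mulN1r mulNr.
  have i1 : mu.-integrable setT (EFin \o (fun x => (4 * amp (2 * e) / e) * `|phi x|)).
    by apply: intbleZ => //; exact: integrable_norm (test_integrable tphi).
  apply: le_intble i1 _ => //.
    apply: continuous_measurable_fun => x; apply: cvgM; first exact: continuous_hk2.
    exact: test_continuous.
  move=> x _; rewrite normrM ler_wpM2r//; apply: le_trans (b2 x) _.
  by rewrite ler_piMr.
apply: (@parts_test (hk e) (fun x => - (x / (2 * e)) * hk e x) (hk2 e)
  (amp e + 4 * amp (2 * e) / e)) => //.
- by move=> x; exact: is_derive_hk.
- by move=> x; exact: is_derive_hk1.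
- exact: continuous_hk2.
- move=> x; apply: le_trans (hk_bounds x e0) _.
  by rewrite -[leLHS]addr0 lerD// ler_piMr// ltW.
- move=> x; apply: le_trans (b2 x) _.
  by rewrite -[leLHS]add0r lerD ?ler_piMr// ltW.
Qed.

(* (l + A)^-1 applied to A (hk e) = - hk2 e. *)
Definition res e l x : R := \int[mu]_(s in `]0, +oo[) (expR (- (l * s)) * - hk2 (e + s) x).

Let in0 (s : R) : (`]0, +oo[%classic : set R) s -> 0 < s.
Proof. by rewrite /= in_itv/= andbT. Qed.

Let env1 (x : R) : env x <= 1.
Proof. by rewrite /env invf_le1 ?lerDl// ltr_wpDr. Qed.

(** The factor in front of [env] in [hk2_env]: it carries all the dependence on the heat time s. *)
Definition dec e (s : R) : R := 4 * amp (2 * e) / (e + s).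

Lemma dec_ge0 e s : 0 < e -> 0 <= s -> 0 <= dec e s.
Proof. by move=> e0 s0; rewrite divr_ge0 ?mulr_ge0 ?(ltW (amp_gt0 _))//; lra. Qed.

Lemma dec_le e s : 0 < e -> 0 <= s -> dec e s <= dec e 0.
Proof.
move=> e0 s0; rewrite ler_wpM2l ?mulr_ge0 ?(ltW (amp_gt0 _))// addr0.
by rewrite lef_pV2 ?posrE//; lra.
Qed.

Lemma continuous_dec e s : 0 < e -> 0 <= s -> {for s, continuous (dec e)}.
Proof. by move=> e0 s0; rewrite /dec; isDcont; rewrite gt_eqF//; lra. Qed.

Lemma measurable_hk2_time e x : 0 < e ->
  measurable_fun (`]0, +oo[ : set R) (fun s => hk2 (e + s) x).
Proof.
move=> e0; apply: open_continuous_measurable_fun => // s; rewrite inE => /in0 s0.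
by apply: continuous_hk2_time => //; exact: ltW.
Qed.

Lemma measurable_dec e : 0 < e -> measurable_fun (`]0, +oo[ : set R) (dec e).
Proof.
move=> e0; apply: open_continuous_measurable_fun => // s; rewrite inE => /in0 s0.
by apply: continuous_dec => //; exact: ltW.
Qed.

Lemma measurable_expRN l (D : set R) : measurable_fun D (fun s => expR (- (l * s))).
Proof.
apply: measurable_funTS; apply: continuous_measurable_fun => s; isDcont.
Qed.

Lemma intble_exp_bdd l (g : R -> R) (C : R) : 0 < l ->
  measurable_fun (`]0, +oo[ : set R) g -> (forall s, 0 < s -> `|g s| <= C) ->
  mu.-integrable `]0, +oo[ (EFin \o (fun s => expR (- (l * s)) * g s)).
Proof.
move=> l0 mg gC; have i1 : mu.-integrable `]0, +oo[ (EFin \o (fun s => C * expR (- (l * s)))).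
  by apply: intbleZ => //; exact: integrable_expRN.
apply: le_intble (i1) _ => //.
  by apply: measurable_funM => //; exact: measurable_expRN.
move=> s /in0 s0; rewrite normrM (ger0_norm (expR_ge0 _)) mulrC.
by rewrite ler_wpM2r ?expR_ge0 ?gC.
Qed.

Lemma intble_exp_dec e l : 0 < e -> 0 < l ->
  mu.-integrable `]0, +oo[ (EFin \o (fun s => expR (- (l * s)) * dec e s)).
Proof.
move=> e0 l0; apply: (@intble_exp_bdd l (dec e) (dec e 0)) => //; first exact: measurable_dec.
by move=> s /ltW s0; rewrite ger0_norm ?dec_ge0 ?dec_le.
Qed.

Lemma hk2_dec e s x : 0 < e -> 0 <= s -> `|- hk2 (e + s) x| <= dec e s.
Proof.
move=> e0 s0; rewrite normrN; apply: le_trans (hk2_env x e0 s0) _.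
by rewrite ler_piMr ?dec_ge0 ?env1.
Qed.

Lemma intble_exp_hk2 e l x : 0 < e -> 0 < l ->
  mu.-integrable `]0, +oo[ (EFin \o (fun s => expR (- (l * s)) * - hk2 (e + s) x)).
Proof.
move=> e0 l0; apply: (@intble_exp_bdd l _ (dec e 0)) => //.
  by apply: measurableT_comp => //; exact: measurable_hk2_time.
by move=> s /ltW s0; apply: le_trans (hk2_dec x e0 s0) _; exact: dec_le.
Qed.

Lemma intble_exp_hp X u b e l : Xmem X u -> 0 < e -> 0 < l ->
  mu.-integrable `]0, +oo[ (EFin \o (fun s => expR (- (l * s)) * hp u b (e + s))).
Proof.
move=> uX e0 l0; apply: (@intble_exp_bdd l _ (amp e * nrm X u)) => //.
  apply: open_continuous_measurable_fun => // s; rewrite inE => /in0 s0.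
  have es : 0 < e + s by lra.
  have d1 : is_derive s 1 (fun s : R => e + s) (0 + 1) by isD.
  exact: isD_continuous (@isD_comp _ (hp u b) (fun s => e + s) s _ _ (is_derive_hp b uX es) d1).
move=> s s0; apply: le_trans (hp_le b uX _) _; first by lra.
by rewrite ler_wpM2r ?nrm_ge0// amp_le//; lra.
Qed.

Lemma intble_exp_hp2 X u b e l : Xmem X u -> 0 < e -> 0 < l ->
  mu.-integrable `]0, +oo[ (EFin \o (fun s => expR (- (l * s)) * hp2 u b (e + s))).
Proof.
move=> uX e0 l0; apply: (@intble_exp_bdd l _ (4 * amp e * nrm X u / e)) => //.
  exact: (measurable_hp2_shift b uX e0).
move=> s s0; apply: le_trans (hp2_le_shift b uX e0 (ltW s0)) _.
rewrite ler_wpM2l ?mulr_ge0 ?nrm_ge0 ?(ltW (amp_gt0 _))//.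
by rewrite lef_pV2 ?posrE//; lra.
Qed.

Lemma res_le e l x : 0 < e -> 0 < l ->
  `|res e l x| <= \int[mu]_(s in `]0, +oo[) (expR (- (l * s)) * dec e s) * env x.
Proof.
move=> e0 l0; have ie := intble_exp_dec e0 l0.
rewrite mulrC -RintegralcM//.
have i1 : mu.-integrable `]0, +oo[ (EFin \o (fun s => env x * (expR (- (l * s)) * dec e s))).
  exact: intbleZ.
apply: (Rintegral_le_norm _ _ i1) => // [|s /in0/ltW s0].
  exact: intble_meas (intble_exp_hk2 x e0 l0).
rewrite normrM normrN ger0_norm ?expR_ge0// mulrCA ler_wpM2l ?expR_ge0// mulrC.
exact: hk2_env.
Qed.

Lemma continuous_res e l : 0 < e -> 0 < l -> continuous (res e l).
Proof.
move=> e0 l0 x; have m0 : measurable (`]0, +oo[%classic : set R) by [].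
have := @continuity_under_integral R _ _ mu (fun x s => expR (- (l * s)) * - hk2 (e + s) x)
  `]0, +oo[ m0 (x - 1) (x + 1) _ _ _ (intble_exp_dec e0 l0) _ x.
apply.
- by move=> y _; exact: intble_exp_hk2.
- apply: aeW => s /in0 s0 y _; apply: cvgMr; apply: cvgN; apply: continuous_hk2; lra.
- move=> y _; apply: aeW => s /in0/ltW s0.
  rewrite normrM normrN ger0_norm ?expR_ge0// ler_wpM2l ?expR_ge0//.
  by apply: le_trans (hk2_env y e0 s0) _; rewrite ler_piMr ?dec_ge0.
- by rewrite inE/= in_itv/=; lra.
Qed.

Lemma res_Xmem X e l : 0 < e -> 0 < l -> Xmem X (res e l).
Proof.
move=> e0 l0; apply: (@Xmem_le_env _ X _ (\int[mu]_(s in `]0, +oo[) (expR (- (l * s)) * dec e s))).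
  exact: continuous_res.
by move=> x; exact: res_le.
Qed.

(** Fubini exchanges the roles of kernel and function: testing [res] against [psi] amounts to
    pairing [psi], as an element of C_0, with heat kernels centred at 0, for which the calculus of
    [hp] is available. *)
Lemma res_pair e l psi : test_function psi -> 0 < e -> 0 < l ->
  mu.-integrable setT (EFin \o (fun x => res e l x * psi x)) /\
  \int[mu]_x (res e l x * psi x) =
  - \int[mu]_(s in `]0, +oo[) (expR (- (l * s)) * hp2 psi 0 (e + s)).
Proof.
move=> tpsi e0 l0; have m0 : measurable (`]0, +oo[%classic : set R) by [].
pose h x s := psi x * (expR (- (l * s)) * - hk2 (e + s) x).
set L := \int[mu]_(s in `]0, +oo[) (expR (- (l * s)) * dec e s).
have cpsi := test_continuous tpsi.
have hE x : \int[mu]_(s in `]0, +oo[) h x s = res e l x * psi x.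
  by rewrite /h (RintegralcM _ m0 (intble_exp_hk2 x e0 l0)) mulrC.
have [|||x _|x _||i1 _ FE] := @Rintegral_Fubini R setT `]0, +oo[ h (fun x => L * `|psi x|).
- by [].
- by [].
- rewrite /h.
  have mA : measurable_fun (setT `*` `]0, +oo[ : set (R * R)) (fun z : R * R => hk2 (e + z.2) z.1).
    have mc := @measurable_fun_cara R setT (fun x s => hk2 (e + s) x) measurableT.
    apply: measurable_funS (mc _ _).
    + exact: measurableX.
    + move=> [x' s'] [_] /=; rewrite !in_itv/= !andbT => /ltW //.
    + by move=> s s0; apply: continuous_measurable_fun; apply: continuous_hk2; lra.
    + by move=> x s _ s0; apply: cvg_within_filter; exact: continuous_hk2_time.
  apply: measurable_funM.
    by apply: (measurable_fst_on measurableT m0); exact: continuous_measurable_fun.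
  apply: measurable_funM; first exact: (@measurable_snd_on R setT `]0, +oo[ (fun s => expR (- (l * s))) measurableT m0 (@measurable_expRN l _)).
  exact: measurableT_comp.
- by apply: intbleZ => //; exact: intble_exp_hk2.
- have i1 : mu.-integrable `]0, +oo[
      (EFin \o (fun s => `|psi x| * (expR (- (l * s)) * dec e s))).
    by apply: intbleZ => //; exact: intble_exp_dec.
  have mh := intble_meas (intble_exp_hk2 x e0 l0).
  apply: (@le_trans _ _ (\int[mu]_(s in `]0, +oo[) (`|psi x| * (expR (- (l * s)) * dec e s)))).
    apply: le_trans (ler_norm _) _; apply: (Rintegral_le_norm m0 _ i1).
      by apply: measurableT_comp => //; exact: measurable_funM.
    move=> s /in0/ltW s0; rewrite normr_id /h normrM ler_wpM2l//.
    by rewrite normrM (ger0_norm (expR_ge0 _)) ler_wpM2l ?expR_ge0// hk2_dec.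
  by rewrite (RintegralcM _ m0 (intble_exp_dec e0 l0)) mulrC.
- by apply: intbleZ => //; exact: integrable_norm (test_integrable tpsi).
have FE' : \int[mu]_x (res e l x * psi x) = \int[mu]_(s in `]0, +oo[) \int[mu]_x h x s.
  by rewrite -FE; apply: eq_Rintegral => x _; rewrite hE.
split.
  have <- : (fun x => \int[mu]_(s in `]0, +oo[) h x s) = (fun x => res e l x * psi x).
    exact/funext.
  exact: i1.
have pX := test_Xmem tpsi.
rewrite FE' -mulN1r -(RintegralcM _ m0 (intble_exp_hp2 0 pX e0 l0)).
apply: eq_Rintegral => s; rewrite inE => /in0 s0; have es := addr_gt0 e0 s0.
rewrite /hp2 mulN1r -mulNr -(RintegralcM _ measurableT (hp2_intble 0 pX es)).
apply: eq_Rintegral => x _; rewrite /h subr0.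
by move: (hk2 _ _) (expR _) (psi x) => y1 y2 y3; clear; ring.
Qed.

Lemma hp_laplace phi b t : test_function phi -> 0 < t ->
  hp (derive1n 2 phi) b t = hp2 phi b t.
Proof.
move=> tphi t0.
have isub (f : R -> R) (x d : R) : is_derive (x - b) 1 f d ->
    is_derive x 1 (fun y => f (y - b)) d.
  move=> df; have d1 : is_derive x 1 (fun y : R => y - b) 1 by isDeq; ring.
  by apply: is_derive_eq (@isD_comp _ f (fun y : R => y - b) x _ _ df d1) _; ring.
have A0 := amp_gt0 t; have A20 := amp_gt0 (2 * t).
apply: (@parts_test (fun y => hk t (y - b)) (fun y => - ((y - b) / (2 * t)) * hk t (y - b))
  (fun y => hk2 t (y - b)) (amp t + dec t 0)) => //.
- by move=> y; apply: isub; exact: is_derive_hk.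
- by move=> y; exact: (isub (fun y => - (y / (2 * t)) * hk t y)) (is_derive_hk1 _ t0).
- move=> y; apply: (@continuous_comp _ _ _ (fun y => y - b) (hk2 t)); last exact: continuous_hk2.
  by apply: cvgB; [exact: cvg_id|exact: cvg_cst].
- move=> y; apply: le_trans (hk_bounds _ t0) _.
  by rewrite -[leLHS]addr0 lerD ?dec_ge0// ler_piMr// ltW.
- move=> y; have := hk2_dec (y - b) t0 (lexx 0); rewrite addr0 normrN => /le_trans; apply.
  by rewrite lerDr ltW.
Qed.

(** One integration by parts in s of [exp (- l s) * hp (phi'') 0 (e + s)]. The boundary value at 0
    is the test of [hk e] against [phi''], known from [hk_is_A]; the term with factor [l] is the
    test of [res] against [phi], because [hp (phi'') = hp2 phi]. *)
Lemma res_is_A X e l : 0 < e -> 0 < l ->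
  is_A X (res e l) (fun x => - hk2 e x - l * res e l x).
Proof.
move=> e0 l0; have m0 : measurable (`]0, +oo[%classic : set R) by [].
have [_ aX weak] := hk_is_A X e0; have rX := res_Xmem X e0 l0.
split => //; first by apply: (Xmem_sub aX); exact: Xmem_scale.
move=> phi tphi; have t2 : test_function (derive1n 2 phi).
  rewrite (_ : derive1n 2 phi = derive1 (derive1 phi)) ?derive1nS ?derive1n1//.
  by apply: test_derive; exact: test_derive.
have pX := test_Xmem tphi; have p2X := test_Xmem t2.
have [_ e1] := res_pair t2 e0 l0; have [ir e2] := res_pair tphi e0 l0.
have iN := intble_exp_hp 0 p2X e0 l0; have iN2 := intble_exp_hp2 0 p2X e0 l0.
pose N s := hp (derive1n 2 phi) 0 (e + s).
have NE s : 0 <= s -> N s = hp2 phi 0 (e + s).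
  by move=> s0; apply: hp_laplace => //; exact: ltr_wpDr.
pose F s := expR (- (l * s)) * N s.
have dN s : 0 <= s -> is_derive s 1 N (hp2 (derive1n 2 phi) 0 (e + s)).
  move=> s0; have es : 0 < e + s by exact: ltr_wpDr.
  have d1 : is_derive s 1 (fun s : R => e + s) (0 + 1) by isD.
  have := @isD_comp _ (hp (derive1n 2 phi) 0) (fun s => e + s) s _ _ (is_derive_hp 0 p2X es) d1.
  by move/is_derive_eq; apply; ring.
have dF s : 0 <= s -> is_derive s 1 F
   (expR (- (l * s)) * hp2 (derive1n 2 phi) 0 (e + s) - l * (expR (- (l * s)) * N s)).
  by move=> s0; have d := dN s s0; rewrite /F; isDeq; ring.
have FT : \int[mu]_(s in `]0, +oo[) (expR (- (l * s)) * hp2 (derive1n 2 phi) 0 (e + s)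
    - l * (expR (- (l * s)) * N s)) = 0 - F 0.
  apply: (@ftc_oy R (fun s => expR (- (l * s)) * hp2 (derive1n 2 phi) 0 (e + s)
    - l * (expR (- (l * s)) * N s)) F 0 (F 0) 0 _ _ _ _ _).2.
  - by move=> s /ltW; exact: dF.
  - move=> s s0; have dn := dN s (ltW s0).
    have cE : {for s, continuous (fun s => expR (- (l * s)))} by isDcont.
    apply: cvgB; first by apply: cvgM => //; exact: (@continuous_hp2_shift R _ _ 0 _ _ p2X e0 (ltW s0)).
    by apply: cvgMr; apply: cvgM => //; exact: isD_continuous dn.
  - by apply: cvg_at_right_filter; exact: isD_continuous (dF 0 (lexx 0)).
  - apply: norm_cvg0; set C := amp e * nrm C0 (derive1n 2 phi).
    apply: (@squeeze_cvgr _ _ _ _ (fun=> 0) (fun s => expR (- (l * s)) * C)).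
    + near=> s; have s0 : 0 < s by near: s; apply: nbhs_pinfty_gt; exact: num_real.
      rewrite normr_ge0/= /F normrM ger0_norm ?expR_ge0// ler_wpM2l ?expR_ge0//.
      apply: le_trans (hp_le 0 p2X (addr_gt0 e0 s0)) _.
      by rewrite ler_wpM2r ?nrm_ge0// amp_le// lerDl ltW.
    + exact: cvg_cst.
    + rewrite -[X in _ --> X](mul0r C); apply: cvgMl.
      apply: (cvg_comp (fun s => l * s) (fun y => expR (- y)) _ (@cvg_expRN R)).
      by apply: gt0_cvgMry.
  - by right; apply: intbleB => //; exact: intbleZ.
have ilN : mu.-integrable `]0, +oo[ (EFin \o (fun s => l * (expR (- (l * s)) * N s))).
  exact: intbleZ.
rewrite RintegralB// (RintegralcM _ m0 iN) in FT.
have e3 : \int[mu]_(s in `]0, +oo[) (expR (- (l * s)) * N s) = - \int[mu]_x (res e l x * phi x).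
  rewrite e2 opprK; apply: eq_Rintegral => s; rewrite inE => /in0/ltW s0.
  by rewrite NE.
have e4 : F 0 = - \int[mu]_x (- hk2 e x * phi x).
  rewrite -weak// /F mulr0 oppr0 expR0 mul1r /N addr0 /hp.
  by apply: eq_Rintegral => x _; rewrite subr0.
have e5 : \int[mu]_x ((- hk2 e x - l * res e l x) * phi x) =
   \int[mu]_x (- hk2 e x * phi x) - l * \int[mu]_x (res e l x * phi x).
  have i0 : mu.-integrable setT (EFin \o (fun x => - hk2 e x * phi x)).
    have := intbleZ (- 1) measurableT (hp2_intble 0 pX e0).
    by under eq_fun do rewrite subr0 mulN1r -mulNr.
  rewrite -(RintegralcM l measurableT ir) -RintegralB//; last exact: intbleZ.
  by apply: eq_Rintegral => x _; ring.
rewrite e1 e5; rewrite e3 e4 in FT.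
have fin (y1 y2 y3 : R) : y1 - l * - y2 = 0 - - y3 -> - y1 = - (y3 - l * y2).
  by clear; lra.
exact: fin FT.
Unshelve. all: by end_near. Qed.

(** The resolvents of [A (hk e)] are the explicit functions [res e l], and [Bochner_riemann] applies
    with [D], the same Laplace integral with [hk2] replaced by its majorant. The kernel lies in the
    domain before closure, so constant sequences suffice. *)
Lemma Ahalf_hk X e : 0 < e -> exists w, is_Ahalf X (hk e) w.
Proof.
move=> e0; have m0 : measurable (`]0, +oo[%classic : set R) by [].
pose D l := (Num.sqrt l)^-1 * \int[mu]_(s in `]0, +oo[) (expR (- (l * s)) * dec e s).
pose f l x := l `^ (- 2^-1) * res e l x.
have sq0 (l : R) : 0 <= (Num.sqrt l)^-1 by rewrite invr_ge0 sqrtr_ge0.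
have cr : {in `]0, +oo[%classic, continuous (fun l : R => (Num.sqrt l)^-1)}.
  by move=> l; rewrite inE => /in0 l0; isDcont; rewrite ?gt_eqF ?sqrtr_gt0.
have HB : is_Bochner X `]0, +oo[ f (fun x => \int[mu]_(l in `]0, +oo[) f l x).
  apply: (@Bochner_riemann R X f D).
  - by move=> l l0 x; apply: cvgMr; exact: continuous_res.
  - move=> l l' x l0 ll'; have l'0 : 0 < l' by lra.
    rewrite /f /D !powRN_half//.
    rewrite /res -!RintegralcM//; try exact: intble_exp_dec; try exact: intble_exp_hk2.
    rewrite -!RintegralB//; try (by apply: intbleZ => //; exact: intble_exp_dec);
      try (by apply: intbleZ => //; exact: intble_exp_hk2).
    pose g s := (Num.sqrt l)^-1 * (expR (- (l * s)) * dec e s) -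
      (Num.sqrt l')^-1 * (expR (- (l' * s)) * dec e s).
    have ig : mu.-integrable `]0, +oo[ (EFin \o g).
      by apply: intbleB => //; apply: intbleZ => //; exact: intble_exp_dec.
    rewrite mulrC -(RintegralcM (env x) m0 ig).
    have ieg : mu.-integrable `]0, +oo[ (EFin \o (fun s => env x * g s)) by exact: intbleZ.
    apply: (Rintegral_le_norm m0 _ ieg) => [|s /in0/ltW s0].
      apply: (intble_meas (intbleB m0 _ _)) => //.
        by apply: intbleZ => //; exact: intble_exp_hk2.
      by apply: intbleZ => //; exact: intble_exp_hk2.
    rewrite /g ![(Num.sqrt _)^-1 * (_ * _)]mulrA -!mulrBl normrM normrN.
    (* The weight [l^(-1/2) * exp (- l s)] decreases in [l]; hence increments of [f] are dominated
       by increments of [D]. *)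
    have h0 : 0 <= (Num.sqrt l)^-1 * expR (- (l * s)) - (Num.sqrt l')^-1 * expR (- (l' * s)).
      rewrite subr_ge0 ler_pM ?expR_ge0//.
        by rewrite lef_pV2 ?posrE ?sqrtr_gt0// ler_wsqrtr.
      by rewrite ler_expR lerN2 ler_wpM2r.
    rewrite (ger0_norm h0) mulrCA ler_wpM2l// mulrC; exact: hk2_env.
  - move=> l x l0; rewrite /f /D powRN_half// normrM ger0_norm// -mulrA ler_wpM2l//.
    exact: res_le.
  - move=> l l0; apply: cvgM; first by apply: cr; rewrite inE/= in_itv/= andbT.
    have l20 : 0 < l / 2 by lra.
    have := @continuity_under_integral R _ _ mu (fun l s => expR (- (l * s)) * dec e s)
      `]0, +oo[ m0 (l / 2) (2 * l) _ _ _ (intble_exp_dec e0 l20) _ l.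
    apply.
    + move=> l'; rewrite /= in_itv/= => /andP[l'0 _]; apply: intble_exp_dec => //; lra.
    + by apply: aeW => s _ l' _; isDcont.
    + move=> l'; rewrite /= in_itv/= => /andP[l'0 _]; apply: aeW => s /in0/ltW s0.
      rewrite (normrM (expR _) (dec e s)) (ger0_norm (expR_ge0 _)) (ger0_norm (dec_ge0 e0 s0)).
      rewrite ler_wpM2r ?dec_ge0//.
      by rewrite ler_expR lerN2 ler_wpM2r// ltW.
    + by rewrite inE/= in_itv/=; lra.
  (* Integrability of [D] by Fubini: integrating first in [l] leaves [sqrt pi / sqrt s * dec e s], a
     multiple of the weight of [integral_sqrt_cauchy]. *)
  - pose h s l := (Num.sqrt l)^-1 * expR (- (l * s)) * dec e s.
    have [ik _] := integral_sqrt_cauchy e0.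
    have inner s : 0 < s -> mu.-integrable `]0, +oo[ (EFin \o h s) /\
        \int[mu]_(l in `]0, +oo[) h s l = Num.sqrt pi / Num.sqrt s * dec e s.
      move=> s0; have [i E] := integral_laplace_sqrt s0.
      have -> : h s = (fun l => dec e s * ((Num.sqrt l)^-1 * expR (- (l * s)))).
        by apply/funext => l; rewrite mulrC.
      split; first exact: intbleZ.
      by rewrite (RintegralcM _ m0 i) E mulrC.
    have [|||s /in0 s0|s /in0 s0||_ i2 _] := @Rintegral_Fubini R `]0, +oo[ `]0, +oo[ h
      (fun s => Num.sqrt pi * (4 * amp (2 * e)) * (Num.sqrt s * (e + s))^-1).
    + by [].
    + by [].
    + rewrite /h; apply: measurable_funM; last exact: (measurable_fst_on m0 m0 (measurable_dec e0)).
      apply: measurable_funM; first exact: (measurable_snd_on m0 m0 measurable_sqrtV).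
      apply: measurable_funTS; apply: measurableT_comp => //; apply: measurableT_comp => //.
      exact: measurable_funM.
    + by case: (inner s s0).
    + rewrite le_eqVlt; apply/orP; left; apply/eqP.
      transitivity (\int[mu]_(l in `]0, +oo[) h s l).
        apply: eq_Rintegral => l _; apply: ger0_norm.
        apply: mulr_ge0; last exact: dec_ge0 (ltW s0).
        by apply: mulr_ge0; rewrite ?expR_ge0 ?sq0.
      rewrite (inner s s0).2 /dec invfM; move: (Num.sqrt pi) => P; ring.
    + exact: intbleZ.
    apply: eq_integrable i2 => // l; rewrite inE => /in0 l0 /=; congr EFin.
    rewrite /D -(RintegralcM _ m0 (intble_exp_dec e0 l0)).
    by apply: eq_Rintegral => s _; rewrite /h mulrA.
set I := fun x => _ in HB; have [_ [IX _]] := HB.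
have wX : Xmem X (fun x => pi^-1 * I x) by exact: Xmem_scale.
have [vX aX _] := hk_is_A X e0.
exists (fun x => pi^-1 * I x); split => //.
exists (fun=> hk e), (fun=> (fun x => pi^-1 * I x)); split; [move=> _|exact: Xcvg_cst|exact: Xcvg_cst].
exists (fun x => - hk2 e x), (res e), I; split => //.
- exact: hk_is_A.
- move=> l l0; exists (fun x => - hk2 e x - l * res e l x); first exact: res_is_A.
  by apply: XforallT => x; ring.
- by apply: XforallT.
Qed.

End heat_domain.

(** * Translations and reflections of the line *)

Section affine_invariance.
Context {R : realType}.
Notation mu := (@lebesgue_measure R).

(** By uniqueness of Lebesgue measure it is enough to compare on intervals []a, b]]; a reflection
    exchanges the open and the closed end without changing the length. *)
Lemma lebesgue_measure_affine (c d : R) : d = 1 \/ d = -1 -> forall A, measurable A ->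
  mu A = mu ((fun x => c + d * x) @^-1` A).
Proof.
move=> d1; have mphi : @measurable_fun _ _ (measurableTypeR R) (measurableTypeR R) setT (fun x : R => c + d * x).
  apply: (@continuous_measurable_fun R) => x; apply: cvgD; first exact: cvg_cst.
  by apply: cvgMr; exact: cvg_id.
pose phi : {mfun measurableTypeR R >-> measurableTypeR R} :=
  @mfun_Sub _ _ (measurableTypeR R) (measurableTypeR R) (fun x : R => c + d * x) (mem_set mphi).
apply: (@lebesgue_measure_unique R (pushforward mu phi)).
move=> _ [[a b] _ <-] /=.
rewrite /pushforward.
rewrite lebesgue_measure_itv /=.
case: d1 => ->.
  have -> : (fun x : R => c + 1 * x) @^-1` `]a, b] = `](a - c), (b - c)]%classic.
    by apply/seteqP; split => x /=; rewrite !in_itv/= mul1r; lra.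
  rewrite lebesgue_measure_itv /= !lte_fin ltrD2r.
  by case: ifP => // _; rewrite -!EFinB; congr EFin; lra.
have -> : (fun x : R => c + -1 * x) @^-1` `]a, b] = `[(c - b), (c - a)[%classic.
  by apply/seteqP; split => x /=; rewrite !in_itv/= mulN1r; lra.
rewrite lebesgue_measure_itv /= !lte_fin ltrD2l ltrN2.
by case: ifP => // _; rewrite -!EFinB; congr EFin; lra.
Qed.

Lemma Rintegral_affine (c d : R) (E : set R) (g : R -> R) : d = 1 \/ d = -1 ->
  measurable E -> mu.-integrable E (EFin \o g) ->
  let D := (fun x => c + d * x) @^-1` E in
  mu.-integrable D (EFin \o (fun x => g (c + d * x))) /\
  \int[mu]_(x in D) g (c + d * x) = \int[mu]_(x in E) g x.
Proof.
move=> d1 mE ig D; pose phi (y : R) := d * (y - c).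
have phiK y : c + d * phi y = y by rewrite /phi mulrA; case: d1 => ->; lra.
have Kphi y : phi (c + d * y) = y by rewrite /phi addrC addKr mulrA; case: d1 => ->; lra.
have mphi : measurable_fun setT phi.
  apply: continuous_measurable_fun => x; apply: cvgMr.
  by apply: cvgB; [exact: cvg_id|exact: cvg_cst].
have mpsi : measurable_fun setT (fun x => c + d * x).
  apply: continuous_measurable_fun => x; apply: cvgD; first exact: cvg_cst.
  by apply: cvgMr; exact: cvg_id.
have mD : measurable D by rewrite -[D]setTI; exact: mpsi.
pose f := EFin \o (fun x => (g \_ E) (c + d * x)).
have mg : measurable_fun setT (g \_ E).
  by apply/(measurable_restrictT _ mE); exact: intble_meas ig.
have mf : measurable_fun setT f.
  by apply/measurable_EFinP; exact: measurableT_comp mg mpsi.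
have phiD : phi @^-1` D = E.
  by apply/seteqP; split => x; rewrite /D /preimage /= phiK.
have fphi : f \o phi = EFin \o (g \_ E) by apply/funext => x; rewrite /f /= phiK.
have ifp : mu.-integrable (phi @^-1` D) (f \o phi).
  rewrite phiD fphi; apply: eq_integrable ig => // x xE /=.
  by rewrite patchE xE.
have fD x : x \in D -> f x = (g (c + d * x))%:E.
  by move=> /set_mem Dx; rewrite /f /= patchE mem_set.
have d1' : d = 1 \/ d = -1 by [].
have pE A : measurable A -> pushforward mu phi A = mu A.
  move=> mA; rewrite /pushforward; have := @lebesgue_measure_affine (- (d * c)) d d1 A mA.
  move=> ->; congr (mu _); apply/seteqP; split => x /=; rewrite /phi mulrBr addrC //.
pose phim : {mfun measurableTypeR R >-> measurableTypeR R} :=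
  @mfun_Sub _ _ (measurableTypeR R) (measurableTypeR R) phi (mem_set mphi).
have eI (k : R -> \bar R) : (\int[mu]_(x in D) k x = \int[pushforward mu phim]_(x in D) k x)%E.
  apply: (@eq_measure_integral _ (measurableTypeR R) R D (pushforward mu phim) mu k).
  by move=> A mA _; exact: esym (pE A mA).
have i1 := @integrable_pushforward _ _ (measurableTypeR R) (measurableTypeR R) R phi mphi mu D f mf ifp mD.
have I1 := @integral_pushforward _ _ (measurableTypeR R) (measurableTypeR R) R phi mphi mu D f mf ifp mD.
split.
  have i2 : mu.-integrable D f.
    move/integrableP : i1 => [_ i1]; apply/integrableP; split; first exact: measurable_funTS.
    by rewrite eI.
  apply: eq_integrable i2 => // x; exact: fD.
rewrite /Rintegral; congr fine.
transitivity (\int[mu]_(x in D) f x)%E; first by apply: eq_integral => x /fD ->.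
rewrite eI I1 phiD fphi; apply: eq_integral => x xE /=.
by rewrite patchE xE.
Qed.

End affine_invariance.

(** * The subordination kernel *)

Section subordination_kernel.
Context {R : realType}.
Notation mu := (@lebesgue_measure R).
Implicit Types (s t c r T : R).

(** Puts convolution integrals on a fixed domain, as Fubini needs. The zero extension is automatic
    for the kernels in use: [Num.sqrt] vanishes on negative numbers and the inverse of 0 is 0, so
    [(Num.sqrt (r - x))^-1] is 0 for [x >= r]. *)
Lemma Rintegral_zero_ext (D E : set R) (f : R -> R) : measurable D -> measurable E ->
  E `<=` D -> (forall x, D x -> ~ E x -> f x = 0) ->
  mu.-integrable E (EFin \o f) ->
  mu.-integrable D (EFin \o f) /\ \int[mu]_(x in D) f x = \int[mu]_(x in E) f x.
Proof.
move=> mD mE ED f0 iE; have pE : f \_ D = f \_ E.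
  apply/funext => x; rewrite !patchE; case: (boolP (x \in E)) => xE.
    by rewrite mem_set//; apply: ED; exact/set_mem.
  case: ifPn => // xD; apply: f0; first exact/set_mem.
  by move=> Ex; move: xE; rewrite mem_set.
split; last by rewrite (Rintegral_mkcond mu D) (Rintegral_mkcond mu E) pE.
have pE' : (EFin \o f) \_ D = (EFin \o f) \_ E.
  apply/funext => x; have := congr1 (fun h : R -> R => h x) pE; rewrite !patchE /=.
  by case: (x \in D); case: (x \in E) => //=; by [move=> ->|move=> <-].
have HD := @integrable_mkcond _ (measurableTypeR R) R mu D (EFin \o f) mD.
have HE := @integrable_mkcond _ (measurableTypeR R) R mu E (EFin \o f) mE.
by apply/HD; rewrite pE'; apply/HE.
Qed.

Lemma intble_bdd_itv T (C : R) (g : R -> R) : measurable_fun (`]0, T[ : set R) g ->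
  (forall s, 0 < s < T -> `|g s| <= C) -> mu.-integrable `]0, T[ (EFin \o g).
Proof.
move=> mg gC; have i1 : mu.-integrable `]0, T[ (EFin \o (cst C : R -> R)).
  apply: measurable_bounded_integrable => //.
    by rewrite /= lebesgue_measure_itv /=; case: ifP => _; rewrite ?ltry// -EFinB ltry.
  by exists `|C|; split; [exact: num_real|move=> M CM x _ /=; exact: ltW].
by apply: le_intble (i1) _ => // s; rewrite /= in_itv/=; exact: gC.
Qed.

Lemma measurable_sqrtVT : measurable_fun [set: R] (fun s => (Num.sqrt s)^-1).
Proof.
have -> : (fun s : R => (Num.sqrt s)^-1) = (fun s => (Num.sqrt s)^-1) \_ `]0, +oo[.
  apply/funext => s; rewrite patchE; case: ifPn => // s0.
  rewrite ler0_sqrtr ?invr0// leNgt; apply/negP => s1.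
  by move: s0; rewrite mem_set//= in_itv/= andbT.
have m0 : measurable (`]0, +oo[%classic : set R) by [].
by apply/(measurable_restrictT _ m0); exact: measurable_sqrtV.
Qed.

Lemma atan_le_id (x : R) : 0 <= x -> atan x <= x.
Proof.
move=> x0; rewrite -subr_ge0.
have d (y : R) : is_derive y 1 (fun y => y - atan y) (1 - (1 + y ^+ 2)^-1).
  by isDeq; rewrite mulr1.
have := @ger0_derive1_ndecr R (fun y => y - atan y) 0 x _ _ _ 0 x (lexx 0) x0 (lexx x).
rewrite atan0 subr0; apply.
- by move=> y _; have [] := d y.
- move=> y _; rewrite derive1E; have [_ ->] := d y.
  by rewrite subr_ge0 invf_le1 ?lerDl ?sqr_ge0// ltr_pwDl ?sqr_ge0.
- by apply: continuous_subspaceT => y; exact: isD_continuous (d y).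
Qed.

(* Subordination: S(t) v = int_0^oo qk s t * e^(-s A) v ds. *)
Definition qk s t : R := Num.sqrt t / (pi * (Num.sqrt s * (s + t))).
Definition th s t : R := (Num.sqrt s)^-1 - (Num.sqrt (t + s))^-1.

Lemma pi_qk s t : pi * qk s t = Num.sqrt t / (Num.sqrt s * (s + t)).
Proof.
rewrite /qk; move: (pi : R) (pi_gt0 R) => P P0; rewrite invfM mulrCA; congr (_ * _).
by rewrite mulVKf// gt_eqF.
Qed.

Lemma qk_ge0 s t : 0 < s -> 0 < t -> 0 <= qk s t.
Proof.
by move=> s0 t0; rewrite divr_ge0 ?mulr_ge0 ?sqrtr_ge0 ?pi_ge0// ltW// addr_gt0.
Qed.

Lemma th_ge0 s t : 0 < s -> 0 <= t -> 0 <= th s t.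
Proof.
move=> s0 t0; rewrite subr_ge0 lef_pV2 ?posrE ?sqrtr_gt0//; last by rewrite ltr_wpDl.
by rewrite ler_wsqrtr// lerDr.
Qed.

Lemma th_le s t t' : 0 < s -> 0 <= t -> t <= t' -> th s t <= th s t'.
Proof.
move=> s0 t0 tt'; rewrite lerD2l lerN2 lef_pV2 ?posrE ?sqrtr_gt0 ?ltr_wpDl//; last first.
  exact: le_trans tt'.
by rewrite ler_wsqrtr// lerD2r.
Qed.

Lemma th_le_sqrtV s t : th s t <= (Num.sqrt s)^-1.
Proof. by rewrite gerBl invr_ge0 sqrtr_ge0. Qed.

(** The link between the two kernels: [2 * atan (sqrt c / sqrt r)] is the half-order integral of
    [th] in s ([integral_th_atan]), and its derivative produces [qk]. *)
Lemma is_derive_atan_sqrt c r : 0 < c -> 0 < r ->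
  is_derive r 1 (fun r => 2 * atan (Num.sqrt c / Num.sqrt r)) (- (pi * qk r c)).
Proof.
move=> c0 r0; rewrite pi_qk.
have sr : 0 < Num.sqrt r by rewrite sqrtr_gt0.
have sc : 0 < Num.sqrt c by rewrite sqrtr_gt0.
isDeq; [exact: lt0r_neq0|exact: r0|].
have e1 : r = Num.sqrt r ^+ 2 by rewrite sqr_sqrtr// ltW.
have e2 : c = Num.sqrt c ^+ 2 by rewrite sqr_sqrtr// ltW.
rewrite [in r + c]e1 [in _ + c]e2.
move: (Num.sqrt r) (Num.sqrt c) sr sc => A B A0 B0.
by field; rewrite ?gt_eqF//= ?addr_gt0 ?exprn_gt0// ?mulr_gt0.
Qed.

Lemma intble_qk t : 0 < t ->
  mu.-integrable `]0, +oo[ (EFin \o (fun s => qk s t)) /\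
  \int[mu]_(s in `]0, +oo[) qk s t = 1.
Proof.
move=> t0; have [i e] := integral_sqrt_cauchy t0.
have qE : (fun s => qk s t) = (fun s => Num.sqrt t / pi * (Num.sqrt s * (t + s))^-1).
  by apply/funext => s; rewrite /qk invfM mulrA [s + t]addrC.
have m0 : measurable (`]0, +oo[%classic : set R) by [].
rewrite qE; split; first exact: intbleZ.
rewrite (RintegralcM _ m0 i) e; have p0 : 0 < pi :> R := pi_gt0 R.
have st : 0 < Num.sqrt t by rewrite sqrtr_gt0.
by move: (pi : R) p0 => P p0; field; lra.
Qed.

Lemma continuous_qk s c : 0 < s -> 0 < c -> {for s, continuous (fun s => qk s c)}.
Proof.
move=> s0 c0; have -> : (fun s => qk s c) = (fun s => Num.sqrt c / pi * (Num.sqrt s * (c + s))^-1).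
  by apply/funext => x; rewrite /qk invfM mulrA [x + c]addrC.
move: (Num.sqrt c / pi) => k; isDcont; last exact: s0.
by rewrite mulf_neq0// gt_eqF ?sqrtr_gt0// addr_gt0.
Qed.

Lemma integral_kernel_th s r T : 0 < s -> 0 <= r -> r < T ->
  mu.-integrable `]0, T[ (EFin \o (fun x => qk s (T - x) * (Num.sqrt (x - r))^-1)) /\
  \int[mu]_(x in `]0, T[) (qk s (T - x) * (Num.sqrt (x - r))^-1) = th s (T - r).
Proof.
move=> s0 r0 rT; have t0 : 0 < T - r by lra.
have m0 : measurable (`]0, (T - r)[%classic : set R) by [].
have [i e] := integral_sqrt_kernel s0 t0.
have := @Rintegral_affine R T (-1) _ _ (or_intror erefl) m0 i; cbv zeta.
have -> : (fun x => T + -1 * x) @^-1` `]0, (T - r)[ = `]r, T[%classic.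
  by apply/seteqP; split => x /=; rewrite !in_itv/= mulN1r; lra.
move=> [i1 e1]; rewrite e in e1.
set g := fun x => Num.sqrt (T + -1 * x) /
   ((s + (T + -1 * x)) * Num.sqrt (T - r - (T + -1 * x))) in i1 e1.
have gE : (fun x => qk s (T - x) * (Num.sqrt (x - r))^-1) =
    (fun x => (pi * Num.sqrt s)^-1 * g x).
  apply/funext => x; rewrite /g /qk mulN1r !invfM.
  have -> : T - r - (T - x) = x - r by lra.
  by move: (pi : R) (Num.sqrt _) (Num.sqrt _) (Num.sqrt _) => P y1 y2 y3; ring.
have mr : measurable (`]r, T[%classic : set R) by [].
have ir : mu.-integrable `]r, T[ (EFin \o (fun x => qk s (T - x) * (Num.sqrt (x - r))^-1)).
  by rewrite gE; exact: intbleZ.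
have [||//|i2 ->] := @Rintegral_zero_ext `]0, T[ `]r, T[ _ _ mr _ _ ir.
- by [].
- by move=> x /=; rewrite !in_itv/= => /andP[rx ->]; rewrite (le_lt_trans r0 rx).
- move=> x /= _; rewrite in_itv/= => xr; case: (ltP r x) => xr'; last first.
    by rewrite ler0_sqrtr ?subr_le0// invr0 mulr0.
  rewrite /qk ler0_sqrtr ?mul0r// subr_le0 leNgt; apply/negP => xT.
  by apply: xr; rewrite xr' xT.
split => //; rewrite gE (RintegralcM _ mr i1) e1 /th.
have p0 : 0 < pi :> R := pi_gt0 R; have ss : 0 < Num.sqrt s by rewrite sqrtr_gt0.
have ss2 : 0 < Num.sqrt (T - r + s) by rewrite sqrtr_gt0; lra.
move: (pi : R) p0 (Num.sqrt s) (Num.sqrt _) ss ss2 => P p0 y1 y2 h1 h2.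
by field; rewrite !gt_eqF.
Qed.

Lemma integral_th_atan c r : 0 < c -> 0 < r ->
  mu.-integrable `]0, +oo[ (EFin \o (fun s => th s c * (Num.sqrt (r - s))^-1)) /\
  \int[mu]_(s in `]0, +oo[) (th s c * (Num.sqrt (r - s))^-1) =
  2 * atan (Num.sqrt c / Num.sqrt r).
Proof.
move=> c0 r0; have [i e] := integral_sqrt_theta c0 r0.
have sub : `]0, r[ `<=` (`]0, +oo[%classic : set R).
  by move=> x /=; rewrite !in_itv/= andbT => /andP[].
have m0 : measurable (`]0, +oo[%classic : set R) by [].
have mr : measurable (`]0, r[%classic : set R) by [].
have z x : (`]0, +oo[%classic : set R) x -> ~ (`]0, r[%classic : set R) x ->
    ((Num.sqrt x)^-1 - (Num.sqrt (c + x))^-1) / Num.sqrt (r - x) = 0.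
  rewrite /= !in_itv/= andbT => -> /negP; rewrite -leNgt -subr_le0 => rx.
  by rewrite (ler0_sqrtr rx) invr0 mulr0.
have [i1 e1] := Rintegral_zero_ext m0 mr sub z i; split; first exact: i1.
by rewrite /th e1.
Qed.

End subordination_kernel.

(** * The kernel [th] integrated against the square root of A *)

Section subordination.
Context {R : realType}.
Notation mu := (@lebesgue_measure R).
Implicit Types (X : Xspace R) (u : R -> R) (b s t c r : R).

Let in0 (s : R) : (`]0, +oo[%classic : set R) s -> 0 < s.
Proof. by rewrite /= in_itv/= andbT. Qed.

(** The translation [r = s + s'] moves the dependence on s into the weight: [hp2 u b (t + r)] no
    longer contains s and can be pulled out of an s-integral. *)
Lemma hA_shift X u b t s : Xmem X u -> 0 < t -> 0 < s ->
  mu.-integrable `]0, +oo[ (EFin \o (fun r => (Num.sqrt (r - s))^-1 * hp2 u b (t + r))) /\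
  \int[mu]_(r in `]0, +oo[) ((Num.sqrt (r - s))^-1 * hp2 u b (t + r)) =
  - (Num.sqrt pi * hA u b (t + s)).
Proof.
move=> uX t0 s0; have ts := addr_gt0 t0 s0.
have m0 : measurable (`]0, +oo[%classic : set R) by [].
have [i _] := Ahalf_kernel_intble b uX ts.
have := @Rintegral_affine R (- s) 1 _ _ (or_introl erefl) m0 i; cbv zeta.
have -> : (fun x => - s + 1 * x) @^-1` `]0, +oo[ = `]s, +oo[%classic.
  by apply/seteqP; split => x /=; rewrite !in_itv/= mul1r !andbT; lra.
have gE : (fun x => (Num.sqrt (- s + 1 * x))^-1 * hp2 u b (t + s + (- s + 1 * x))) =
    (fun r => (Num.sqrt (r - s))^-1 * hp2 u b (t + r)).
  by apply/funext => x; rewrite mul1r; congr (_ * hp2 _ _ _); [rewrite addrC|lra].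
rewrite gE => -[i1 e1].
have ms : measurable (`]s, +oo[%classic : set R) by [].
have sub : `]s, +oo[ `<=` (`]0, +oo[%classic : set R).
  by move=> x /=; rewrite !in_itv/= !andbT; exact: lt_trans.
have z x : (`]0, +oo[%classic : set R) x -> ~ (`]s, +oo[%classic : set R) x ->
    (Num.sqrt (x - s))^-1 * hp2 u b (t + x) = 0.
  rewrite /= !in_itv/= !andbT => _ /negP; rewrite -leNgt -subr_le0 => xs.
  by rewrite (ler0_sqrtr xs) invr0 mul0r.
have [i2 e2] := Rintegral_zero_ext m0 ms sub z i1; split; first exact: i2.
rewrite e2 e1 /hA mulrN opprK.
have sp : 0 < Num.sqrt pi :> R by rewrite sqrtr_gt0; exact: pi_gt0.
exact: esym (mulVKf (lt0r_neq0 sp) _).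
Qed.

Lemma is_derive_hp_shift X u b t s : Xmem X u -> 0 < t + s ->
  is_derive s 1 (fun s => hp u b (t + s)) (hp2 u b (t + s)).
Proof.
move=> uX ts; have d1 : is_derive s 1 (fun s : R => t + s) (0 + 1) by isD.
have := @isD_comp _ (hp u b) (fun s => t + s) s _ _ (is_derive_hp b uX ts) d1.
by move/is_derive_eq; apply; ring.
Qed.

Lemma measurable_hp_shift X u b t : Xmem X u -> 0 < t ->
  measurable_fun (`]0, +oo[ : set R) (fun s => hp u b (t + s)).
Proof.
move=> uX t0; apply: open_continuous_measurable_fun => // s; rewrite inE => /in0 s0.
exact: isD_continuous (is_derive_hp_shift b uX (addr_gt0 t0 s0)).
Qed.

Lemma hp_le_shift X u b t s : Xmem X u -> 0 < t -> 0 <= s ->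
  `|hp u b (t + s)| <= amp t * nrm X u.
Proof.
move=> uX t0 s0; apply: le_trans (hp_le b uX _) _; first exact: ltr_wpDr.
by rewrite ler_wpM2r ?nrm_ge0// amp_le// lerDl.
Qed.

Lemma intble_qk_hp X u b t c : Xmem X u -> 0 < t -> 0 < c ->
  mu.-integrable `]0, +oo[ (EFin \o (fun s => qk s c * hp u b (t + s))).
Proof.
move=> uX t0 c0; have [i _] := intble_qk c0.
have i1 : mu.-integrable `]0, +oo[ (EFin \o (fun s => amp t * nrm X u * qk s c)).
  exact: intbleZ.
apply: le_intble (i1) _ => //.
  by apply: measurable_funM; [exact: intble_meas i|exact: (measurable_hp_shift b uX)].
move=> s /in0 s0; rewrite normrM (ger0_norm (qk_ge0 s0 c0)) mulrC.
by rewrite ler_wpM2r ?qk_ge0//; apply: hp_le_shift => //; exact: ltW.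
Qed.

(** Integration by parts against [is_derive_atan_sqrt]. At 0 the arctangent tends to pi/2, giving
    the boundary term [pi * hp u b t]; at infinity it tends to 0 while [hp] stays bounded. *)
Lemma integral_atan_hp2 X u b t c : Xmem X u -> 0 < t -> 0 < c ->
  mu.-integrable `]0, +oo[
    (EFin \o (fun r => hp2 u b (t + r) * (2 * atan (Num.sqrt c / Num.sqrt r)))) /\
  \int[mu]_(r in `]0, +oo[) (hp2 u b (t + r) * (2 * atan (Num.sqrt c / Num.sqrt r))) =
  pi * (\int[mu]_(s in `]0, +oo[) (qk s c * hp u b (t + s)) - hp u b t).
Proof.
move=> uX t0 c0; have m0 : measurable (`]0, +oo[%classic : set R) by [].
have [ik _] := Ahalf_kernel_intble b uX t0.
pose P r := hp u b (t + r) * (2 * atan (Num.sqrt c / Num.sqrt r)).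
pose p1 r := hp2 u b (t + r) * (2 * atan (Num.sqrt c / Num.sqrt r)).
have [P' P'E] : exists P' : R, P' = pi by exists pi.
have p0 : 0 < P' by rewrite P'E; exact: pi_gt0.
pose p2 r := P' * (qk r c * hp u b (t + r)).
have sc : 0 < Num.sqrt c by rewrite sqrtr_gt0.
have dat r : 0 < r -> is_derive r 1 (fun r => 2 * atan (Num.sqrt c / Num.sqrt r)) (- (P' * qk r c)).
  by rewrite P'E; exact: is_derive_atan_sqrt.
have dP r : 0 < r -> is_derive r 1 P (p1 r - p2 r).
  move=> r0; have d := isD_mul (is_derive_hp_shift b uX (addr_gt0 t0 r0)) (dat r r0).
  apply: is_derive_eq d _; rewrite /p1 /p2.
  by move: (hp _ _ _) (qk _ _) => y1 y2; ring.
have ip2 : mu.-integrable `]0, +oo[ (EFin \o p2).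
  exact: (intbleZ P' m0 (intble_qk_hp b uX t0 c0)).
have ip1 : mu.-integrable `]0, +oo[ (EFin \o p1).
  have i1 : mu.-integrable `]0, +oo[
      (EFin \o (fun r => 2 * Num.sqrt c * `|(Num.sqrt r)^-1 * hp2 u b (t + r)|)).
    by apply: (intbleZ _ m0); exact: integrable_norm ik.
  apply: le_intble (i1) _ => //.
    apply: measurable_funM; first exact: (measurable_hp2_shift b uX).
    apply: open_continuous_measurable_fun => // r; rewrite inE => /in0 r0.
    exact: isD_continuous (dat r r0).
  move=> r /in0 r0; rewrite /p1 !normrM mulrC (ger0_norm (_ : 0 <= (Num.sqrt r)^-1)) ?invr_ge0 ?sqrtr_ge0//.
  rewrite [leRHS]mulrA ler_wpM2r// normr_nat -mulrA ler_wpM2l//.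
  have a0 : 0 <= Num.sqrt c / Num.sqrt r by rewrite divr_ge0 ?sqrtr_ge0.
  by rewrite ger0_norm ?atan_le_id// -(@atan0 R); exact: le_atan.
have FT : \int[mu]_(r in `]0, +oo[) (p1 r - p2 r) = 0 - hp u b t * P'.
  apply: (@ftc_oy R (fun r => p1 r - p2 r) P 0 (hp u b t * P') 0 _ _ _ _ _).2.
  - move=> r r0; apply: cvgB.
      apply: cvgM; first exact: (@continuous_hp2_shift R _ _ b _ _ uX t0 (ltW r0)).
      exact: isD_continuous (dat r r0).
    apply: cvgMr; apply: cvgM.
      exact: (@continuous_qk R r c r0 c0).
    exact: isD_continuous (is_derive_hp_shift b uX (addr_gt0 t0 r0)).
  - apply: cvgM.
      have -> : hp u b t = hp u b (t + 0) by rewrite addr0.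
      apply: cvg_at_right_filter.
      by apply: isD_continuous (is_derive_hp_shift b uX _); rewrite addr0.
    have -> : P' = 2 * (P' / 2) by field.
    rewrite P'E.
    apply: cvgMr; apply: (atan_div_cvg sc); first exact: cvg_cst.
      by rewrite -[X in _ --> X]sqrtr0; apply: sqrt_cvg; exact: cvg_at_right_filter.
    by near=> r; rewrite sqrtr_gt0.
  - apply: norm_cvg0; set C := amp t * nrm X u.
    apply: (@squeeze_cvgr _ _ _ _ (fun=> 0) (fun r => C * (2 * (Num.sqrt c / Num.sqrt r)))).
    + near=> r; have r0 : 0 < r by near: r; apply: nbhs_pinfty_gt; exact: num_real.
      have a0 : 0 <= Num.sqrt c / Num.sqrt r by rewrite divr_ge0 ?sqrtr_ge0.
      have at0 : 0 <= atan (Num.sqrt c / Num.sqrt r) by rewrite -(@atan0 R); exact: le_atan.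
      rewrite normr_ge0/= /P normrM ler_pM//; first exact: (hp_le_shift b uX t0 (ltW r0)).
      by rewrite ger0_norm ?mulr_ge0// ler_wpM2l// atan_le_id.
    + exact: cvg_cst.
    + rewrite -[X in _ --> X](mulr0 C); apply: cvgMr.
      rewrite -[X in _ --> X](mulr0 2); apply: cvgMr.
      rewrite -[X in _ --> X](mulr0 (Num.sqrt c)); apply: cvgMr.
      exact: (cvg_comp Num.sqrt GRing.inv (@cvgy_sqrt R) (@cvgV_y R)).
  - by right; exact: intbleB.
have iqh := intble_qk_hp b uX t0 c0.
split; first exact: ip1.
have E : \int[mu]_(r in `]0, +oo[) p1 r - \int[mu]_(r in `]0, +oo[) p2 r = 0 - hp u b t * P'.
  by rewrite -FT; symmetry; exact: RintegralB.
have E2 : \int[mu]_(r in `]0, +oo[) p2 r = P' * \int[mu]_(s in `]0, +oo[) (qk s c * hp u b (t + s)).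
  exact: RintegralcM.
rewrite E2 in E; rewrite -P'E -/p1.
have fin (y1 y2 y3 : R) : y1 - P' * y2 = 0 - y3 * P' -> y1 = P' * (y2 - y3) by clear; lra.
exact: fin E.
Unshelve. all: by end_near. Qed.

Lemma mulNVNKf (x y : R) : x != 0 -> - x^-1 * (- x * y) = y.
Proof. by move=> x0; rewrite !mulNr mulrN opprK mulKf. Qed.

(** After [hA_shift] and Fubini the s-integral of [th s c * (r - s)^(-1/2)] is
    [2 * atan (sqrt c / sqrt r)], and [integral_atan_hp2] finishes. This eliminates A^(1/2) by
    integrating over heat time, for each fixed [u]. *)
Lemma integral_th_hA X u b t c : Xmem X u -> 0 < t -> 0 < c ->
  \int[mu]_(s in `]0, +oo[) (th s c * hA u b (t + s)) =
  Num.sqrt pi * (hp u b t - \int[mu]_(s in `]0, +oo[) (qk s c * hp u b (t + s))).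
Proof.
move=> uX t0 c0; have m0 : measurable (`]0, +oo[%classic : set R) by [].
pose h r s := th s c * (Num.sqrt (r - s))^-1 * hp2 u b (t + r).
have [ik _] := Ahalf_kernel_intble b uX t0.
have inner r : 0 < r -> mu.-integrable `]0, +oo[ (EFin \o h r) /\
   forall y, \int[mu]_(s in `]0, +oo[) (th s c * (Num.sqrt (r - s))^-1 * y) =
     2 * atan (Num.sqrt c / Num.sqrt r) * y.
  move=> r0; have [i e] := integral_th_atan c0 r0.
  have hE y : (fun s => th s c * (Num.sqrt (r - s))^-1 * y) =
      (fun s => y * (th s c * (Num.sqrt (r - s))^-1)).
    by apply/funext => s; rewrite mulrC.
  split; first by rewrite /h hE; exact: intbleZ.
  by move=> y; rewrite hE (RintegralcM _ m0 i) e mulrC.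
have thm : measurable_fun [set: R] (fun s => th s c).
  apply: measurable_funB; first exact: measurable_sqrtVT.
  apply: (measurableT_comp measurable_sqrtVT).
  by apply: measurable_funD.
have [|||r /in0 r0|r /in0 r0||_ i2 FE] := @Rintegral_Fubini R `]0, +oo[ `]0, +oo[ h
  (fun r => 2 * Num.sqrt c * `|(Num.sqrt r)^-1 * hp2 u b (t + r)|).
- by [].
- by [].
- rewrite /h; apply: measurable_funM; last exact: (measurable_fst_on m0 m0 (measurable_hp2_shift b uX t0)).
  apply: measurable_funM.
    exact: (@measurable_snd_on R _ _ (fun s => th s c) m0 m0 (measurable_funTS thm)).
  apply: measurable_funTS; apply: (measurableT_comp measurable_sqrtVT).
  exact: measurable_funB.
- by case: (inner r r0).
- have [_ e] := inner r r0.
  apply: (@le_trans _ _ (2 * atan (Num.sqrt c / Num.sqrt r) * `|hp2 u b (t + r)|)).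
    rewrite -e le_eqVlt; apply/orP; left; apply/eqP; apply: eq_Rintegral => s.
    rewrite inE => /in0 s0; rewrite /h (normrM (_ * _)) ger0_norm//.
    by apply: mulr_ge0; [exact: th_ge0 (ltW c0)|rewrite invr_ge0 sqrtr_ge0].
  rewrite normrM ger0_norm ?invr_ge0 ?sqrtr_ge0// mulrA ler_wpM2r// -mulrA ler_wpM2l//.
  by apply: atan_le_id; rewrite divr_ge0 ?sqrtr_ge0.
- by apply: intbleZ => //; exact: integrable_norm ik.
have [_ A] := integral_atan_hp2 b uX t0 c0.
have E1 : \int[mu]_(r in `]0, +oo[) (hp2 u b (t + r) * (2 * atan (Num.sqrt c / Num.sqrt r))) = \int[mu]_(r in `]0, +oo[) \int[mu]_(s in `]0, +oo[) h r s.
  apply: eq_Rintegral => r; rewrite inE => /in0 r0; have [_ e] := inner r r0.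
  by rewrite /h (e (hp2 u b (t + r))) mulrC.
have hE s : 0 < s -> \int[mu]_(r in `]0, +oo[) h r s = - Num.sqrt pi * (th s c * hA u b (t + s)).
  move=> s0; have [i e] := hA_shift b uX t0 s0.
  have -> : - Num.sqrt pi * (th s c * hA u b (t + s)) = th s c * - (Num.sqrt pi * hA u b (t + s)).
    by move: (Num.sqrt pi) (th s c) (hA _ _ _) => y1 y2 y3; clear; ring.
  rewrite -e -(RintegralcM _ m0 i); apply: eq_Rintegral => r _; exact: esym (mulrA _ _ _).
have [P [PE P0]] : exists P : R, P = Num.sqrt pi /\ 0 < P.
  exists (Num.sqrt pi); split; first exact: erefl.
  by rewrite sqrtr_gt0; exact: pi_gt0.
have PP : pi = P * P by rewrite PE; exact: esym (sqr_sqrtr (pi_ge0 R)).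
have i3 : mu.-integrable `]0, +oo[ (EFin \o (fun s => th s c * hA u b (t + s))).
  have i4 := intbleZ (- P^-1) m0 i2; apply: eq_integrable (i4).
    by [].
  move=> s; rewrite inE => /in0 s0 /=; rewrite (hE s s0) -PE; congr EFin.
  exact: mulNVNKf (lt0r_neq0 P0).
have E2 : \int[mu]_(s in `]0, +oo[) \int[mu]_(r in `]0, +oo[) h r s =
   - P * \int[mu]_(s in `]0, +oo[) (th s c * hA u b (t + s)).
  rewrite -(RintegralcM _ m0 i3); apply: eq_Rintegral => s; rewrite inE => /in0 s0.
  by rewrite (hE s s0) PE.
rewrite E1 FE E2 PP in A; rewrite -PE.
have fin (y1 y2 y3 : R) : - P * y1 = P * P * (y2 - y3) -> y1 = P * (y3 - y2).
  move=> H; apply: (mulfI (lt0r_neq0 P0)); move: H; clear; lra.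
exact: fin A.
Qed.

End subordination.

(** * The Volterra equation *)

Lemma Volterra_algebra {R : realType} (P q f f0 k : R) : P != 0 ->
  f = f0 - P^-1 * k -> q * k = P * (q * f0 - q * f).
Proof. by move=> P0 ->; field. Qed.

Section volterra.
Context {R : realType}.
Notation mu := (@lebesgue_measure R).
Implicit Types (X : Xspace R) (u v : R -> R) (U W : R -> R -> R) (b s t c r T : R).

Let in0 (s : R) : (`]0, +oo[%classic : set R) s -> 0 < s.
Proof. by rewrite /= in_itv/= andbT. Qed.

Let inT (T s : R) : (`]0, T[%classic : set R) s -> 0 < s < T.
Proof. by rewrite /= in_itv/=. Qed.

Let m0 : measurable (`]0, +oo[%classic : set R).
Proof. by []. Qed.

Let mT (T : R) : measurable (`]0, T[%classic : set R).
Proof. by []. Qed.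

Lemma nrm_subC X u v : nrm X (u \- v) = nrm X (v \- u).
Proof.
rewrite /nrm; congr fine; case: X => [p p1|] /=.
  rewrite unlock; congr (_ `^ _)%E; apply: eq_integral => x _ /=.
  by rewrite distrC.
congr ereal_sup; apply/seteqP; split => _ [x _ <-]; exists x => //=; by rewrite distrC.
Qed.

Lemma nrm_triangle X u v : Xmem X u -> Xmem X v -> nrm X u <= nrm X (u \- v) + nrm X v.
Proof.
move=> uX vX; have dX := Xmem_sub uX vX.
have := Xnorm_triangle dX vX.
rewrite (_ : (u \- v) \+ v = u); last by apply/funext => x /=; rewrite subrK.
by rewrite (nrmE uX) (nrmE dX) (nrmE vX) -EFinD lee_fin.
Qed.

Definition continuous_family X U : Prop := (forall s, Xmem X (U s)) /\
  forall s0 : R, nrm X (U s \- U s0) @[s --> s0] --> 0.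

Lemma continuous_family_cst X v : Xmem X v -> continuous_family X (fun=> v).
Proof.
move=> vX; split => // s0; have -> : nrm X (v \- v) = 0 by rewrite /nrm Xnorm_sub0.
exact: cvg_cst.
Qed.

Lemma continuous_family_cvg X U s0 (C : R) (F : (R -> R) -> R) : continuous_family X U ->
  (forall u v, Xmem X u -> Xmem X v -> F (u \- v) = F u - F v) ->
  (forall u, Xmem X u -> `|F u| <= C * nrm X u) ->
  F (U s) @[s --> s0] --> F (U s0).
Proof.
move=> [UX cU] FB FC; apply/subr_cvg0; apply: norm_cvg0.
apply: (@squeeze_cvgr _ _ _ _ (fun=> 0) (fun s => C * nrm X (U s \- U s0))).
- by near=> s; rewrite normr_ge0/= -FB//; apply: FC; exact: Xmem_sub.
- exact: cvg_cst.
- by rewrite -[X in _ --> X](mulr0 C); apply: cvgMr; exact: cU.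
Unshelve. all: by end_near. Qed.

Lemma continuous_family_hp X U b t : continuous_family X U -> 0 < t ->
  continuous (fun s => hp (U s) b t).
Proof.
move=> gU t0 s0; apply: (@continuous_family_cvg X U s0 (amp t) (fun u => hp u b t) gU).
- by move=> u v uX vX; exact: (hp_sub b uX vX t0).
- by move=> u uX; exact: hp_le.
Qed.

Definition Ah t : R := (Num.sqrt pi)^-1 * (4 * amp t * (pi / Num.sqrt t)).

Lemma Ah_ge0 t : 0 <= Ah t.
Proof.
apply: mulr_ge0; first by rewrite invr_ge0 sqrtr_ge0.
apply: mulr_ge0; first by apply: mulr_ge0 => //; exact: ltW (amp_gt0 t).
by apply: divr_ge0; [exact: pi_ge0|exact: sqrtr_ge0].
Qed.

Lemma continuous_family_hA X U b t : continuous_family X U -> 0 < t ->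
  continuous (fun s => hA (U s) b t).
Proof.
move=> gU t0 s0; apply: (@continuous_family_cvg X U s0 (Ah t) (fun u => hA u b t) gU).
- by move=> u v uX vX; exact: (hA_sub b uX vX t0).
- by move=> u uX; exact: (hA_le b uX t0).
Qed.

Lemma continuous_family_bound X U T : continuous_family X U -> 0 < T ->
  exists2 M, 0 <= M & forall s, 0 <= s <= T -> nrm X (U s) <= M.
Proof.
move=> [UX cU] T0.
have cn : continuous (fun s => nrm X (U s)).
  move=> s0; apply/subr_cvg0; apply: norm_cvg0.
  apply: (@squeeze_cvgr _ _ _ _ (fun=> 0) (fun s => nrm X (U s \- U s0))).
  - near=> s; rewrite normr_ge0/= ler_norml.
    have h1 := nrm_triangle (UX s) (UX s0); have h2 := nrm_triangle (UX s0) (UX s).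
    rewrite (nrm_subC X (U s0) (U s)) in h2.
    by move: (nrm X (U s)) (nrm X (U s0)) (nrm X _) h1 h2 => y1 y2 y3 h1 h2; lra.
  - exact: cvg_cst.
  - exact: cU.
have [||z _ zmax] := @EVT_max R (fun s => nrm X (U s)) 0 T.
- exact: ltW.
- exact: continuous_subspaceT.
exists (nrm X (U z)); first exact: nrm_ge0.
by move=> s sT; apply: zmax; rewrite in_itv/=.
Unshelve. all: by end_near. Qed.

Lemma hA_le_shift X u b t s : Xmem X u -> 0 < t -> 0 <= s ->
  `|hA u b (t + s)| <= Ah t * nrm X u.
Proof.
move=> uX t0 s0; have ts : 0 < t + s by exact: ltr_wpDr.
apply: le_trans (hA_le b uX ts) _; rewrite ler_wpM2r ?nrm_ge0//.
apply: ler_wpM2l; first by rewrite invr_ge0 sqrtr_ge0.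
apply: ler_pM.
- by apply: mulr_ge0 => //; exact: ltW (amp_gt0 _).
- by apply: divr_ge0; [exact: pi_ge0|exact: sqrtr_ge0].
- by apply: ler_wpM2l => //; apply: amp_le => //; rewrite lerDl.
- apply: ler_wpM2l; first exact: pi_ge0.
  by rewrite lef_pV2 ?posrE ?sqrtr_gt0// ler_wsqrtr// lerDl.
Qed.

Lemma continuous_hA X u b t : Xmem X u -> 0 < t -> {for t, continuous (hA u b)}.
Proof.
move=> uX t0; have t2 : 0 < t / 2 by lra.
have [i _] := integral_sqrt_cauchy t2.
have ig := intbleZ (4 * amp (t / 2) * nrm X u) m0 i.
have c1 : {for t, continuous
    (fun t => \int[mu]_(s in `]0, +oo[) ((Num.sqrt s)^-1 * hp2 u b (t + s)))}.
  have := @continuity_under_integral R _ _ mu (fun t s => (Num.sqrt s)^-1 * hp2 u b (t + s))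
    `]0, +oo[ m0 (t / 2) (2 * t) _ _ _ ig _ t.
  apply.
  - move=> t'; rewrite /= in_itv/= => /andP[t1 _].
    by apply: (Ahalf_kernel_intble b uX _).1; exact: lt_trans t1.
  - apply: aeW => s /in0 s0 t'; rewrite inE/= in_itv/= => /andP[t1 _].
    have t's : 0 < t' + s by apply: addr_gt0 => //; exact: lt_trans t1.
    apply: cvgMr; have c2 : hp2 u b y @[y --> t' + s] --> hp2 u b (t' + s) := @continuous_hp2 R X u b _ uX t's.
    have c1 : t'' + s @[t'' --> t'] --> t' + s by apply: cvgD; [exact: cvg_id|exact: cvg_cst].
    exact: (cvg_comp (fun t'' => t'' + s) (hp2 u b) c1 c2).
  - move=> t'; rewrite /= in_itv/= => /andP[t1 _]; apply: aeW => s /in0 s0.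
    have t'0 := lt_trans t2 t1.
    rewrite normrM ger0_norm ?invr_ge0 ?sqrtr_ge0// invfM mulrCA.
    apply: ler_wpM2l; first by rewrite invr_ge0 sqrtr_ge0.
    apply: le_trans (hp2_le_shift b uX t'0 (ltW s0)) _.
    apply: ler_pM.
    + by rewrite !mulr_ge0 ?nrm_ge0// ltW// amp_gt0.
    + by rewrite invr_ge0 ltW// addr_gt0.
    + by rewrite ler_wpM2r ?nrm_ge0// ler_wpM2l// amp_le// ltW.
    + by rewrite lef_pV2 ?posrE ?addr_gt0// lerD2r ltW.
  - by rewrite inE/= in_itv/=; lra.
by apply: cvgN; apply: cvgMr; exact: c1.
Qed.

Lemma measurable_hA_shift X u b t : Xmem X u -> 0 < t ->
  measurable_fun (`]0, +oo[ : set R) (fun s => hA u b (t + s)).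
Proof.
move=> uX t0; apply: open_continuous_measurable_fun => // s; rewrite inE => /in0 s0.
have c2 : hA u b y @[y --> t + s] --> hA u b (t + s) := @continuous_hA X u b _ uX (addr_gt0 t0 s0).
have c1 : t + s' @[s' --> s] --> t + s by apply: cvgD; [exact: cvg_cst|exact: cvg_id].
exact: (cvg_comp (fun s' => t + s') (hA u b) c1 c2).
Qed.

Lemma measurable_shift_joint (f : R -> R -> R) T :
  (forall y : R, measurable_fun (`]0, +oo[ : set R) (f^~ y)) ->
  (forall x : R, 0 < x -> continuous (f x)) ->
  measurable_fun (`]0, +oo[ `*` `]0, T[ : set (R * R)) (fun z : R * R => f z.1 z.2).
Proof.
move=> mf cf; apply: (@measurable_funS _ _ _ _ (`]0, +oo[ `*` `[0, +oo[ : set (R * R))).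
- exact: measurableX.
- by move=> [x y] [] /=; rewrite !in_itv/= !andbT => x0 /andP[/ltW y0 _].
- apply: measurable_fun_cara => // x y /in0 x0 y0.
  by apply: cvg_within_filter; exact: cf.
Qed.

Lemma measurable_qk_joint T :
  measurable_fun (`]0, +oo[ `*` `]0, T[ : set (R * R)) (fun z : R * R => qk z.1 (T - z.2)).
Proof.
(* The factor 1/(s + T - r) is written as the square of an inverse root, whose measurability on the
   whole line is known. *)
apply: (eq_measurable_fun (fun z : R * R => pi^-1 * Num.sqrt (T - z.2) * (Num.sqrt z.1)^-1 *
  ((Num.sqrt (z.1 + (T - z.2)))^-1 * (Num.sqrt (z.1 + (T - z.2)))^-1))).
  move=> [x y]; rewrite inE => -[/in0/= x0 /inT /= /andP[y0 yT]].
  have xy : 0 <= x + (T - y) by rewrite addr_ge0 ?subr_ge0 ?ltW.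
  rewrite -invfM -expr2 sqr_sqrtr// /qk !invfM.
  move: (pi^-1 : R) => P; rewrite !mulrA; congr (_ * _ * _); exact: mulrC.
apply: measurable_funTS; apply: measurable_funM; first apply: measurable_funM; first apply: measurable_funM.
- exact: measurable_cst.
- apply: (measurableT_comp (continuous_measurable_fun (@sqrt_continuous R))).
  exact: measurable_funB.
- exact: (measurableT_comp measurable_sqrtVT).
- apply: measurable_funM; apply: (measurableT_comp measurable_sqrtVT);
    by apply: measurable_funD => //; exact: measurable_funB.
Qed.

(** Separates the variables: a weight in s of the type of [integral_sqrt_cauchy] times the
    integrable [c^(-1/2)]. The difference of the two sides is a positive multiple of
    [s * (T - c)]. *)
Lemma qk_le s c T : 0 < s -> 0 < c -> c <= T ->
  qk s c <= T / pi * (Num.sqrt s * (T + s))^-1 * (Num.sqrt c)^-1.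
Proof.
move=> s0 c0 cT.
have -> : qk s c = pi^-1 * (Num.sqrt c / (Num.sqrt s * (s + c))).
  by rewrite -pi_qk mulKf// lt0r_neq0// pi_gt0.
rewrite [T / pi]mulrC -!mulrA ler_wpM2l ?invr_ge0 ?pi_ge0//.
have sc : 0 < Num.sqrt c by rewrite sqrtr_gt0.
have ss : 0 < Num.sqrt s by rewrite sqrtr_gt0.
have e2 : c = Num.sqrt c ^+ 2 by rewrite sqr_sqrtr// ltW.
rewrite [in s + c]e2; rewrite e2 in cT.
move: (Num.sqrt c) (Num.sqrt s) sc ss cT => B A B0 A0 cT {e2}.
have T0 : 0 < T by apply: lt_le_trans cT; rewrite exprn_gt0.
have sB : 0 < s + B ^+ 2 by rewrite addr_gt0 ?exprn_gt0.
rewrite -subr_ge0.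
have -> : T * ((A * (T + s))^-1 / B) - B / (A * (s + B ^+ 2)) =
    s * (T - B ^+ 2) / (A * (T + s) * B * (s + B ^+ 2)).
  by field; rewrite !gt_eqF//= addr_gt0.
apply: divr_ge0; first by rewrite mulr_ge0 ?subr_ge0// ltW.
by apply: ltW; rewrite !mulr_gt0// addr_gt0.
Qed.

Lemma intble_qk_time s T (C : R) (g : R -> R) : 0 < s ->
  measurable_fun (`]0, T[ : set R) g -> (forall r, 0 < r < T -> `|g r| <= C) ->
  mu.-integrable `]0, T[ (EFin \o (fun r => qk s (T - r) * g r)) /\
  (0 < T -> \int[mu]_(r in `]0, T[) `|qk s (T - r) * g r| <=
    T / pi * (Num.sqrt s * (T + s))^-1 * C * (2 * Num.sqrt T)).
Proof.
move=> s0 mg gC; case: (ltP 0 T) => T0; last first.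
  split => //; have -> : `]0, T[%classic = set0 :> set R by rewrite set_itv_ge// bnd_simp -leNgt.
  exact: integrable_set0.
have [i e] := integral_sqrtV T0.
set K := T / pi * (Num.sqrt s * (T + s))^-1.
have C0 : 0 <= C.
  by apply: le_trans (normr_ge0 _) (gC (T / 2) _); lra.
have le r : (`]0, T[%classic : set R) r -> `|qk s (T - r) * g r| <= K * C * (Num.sqrt (T - r))^-1.
  move=> /inT rT; have /andP[r0 rT'] := rT; have c0 : 0 < T - r by rewrite subr_gt0.
  rewrite normrM (ger0_norm (qk_ge0 s0 c0)) [leRHS]mulrAC.
  apply: ler_pM; [exact: qk_ge0|exact: normr_ge0| |exact: gC].
  by apply: qk_le => //; rewrite gerBl ltW.
have mq : measurable_fun (`]0, T[ : set R) (fun r => qk s (T - r)).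
  apply: open_continuous_measurable_fun => // r; rewrite inE => /inT /andP[r0 rT].
  have c0 : 0 < T - r by rewrite subr_gt0.
  have c1 : Num.sqrt (T - r') @[r' --> r] --> Num.sqrt (T - r).
    by apply: sqrt_cvg; apply: cvgB; [exact: cvg_cst|exact: cvg_id].
  have c2 : (Num.sqrt s * (s + (T - r')))^-1 @[r' --> r] --> (Num.sqrt s * (s + (T - r)))^-1.
    apply: cvgV.
      by apply: mulf_neq0; apply: lt0r_neq0; [rewrite sqrtr_gt0|exact: addr_gt0].
    apply: cvgMr; apply: cvgD; first exact: cvg_cst.
    by apply: cvgB; [exact: cvg_cst|exact: cvg_id].
  have -> : (fun r => qk s (T - r)) = (fun r => Num.sqrt (T - r) * (pi^-1 * (Num.sqrt s * (s + (T - r)))^-1)).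
    by apply/funext => x; rewrite /qk invfM.
  by apply: cvgM => //; apply: cvgMr.
have m : measurable_fun (`]0, T[ : set R) (fun r => qk s (T - r) * g r) by exact: measurable_funM.
have ib := intbleZ (K * C) (mT T) i.
split; first exact: (le_intble (mT T) m ib le).
move=> _; rewrite -e -(RintegralcM _ (mT T) i); apply: le_trans (ler_norm _) _.
apply: (Rintegral_le_norm (mT T) _ ib); first exact: measurableT_comp m.
by move=> r /le; rewrite normr_id.
Qed.

Lemma qk_hp_swap X W b t T : continuous_family X W -> 0 < t -> 0 < T ->
  [/\ mu.-integrable `]0, +oo[
      (EFin \o (fun s => \int[mu]_(r in `]0, T[) (qk s (T - r) * hp (W r) b (t + s)))),
    mu.-integrable `]0, T[
      (EFin \o (fun r => \int[mu]_(s in `]0, +oo[) (qk s (T - r) * hp (W r) b (t + s)))) &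
    \int[mu]_(s in `]0, +oo[) \int[mu]_(r in `]0, T[) (qk s (T - r) * hp (W r) b (t + s)) =
    \int[mu]_(r in `]0, T[) \int[mu]_(s in `]0, +oo[) (qk s (T - r) * hp (W r) b (t + s))].
Proof.
move=> gW t0 T0; have [M M0 bM] := continuous_family_bound gW T0; have [WX _] := gW.
have [ic _] := integral_sqrt_cauchy T0.
have bnd s : 0 < s -> forall r, 0 < r < T -> `|hp (W r) b (t + s)| <= amp t * M.
  move=> s0 r /andP[r0 rT]; apply: le_trans (hp_le_shift b (WX r) t0 (ltW s0)) _.
  by apply: ler_wpM2l; [exact: ltW (amp_gt0 t)|apply: bM; rewrite !ltW].
have mW s : 0 < s -> measurable_fun (`]0, T[ : set R) (fun r => hp (W r) b (t + s)).
  move=> s0; apply: measurable_funTS; apply: continuous_measurable_fun.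
  exact: continuous_family_hp gW (addr_gt0 t0 s0).
apply: (@Rintegral_Fubini R `]0, +oo[ `]0, T[ (fun s r => qk s (T - r) * hp (W r) b (t + s))
  (fun s => T / pi * (amp t * M) * (2 * Num.sqrt T) * (Num.sqrt s * (T + s))^-1)).
- by [].
- by [].
- apply: measurable_funM; first exact: measurable_qk_joint.
  apply: (@measurable_shift_joint (fun s r => hp (W r) b (t + s))).
    by move=> r; exact: (measurable_hp_shift b (WX r) t0).
  by move=> s s0; exact: continuous_family_hp gW (addr_gt0 t0 s0).
- by move=> s /in0 s0; exact: (intble_qk_time s0 (mW s s0) (bnd s s0)).1.
- move=> s /in0 s0; have [_ /(_ T0)] := intble_qk_time s0 (mW s s0) (bnd s s0).
  by rewrite -!mulrA [X in T * (_ * X)]mulrC -!mulrA.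
- exact: (intbleZ _ m0 ic).
Qed.

End volterra.

(** * Solving the coupled Volterra equations *)

Section volterra_solution.
Context {R : realType}.
Notation mu := (@lebesgue_measure R).
Implicit Types (X : Xspace R) (u v : R -> R) (U W : R -> R -> R) (b s t c r T : R).

Let in0 (s : R) : (`]0, +oo[%classic : set R) s -> 0 < s.
Proof. by rewrite /= in_itv/= andbT. Qed.

Let inT (T s : R) : (`]0, T[%classic : set R) s -> 0 < s < T.
Proof. by rewrite /= in_itv/=. Qed.

Let m0 : measurable (`]0, +oo[%classic : set R).
Proof. by []. Qed.

Let mT (T : R) : measurable (`]0, T[%classic : set R).
Proof. by []. Qed.

Let RintegralBB (D : set R) (f g : R -> R) : measurable D -> mu.-integrable D (EFin \o f) ->
  mu.-integrable D (EFin \o g) ->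
  \int[mu]_(x in D) (f x - g x) = \int[mu]_(x in D) f x - \int[mu]_(x in D) g x.
Proof. by move=> mD i j; apply: RintegralB. Qed.

(** Convolving the equation at heat time [t + s] with [qk s] turns its memory term into a
    convolution with [th s], by [integral_kernel_th]. This eliminates A^(1/2) by integrating over
    time, for each fixed s. *)
Lemma th_conv X U v b t T s : continuous_family X U -> Xmem X v -> 0 < t -> 0 < T -> 0 < s ->
  (forall r, 0 < r -> hp (U r) b (t + s) = hp v b (t + s) -
    (Num.sqrt pi)^-1 * \int[mu]_(x in `]0, r[) ((Num.sqrt (r - x))^-1 * hA (U x) b (t + s))) ->
  \int[mu]_(r in `]0, T[) (th s (T - r) * hA (U r) b (t + s)) =
  Num.sqrt pi * (\int[mu]_(r in `]0, T[) (qk s (T - r) * hp v b (t + s)) -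
    \int[mu]_(r in `]0, T[) (qk s (T - r) * hp (U r) b (t + s))).
Proof.
move=> gU vX t0 T0 s0 hV; have [M M0 bM] := continuous_family_bound gU T0; have [UX _] := gU.
have ts := addr_gt0 t0 s0.
have bG x : 0 < x < T -> `|hA (U x) b (t + s)| <= Ah t * M.
  move=> /andP[x0 xT]; apply: le_trans (hA_le_shift b (UX x) t0 (ltW s0)) _.
  by apply: ler_wpM2l; [exact: Ah_ge0|apply: bM; rewrite !ltW].
have cG := @continuous_family_hA R X U b _ gU ts; have mG (D : set R) : measurable_fun D (fun x => hA (U x) b (t + s)).
  by apply: measurable_funTS; exact: continuous_measurable_fun.
pose h x r := qk s (T - r) * (Num.sqrt (r - x))^-1 * hA (U x) b (t + s).
have inner x : 0 < x < T -> mu.-integrable `]0, T[ (EFin \o h x) /\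
    forall y, \int[mu]_(r in `]0, T[) (qk s (T - r) * (Num.sqrt (r - x))^-1 * y) =
     th s (T - x) * y.
  move=> /andP[x0 xT]; have [i e] := integral_kernel_th s0 (ltW x0) xT.
  have hE y : (fun r => qk s (T - r) * (Num.sqrt (r - x))^-1 * y) =
     (fun r => y * (qk s (T - r) * (Num.sqrt (r - x))^-1)).
    by apply/funext => r; rewrite mulrC.
  split; first by rewrite /h hE; exact: (intbleZ _ (mT T) i).
  by move=> y; rewrite hE (RintegralcM _ (mT T) i) e mulrC.
have [|||x /inT xT|x /inT xT||_ _ FE] := @Rintegral_Fubini R `]0, T[ `]0, T[ h
   (fun=> (Num.sqrt s)^-1 * (Ah t * M)).
- by [].
- by [].
- rewrite /h; apply: measurable_funM; last exact: (measurable_fst_on (mT T) (mT T) (mG _)).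
  apply: measurable_funM; last first.
    apply: measurable_funTS; apply: (measurableT_comp measurable_sqrtVT).
    exact: measurable_funB.
  have m2 : measurable_fun (`]0, T[ : set R) (fun r => qk s (T - r)).
    have c1 (r : R) : 0 < r < T -> `|cst 1 r : R| <= 1 by rewrite /= normr1.
    have [i _] := intble_qk_time s0 (measurable_cst (1 : R)) c1.
    have -> : (fun r => qk s (T - r)) = (fun r => qk s (T - r) * cst 1 r) by apply/funext => r; rewrite /= mulr1.
    exact: intble_meas i.
  exact: (measurable_snd_on (mT T) (mT T) m2).
- by case: (inner x xT).
- have [_ e] := inner x xT; have /andP[x0 xT'] := xT.
  have Tx : 0 < T - x by rewrite subr_gt0.
  apply: (@le_trans _ _ (th s (T - x) * `|hA (U x) b (t + s)|)).
    rewrite -e le_eqVlt; apply/orP; left; apply/eqP; apply: eq_Rintegral => r.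
    rewrite inE => /inT /andP[r0 rT]; have Tr : 0 < T - r by rewrite subr_gt0.
    rewrite /h (normrM (_ * _)); congr (_ * _); apply: ger0_norm.
    by apply: mulr_ge0; [exact: qk_ge0|rewrite invr_ge0 sqrtr_ge0].
  apply: ler_pM; [exact: th_ge0 (ltW Tx)|exact: normr_ge0|exact: th_le_sqrtV|exact: bG].
- apply: (@intble_bdd_itv R T `|(Num.sqrt s)^-1 * (Ah t * M)|) => //.
have E1 : \int[mu]_(r in `]0, T[) (th s (T - r) * hA (U r) b (t + s)) =
    \int[mu]_(x in `]0, T[) \int[mu]_(r in `]0, T[) h x r.
  by apply: eq_Rintegral => x; rewrite inE => /inT xT; rewrite /h (inner x xT).2.
have [P [PE P0]] : exists P : R, P = Num.sqrt pi /\ 0 < P.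
  exists (Num.sqrt pi); split; first exact: erefl.
  by rewrite sqrtr_gt0; exact: pi_gt0.
have E2 r : 0 < r < T -> \int[mu]_(x in `]0, T[) h x r =
    P * (qk s (T - r) * hp v b (t + s) - qk s (T - r) * hp (U r) b (t + s)).
  move=> /andP[r0 rT]; have [ir _] := integral_sqrtV r0.
  have iG : mu.-integrable `]0, r[ (EFin \o (fun x => (Num.sqrt (r - x))^-1 * hA (U x) b (t + s))).
    have ib := intbleZ (Ah t * M) (mT r) ir.
    apply: (le_intble (mT r) _ ib).
      by apply: measurable_funM; [exact: intble_meas ir|exact: mG].
    move=> x /inT /andP[x0 xr]; rewrite normrM (ger0_norm (_ : 0 <= (Num.sqrt (r - x))^-1)); last first.
      by rewrite invr_ge0 sqrtr_ge0.
    rewrite mulrC; apply: ler_wpM2r; first by rewrite invr_ge0 sqrtr_ge0.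
    by apply: bG; rewrite x0 (lt_trans xr rT).
  have sub : `]0, r[ `<=` (`]0, T[%classic : set R).
    by move=> x /inT /andP[x0 xr]; rewrite /= in_itv/= x0 (lt_trans xr rT).
  have z x : (`]0, T[%classic : set R) x -> ~ (`]0, r[%classic : set R) x ->
      (Num.sqrt (r - x))^-1 * hA (U x) b (t + s) = 0.
    move=> /inT /andP[x0 xT]; rewrite /= in_itv/= x0 /= => /negP; rewrite -leNgt -subr_le0 => rx.
    by rewrite (ler0_sqrtr rx) invr0 mul0r.
  (* The memory integral over []0, r[] is extended to []0, T[]; the kernel is 0 beyond [r] by the
     conventions for roots and inverses. *)
  have [iT eT] := Rintegral_zero_ext (mT T) (mT r) sub z iG.
  have := hV r r0; rewrite -PE -eT => hVr.
  transitivity (qk s (T - r) * \int[mu]_(x in `]0, T[) ((Num.sqrt (r - x))^-1 * hA (U x) b (t + s))).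
    rewrite -(RintegralcM _ (mT T) iT); apply: eq_Rintegral => x _; exact: esym (mulrA _ _ _).
  exact: Volterra_algebra (lt0r_neq0 P0) hVr.
have bv r : 0 < r < T -> `|hp v b (t + s)| <= amp t * nrm X v.
  by move=> _; exact: (hp_le_shift b vX t0 (ltW s0)).
have bU r : 0 < r < T -> `|hp (U r) b (t + s)| <= amp t * M.
  move=> /andP[r0 rT]; apply: le_trans (hp_le_shift b (UX r) t0 (ltW s0)) _.
  by apply: ler_wpM2l; [exact: ltW (amp_gt0 t)|apply: bM; rewrite !ltW].
have mU : measurable_fun (`]0, T[ : set R) (fun r => hp (U r) b (t + s)).
  apply: measurable_funTS; apply: continuous_measurable_fun.
  exact: continuous_family_hp gU ts.
have [iv _] := intble_qk_time s0 (measurable_cst (hp v b (t + s))) bv.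
have [iU _] := intble_qk_time s0 mU bU.
rewrite E1 FE -PE.
transitivity (P * \int[mu]_(r in `]0, T[)
    (qk s (T - r) * hp v b (t + s) - qk s (T - r) * hp (U r) b (t + s))).
  rewrite -(RintegralcM _ (mT T) (intbleB (mT T) iv iU)).
  by apply: eq_Rintegral => r; rewrite inE => /inT; exact: E2.
exact: (f_equal (fun y => P * y) (RintegralBB (mT T) iv iU)).
Qed.

Definition volterra_family X U v b : Prop := forall t T, 0 < t -> 0 < T ->
  hp (U T) b t = hp v b t -
    (Num.sqrt pi)^-1 * \int[mu]_(x in `]0, T[) ((Num.sqrt (T - x))^-1 * hA (U x) b t).

Definition Qk v b t T : R := \int[mu]_(s in `]0, +oo[) (qk s T * hp v b (t + s)).

(** The majorant is a multiple of [th s T]: [th] increases in time, and its integral over s is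
    finite by [integral_sqrtV_diff]. *)
Lemma th_hA_swap X U b t T : continuous_family X U -> 0 < t -> 0 < T ->
  \int[mu]_(s in `]0, +oo[) \int[mu]_(r in `]0, T[) (th s (T - r) * hA (U r) b (t + s)) =
  \int[mu]_(r in `]0, T[) \int[mu]_(s in `]0, +oo[) (th s (T - r) * hA (U r) b (t + s)).
Proof.
move=> gU t0 T0; have [M M0 bM] := continuous_family_bound gU T0; have [UX _] := gU.
have bG s r : 0 < s -> 0 < r < T ->
    `|th s (T - r) * hA (U r) b (t + s)| <= th s T * (Ah t * M).
  move=> s0 /andP[r0 rT]; have Tr : 0 <= T - r by rewrite subr_ge0 ltW.
  rewrite normrM (ger0_norm (th_ge0 s0 Tr)); apply: ler_pM.
  - exact: th_ge0.
  - exact: normr_ge0.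
  - by apply: th_le => //; rewrite gerBl ltW.
  - apply: le_trans (hA_le_shift b (UX r) t0 (ltW s0)) _.
    by apply: ler_wpM2l; [exact: Ah_ge0|apply: bM; rewrite !ltW].
have mthT s : measurable_fun (`]0, T[ : set R) (fun r => th s (T - r)).
  apply: measurable_funTS; apply: measurable_funB; first exact: measurable_cst.
  apply: (measurableT_comp measurable_sqrtVT); apply: measurable_funD => //.
  exact: measurable_funB.
have mh s : 0 < s -> measurable_fun (`]0, T[ : set R) (fun r => th s (T - r) * hA (U r) b (t + s)).
  move=> s0; apply: measurable_funM; first exact: mthT.
  apply: measurable_funTS; apply: continuous_measurable_fun.
  exact: continuous_family_hA gU (addr_gt0 t0 s0).
have [ith _] := integral_sqrtV_diff T0.
have [|||s /in0 s0|s /in0 s0||_ _ ->//] := @Rintegral_Fubini R `]0, +oo[ `]0, T[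
  (fun s r => th s (T - r) * hA (U r) b (t + s)) (fun s => Ah t * M * T * th s T).
- by [].
- by [].
- apply: measurable_funM; last first.
    apply: (@measurable_shift_joint R (fun s r => hA (U r) b (t + s))).
      by move=> r; exact: (measurable_hA_shift b (UX r) t0).
    by move=> s s0; exact: continuous_family_hA gU (addr_gt0 t0 s0).
  apply: measurable_funTS; apply: measurable_funB.
    exact: (measurableT_comp measurable_sqrtVT).
  apply: (measurableT_comp measurable_sqrtVT); apply: measurable_funD => //.
  exact: measurable_funB.
- exact: (intble_bdd_itv (mh s s0) (fun r => bG s r s0)).
- have ic : mu.-integrable `]0, T[ (EFin \o (fun=> th s T * (Ah t * M))).
    apply: (@intble_bdd_itv R T `|th s T * (Ah t * M)|) => //.
  apply: (@le_trans _ _ (\int[mu]_(r in `]0, T[) (th s T * (Ah t * M)))).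
    apply: le_trans (ler_norm _) _; apply: (Rintegral_le_norm (mT T) _ ic).
      exact: measurableT_comp (mh s s0).
    by move=> r /inT rT; rewrite normr_id; exact: bG.
  rewrite Rintegral_cst//= lebesgue_measure_itv/= lte_fin T0 -EFinB subr0 /=.
  move: (th s T) (Ah t) => y1 y2; rewrite le_eqVlt; apply/orP; left; apply/eqP.
  by clear; ring.
- exact: (intbleZ _ m0 ith).
Qed.

Let subI_scaled (p x y a c d f : R) : p != 0 -> x = p * (a - c) -> y = p * (f - d) ->
  x = y -> c = d -> a = f.
Proof. by move=> p0 -> -> /(mulfI p0) e cd; rewrite cd in e; exact: addIr e. Qed.

(** One double integral evaluated twice: [th_conv] in the order s outside, [integral_th_hA] in the
    order r outside. Both values contain minus the double integral of
    [qk s (T - r) * hp (U r) b (t + s)], which is therefore removed; the identity that survives is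
    integrated in time. *)
Lemma volterra_integral X U v b t T : continuous_family X U -> Xmem X v ->
  volterra_family X U v b -> 0 < t -> 0 < T ->
  \int[mu]_(s in `]0, T[) hp (U s) b t = \int[mu]_(s in `]0, T[) Qk v b t (T - s).
Proof.
move=> gU vX hV t0 T0; have [UX _] := gU.
have sw := th_hA_swap b gU t0 T0.
have [iv1 iv2 ev] := qk_hp_swap b (continuous_family_cst vX) t0 T0.
have [iU1 iU2 eU] := qk_hp_swap b gU t0 T0.
have iF : mu.-integrable `]0, T[ (EFin \o (fun s => hp (U s) b t)).
  have [M M0 bM] := continuous_family_bound gU T0.
  apply: (@intble_bdd_itv R T (amp t * M)).
    by apply: measurable_funTS; apply: continuous_measurable_fun; exact: continuous_family_hp gU t0.
  move=> s /andP[s0 sT]; apply: le_trans (hp_le b (UX s) t0) _.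
  by apply: ler_wpM2l; [exact: ltW (amp_gt0 t)|apply: bM; rewrite !ltW].
have [P [PE P0]] : exists P : R, P = Num.sqrt pi /\ 0 < P.
  exists (Num.sqrt pi); split; first exact: erefl.
  by rewrite sqrtr_gt0; exact: pi_gt0.
have L : \int[mu]_(s in `]0, +oo[) \int[mu]_(r in `]0, T[) (th s (T - r) * hA (U r) b (t + s)) =
    P * (\int[mu]_(s in `]0, +oo[) \int[mu]_(r in `]0, T[) (qk s (T - r) * hp v b (t + s)) -
     \int[mu]_(s in `]0, +oo[) \int[mu]_(r in `]0, T[) (qk s (T - r) * hp (U r) b (t + s))).
  transitivity (P * \int[mu]_(s in `]0, +oo[) (\int[mu]_(r in `]0, T[) (qk s (T - r) * hp v b (t + s)) -
     \int[mu]_(r in `]0, T[) (qk s (T - r) * hp (U r) b (t + s)))).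
    rewrite -(RintegralcM _ m0 (intbleB m0 iv1 iU1)); apply: eq_Rintegral => s.
    rewrite inE => /in0 s0; rewrite PE; apply: (th_conv gU vX t0 T0 s0) => r r0.
    exact: hV (addr_gt0 t0 s0) r0.
  exact: (f_equal (fun y => P * y) (RintegralBB m0 iv1 iU1)).
have Rr : \int[mu]_(r in `]0, T[) \int[mu]_(s in `]0, +oo[) (th s (T - r) * hA (U r) b (t + s)) =
    P * (\int[mu]_(s in `]0, T[) hp (U s) b t -
     \int[mu]_(r in `]0, T[) \int[mu]_(s in `]0, +oo[) (qk s (T - r) * hp (U r) b (t + s))).
  transitivity (P * \int[mu]_(r in `]0, T[) (hp (U r) b t -
      \int[mu]_(s in `]0, +oo[) (qk s (T - r) * hp (U r) b (t + s)))).
    rewrite -(RintegralcM _ (mT T) (intbleB (mT T) iF iU2)); apply: eq_Rintegral => r.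
    rewrite inE => /inT /andP[r0 rT]; have Tr : 0 < T - r by rewrite subr_gt0.
    by rewrite PE; exact: (integral_th_hA b (UX r) t0 Tr).
  exact: (f_equal (fun y => P * y) (RintegralBB (mT T) iF iU2)).
have e := subI_scaled (lt0r_neq0 P0) L Rr sw eU.
rewrite -e ev; apply: eq_Rintegral => r _; exact: erefl.
Qed.

Lemma Qk_le v X b t T : Xmem X v -> 0 < t -> 0 < T -> `|Qk v b t T| <= amp t * nrm X v.
Proof.
move=> vX t0 T0; have [i e] := intble_qk T0.
have ib := intbleZ (amp t * nrm X v) m0 i.
apply: (@le_trans _ _ (\int[mu]_(s in `]0, +oo[) (amp t * nrm X v * qk s T))); last first.
  by rewrite (RintegralcM _ m0 i) e mulr1.
apply: (Rintegral_le_norm m0 _ ib); first exact: intble_meas (intble_qk_hp b vX t0 T0).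
move=> s /in0 s0; rewrite normrM (ger0_norm (qk_ge0 s0 T0)) mulrC.
apply: ler_wpM2r; first exact: qk_ge0.
exact: (hp_le_shift b vX t0 (ltW s0)).
Qed.

Lemma continuous_qk_time s c : 0 < s -> 0 < c -> {for c, continuous (qk s)}.
Proof.
move=> s0 c0.
have c1 : Num.sqrt c' @[c' --> c] --> Num.sqrt c by apply: sqrt_cvg; exact: cvg_id.
have c2 : (Num.sqrt s * (s + c'))^-1 @[c' --> c] --> (Num.sqrt s * (s + c))^-1.
  apply: cvgV; last by apply: cvgMr; apply: cvgD; [exact: cvg_cst|exact: cvg_id].
  by apply: mulf_neq0; apply: lt0r_neq0; [rewrite sqrtr_gt0|exact: addr_gt0].
have -> : qk s = (fun c => Num.sqrt c * (pi^-1 * (Num.sqrt s * (s + c))^-1)).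
  by apply/funext => x; rewrite /qk invfM.
by apply: cvgM => //; apply: cvgMr.
Qed.

(** The numerator is taken at the larger time and the denominator at the smaller one; the factor 2
    is [sqrt (2 c) / sqrt (c / 2)]. *)
Lemma qk_le_local s c c' : 0 < s -> 0 < c -> c / 2 < c' -> c' < 2 * c ->
  0 <= qk s c' <= 2 * qk s (c / 2).
Proof.
move=> s0 c0 c1 c2; have c20 : 0 < c / 2 by lra.
have c'0 : 0 < c' by lra.
have ss : 0 < Num.sqrt s by rewrite sqrtr_gt0.
have e : Num.sqrt (2 * c) = 2 * Num.sqrt (c / 2).
  rewrite (_ : 2 * c = 2 ^+ 2 * (c / 2)); last by field.
  by rewrite sqrtrM ?exprn_ge0// sqrtr_sqr ger0_norm.
rewrite (qk_ge0 s0 c'0) /= /qk [leRHS]mulrA -e; apply: ler_pM.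
- exact: sqrtr_ge0.
- by rewrite invr_ge0; apply: mulr_ge0; [exact: pi_ge0|apply: mulr_ge0; apply: ltW => //; exact: addr_gt0].
- by apply: ler_wsqrtr; exact: ltW.
- rewrite lef_pV2 ?posrE; last 2 first.
    by apply: mulr_gt0; [exact: pi_gt0|apply: mulr_gt0 => //; exact: addr_gt0].
    by apply: mulr_gt0; [exact: pi_gt0|apply: mulr_gt0 => //; exact: addr_gt0].
  apply: ler_wpM2l; first exact: pi_ge0.
  by apply: ler_wpM2l; [exact: ltW|rewrite lerD2l ltW].
Qed.

Lemma continuous_Qk v X b t T : Xmem X v -> 0 < t -> 0 < T -> {for T, continuous (Qk v b t)}.
Proof.
move=> vX t0 T0; have T20 : 0 < T / 2 by lra.
have [i e] := intble_qk T20.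
have ib := intbleZ (amp t * nrm X v * 2) m0 i.
have := @continuity_under_integral R _ _ mu (fun T s => qk s T * hp v b (t + s))
    `]0, +oo[ m0 (T / 2) (2 * T) _ _ _ ib _ T.
apply.
- by move=> T'; rewrite /= in_itv/= => /andP[T1 _]; apply: (intble_qk_hp b vX t0); exact: lt_trans T1.
- apply: aeW => s /in0 s0 T'; rewrite inE/= in_itv/= => /andP[T1 _].
  by apply: cvgMl; apply: continuous_qk_time => //; exact: lt_trans T1.
- move=> T'; rewrite /= in_itv/= => /andP[T1 T2]; apply: aeW => s /in0 s0.
  have /andP[q0 qle] := qk_le_local s0 T0 T1 T2.
  rewrite normrM (ger0_norm q0) -mulrA mulrC; apply: ler_pM => //.
  exact: (hp_le_shift b vX t0 (ltW s0)).
- by rewrite inE/= in_itv/=; lra.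
Qed.

(** Differentiation of equal primitives at the continuity point [T]; it undoes the time integration
    of [volterra_integral]. *)
Lemma eq_of_integrals (f g : R -> R) T : 0 < T ->
  (forall x, 0 < x -> {for x, continuous f}) -> (forall x, 0 < x -> {for x, continuous g}) ->
  (forall x, 0 < x -> mu.-integrable `]0, x[ (EFin \o f)) ->
  (forall x, 0 < x -> mu.-integrable `]0, x[ (EFin \o g)) ->
  (forall x, 0 < x -> \int[mu]_(y in `]0, x[) f y = \int[mu]_(y in `]0, x[) g y) ->
  f T = g T.
Proof.
move=> T0 cf cg jf jg E; have T1 : T < T + 1 by rewrite ltrDl.
have T10 : 0 < T + 1 by rewrite addr_gt0.
have jc (h : R -> R) (x : R) : mu.-integrable `]0, x[ (EFin \o h) ->
    mu.-integrable `]0, x] (EFin \o h).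
  move=> i; apply/integrableP; split.
    by apply/measurable_EFinP/measurable_fun_itv_bndo_bndcP; exact: intble_meas i.
  rewrite -integral_itv_bndo_bndc; first by case/integrableP: i.
  exact: measurableT_comp (measurable_int _ i).
have lt0 : ((BRight 0 : itv_bound R) < BRight T)%O by rewrite bnd_simp.
have [_ df] := continuous_FTC1 T1 (jc f _ (jf _ T10)) lt0 (cf T T0).
have [_ dg] := continuous_FTC1 T1 (jc g _ (jg _ T10)) lt0 (cg T T0).
rewrite -df -dg; congr (derive1 _ T); apply/funext => x.
have [x0|x0] := ltP 0 x; last first.
  have -> : [set` Interval (BRight 0) (BRight x)] = set0 by rewrite set_itv_ge// bnd_simp -leNgt.
  by rewrite /Rintegral !integral_set0.
by rewrite -!Rintegral_itv_bndo_bndc ?E//; [exact: jg|exact: jf].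
Qed.

Lemma volterra_solution X U v b t T : continuous_family X U -> Xmem X v ->
  volterra_family X U v b -> 0 < t -> 0 < T -> hp (U T) b t = Qk v b t T.
Proof.
move=> gU vX hV t0 T0; have [UX _] := gU.
have iQ x : 0 < x -> mu.-integrable `]0, x[ (EFin \o Qk v b t).
  move=> x0; apply: (@intble_bdd_itv R x (amp t * nrm X v)).
    apply: open_continuous_measurable_fun => // s; rewrite inE => /inT /andP[s0 _].
    exact: continuous_Qk vX t0 s0.
  by move=> s /andP[s0 _]; exact: Qk_le.
apply: (@eq_of_integrals (fun s => hp (U s) b t) (Qk v b t) T T0).
- by move=> x _; exact: continuous_family_hp gU t0 x.
- by move=> x; exact: continuous_Qk vX t0.
- move=> x x0; have [M M0 bM] := continuous_family_bound gU x0.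
  apply: (@intble_bdd_itv R x (amp t * M)).
    by apply: measurable_funTS; apply: continuous_measurable_fun; exact: continuous_family_hp gU t0.
  move=> s /andP[s0 sT]; apply: le_trans (hp_le b (UX s) t0) _.
  by apply: ler_wpM2l; [exact: ltW (amp_gt0 t)|apply: bM; rewrite !ltW].
- exact: iQ.
- move=> x x0; rewrite (volterra_integral gU vX hV t0 x0).
  have := @Rintegral_affine R x (-1) _ _ (or_intror erefl) (mT x) (iQ x x0); cbv zeta.
  have -> : (fun y => x + -1 * y) @^-1` `]0, x[ = `]0, x[%classic.
    by apply/seteqP; split => y /=; rewrite !in_itv/= mulN1r; lra.
  by move=> [_ <-]; apply: eq_Rintegral => y _; rewrite mulN1r.
Qed.

End volterra_solution.

(** * The solution operator *)

Section solution_operator.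
Context {R : realType}.
Notation mu := (@lebesgue_measure R).
Implicit Types (X : Xspace R) (u v w : R -> R) (S : R -> (R -> R) -> R -> R) (b s t c r T : R).

Let in0 (s : R) : (`]0, +oo[%classic : set R) s -> 0 < s.
Proof. by rewrite /= in_itv/= andbT. Qed.

Let inT (T s : R) : (`]0, T[%classic : set R) s -> 0 < s < T.
Proof. by rewrite /= in_itv/=. Qed.

Let m0 : measurable (`]0, +oo[%classic : set R).
Proof. by []. Qed.

Let mT (T : R) : measurable (`]0, T[%classic : set R).
Proof. by []. Qed.

(* A solution operator lives on times [t >= 0]; the even extension [S `|s|]
   gives a norm-continuous family on the whole line. *)
Lemma solution_continuous_family X S v : is_solution_operator X S -> Xmem X v ->
  continuous_family X (fun s => S `|s| v).
Proof.
move=> [hS1 hS2 _ _ _] vX; split=> [s|s0].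
  by have [h _ _] := hS1 _ (normr_ge0 s); exact: h.
apply: fine_cvg.
have c := hS2 v vX _ (normr_ge0 s0).
have cn : `|s| @[s --> s0] --> within [set t : R | 0 <= t] (nbhs `|s0|).
  move=> A /= wA; have cN : `|s| @[s --> s0] --> `|s0| by apply: cvg_norm; exact: cvg_id.
  have H : nbhs s0 [set s | 0 <= `|s| -> A `|s|] := cN _ wA.
  by apply: (@filterS _ (nbhs s0) _ _ _ _ H) => s /=; apply; exact: normr_ge0.
exact: (cvg_comp (fun s : R => `|s|) (fun t => Xnorm X (S t v \- S `|s0| v)) cn c).
Qed.

(** The function [g] in the integral equation is an arbitrary choice of representatives of A^(1/2)
    S(s) v. Its pairing depends only on S(s) v, through [Ahalf_hp]; this gives the measurability in
    s required by [Bochner_hp]. *)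
Lemma solution_volterra X S v w b : is_solution_operator X S -> is_Ahalf X v w ->
  volterra_family X (fun s => S `|s| v) v b.
Proof.
move=> hS vw t T t0 T0; have [vX _ _] := vw.
have gU := solution_continuous_family hS vX; have [UX _] := gU.
have [hS1 _ _ _ hS5] := hS; have [g [I [hg hB hE]]] := hS5 T v w (ltW T0) vw.
have IX : Xmem X I by case: hB => _ [].
rewrite /= (ger0_norm (ltW T0)).
have SX : Xmem X (S T v) by have [h _ _] := hS1 _ (ltW T0); exact: h.
have rE : (fun x => v x - (Gamma 2^-1)^-1 * I x) = (fun x => - (Gamma 2^-1)^-1 * I x + v x).
  by apply/funext => x; rewrite addrC mulNr.
rewrite rE in hE; rewrite (hp_eq b SX (Xmem_lin _ IX vX) hE t0) (hp_lin b _ IX vX t0).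
have fE s : 0 < s < T -> hp (fun x => (T - s) `^ (- 2^-1) * g s x) b t =
    (Num.sqrt (T - s))^-1 * hA (S `|s| v) b t.
  move=> /andP[s0 sT]; have Ts : 0 < T - s by rewrite subr_gt0.
  have gs := hg s (ltW s0); have [_ gX _] := gs.
  by rewrite (hp_scale b _ gX t0) (powRN_half Ts) (Ahalf_hp b gs t0) (ger0_norm (ltW s0)).
have mF : measurable_fun (`]0, T[ : set R)
    (fun s => hp (fun x => (T - s) `^ (- 2^-1) * g s x) b t).
  apply: (eq_measurable_fun (fun s => (Num.sqrt (T - s))^-1 * hA (S `|s| v) b t)).
    by move=> s; rewrite inE => /inT sT; rewrite fE.
  apply: measurable_funTS; apply: measurable_funM.
    by apply: (measurableT_comp measurable_sqrtVT); exact: measurable_funB.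
  apply: continuous_measurable_fun; exact: (@continuous_family_hA R X (fun s => S `|s| v) b t gU t0).
have [_ eI] := Bochner_hp (mT T) t0 hB mF.
rewrite -eI Gamma_half addrC mulNr; congr (_ - _ * _).
by apply: eq_Rintegral => s; rewrite inE => /inT; exact: fE.
Qed.

Let normrM_ge0r (x y : R) : 0 <= y -> `|x * y| = `|x| * y.
Proof. by move=> y0; rewrite normrM (ger0_norm y0). Qed.

Lemma hkN t y : hk t (- y) = hk t y :> R.
Proof. by rewrite /hk sqrrN. Qed.

Lemma solution_hk X S e b t T : is_solution_operator X S -> 0 < e -> 0 < t -> 0 < T ->
  hp (S T (hk e)) b t = \int[mu]_(s in `]0, +oo[) (qk s T * hk (e + t + s) b).
Proof.
move=> hS e0 t0 T0; have [w vw] := Ahalf_hk X e0; have [vX _ _] := vw.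
have := volterra_solution (solution_continuous_family hS vX) vX (solution_volterra b hS vw) t0 T0.
rewrite /= (ger0_norm (ltW T0)) => ->; apply: eq_Rintegral => s; rewrite inE => /in0 s0.
congr (_ * _); rewrite /hp; have ts := addr_gt0 t0 s0.
transitivity (\int[mu]_y (hk (t + s) (y - b) * hk e (y - 0))).
  by apply: eq_Rintegral => y _; rewrite subr0.
by rewrite (hk_semigroup _ _ ts e0) subr0 addrC addrA.
Qed.

(** A Gaussian is dominated by one of twice the time around any other centre: with [a = b - x] and
    [c = y - b], the exponents differ by [(a - c)^2 / (8 t)]. *)
Lemma hk_le_shift t b x y : 0 < t ->
  hk t (y - b) <= Num.sqrt 2 * expR ((b - x) ^+ 2 / (4 * t)) * hk (2 * t) (x - y).
Proof.
move=> t0; have t2 : 0 < 2 * t by lra.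
have st : 0 < Num.sqrt (4 * pi * t) by rewrite sqrtr_gt0 !mulr_gt0 ?pi_gt0.
have -> : Num.sqrt 2 * expR ((b - x) ^+ 2 / (4 * t)) * hk (2 * t) (x - y) =
   (Num.sqrt (4 * pi * t))^-1 * expR ((b - x) ^+ 2 / (4 * t) - (x - y) ^+ 2 / (4 * (2 * t))).
  rewrite expRD /hk.
  have -> : 4 * pi * (2 * t) = 2 * (4 * pi * t) by move: (pi : R) => P; ring.
  rewrite (sqrtrM _ (_ : 0 <= 2))// invfM.
  have s2 : Num.sqrt 2 != 0 :> R by rewrite gt_eqF// sqrtr_gt0.
  by move: (expR _) (expR (- _)) s2 => y1 y2 s2; field; rewrite s2 gt_eqF.
rewrite ler_wpM2l ?invr_ge0 ?sqrtr_ge0// ler_expR -subr_ge0.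
have -> : (b - x) ^+ 2 / (4 * t) - (x - y) ^+ 2 / (4 * (2 * t)) - - ((y - b) ^+ 2 / (4 * t)) =
   ((b - x) - (y - b)) ^+ 2 / (8 * t) by field; lra.
by rewrite divr_ge0 ?sqr_ge0// mulr_ge0// ltW.
Qed.

(** * Integrals of the convolution kernel against Gaussians *)

Section kernel.
Context (X : Xspace R) (S : R -> (R -> R) -> R -> R) (G : R -> R) (T : R).
Context (hS : is_solution_operator X S) (T0 : 0 < T).
Context (hG : forall v, Xmem X v -> Xforall X (fun x =>
  mu.-integrable [set: R] (fun y : R => (G y * v (x - y))%:E) /\
  S T v x = \int[mu]_y (G y * v (x - y)))).

Lemma Xmem_hk e : 0 < e -> Xmem X (hk e).
Proof. by move=> e0; have [w [? _ _]] := Ahalf_hk X e0. Qed.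

(** The convolution hypothesis may hold only almost everywhere, so it is used at a single centre
    [x], with the wider kernel of time [2 * d]; [hk_le_shift] then reaches every centre [b]. *)
Lemma kernel_intble d b : 0 < d -> mu.-integrable setT (EFin \o (fun y => G y * hk d (y - b))).
Proof.
move=> d0; have d2 : 0 < 2 * d by lra.
have [x [ix _]] := Xforall_ex (hG (Xmem_hk d2)).
(* Measurability of [G] is recovered by dividing an integrable product by its strictly positive
   Gaussian factor. *)
have mG : measurable_fun setT G.
  have -> : G = (fun y => G y * hk (2 * d) (x - y) * (hk (2 * d) (x - y))^-1).
    by apply/funext => y; rewrite mulfK// lt0r_neq0// hk_gt0.
  apply: measurable_funM; first exact: intble_meas ix.
  have -> : (fun y => (hk (2 * d) (x - y))^-1) = (fun y => (hk (2 * d) (y - x))^-1).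
    by apply/funext => y; rewrite -hkN opprB.
  apply: continuous_measurable_fun => y; apply: cvgV; first by rewrite lt0r_neq0// hk_gt0.
  exact: continuous_hk_shift.
have ixn : mu.-integrable setT (EFin \o (fun y => `|G y * hk (2 * d) (x - y)|)).
  exact: (integrable_norm ix).
have ib := intbleZ (Num.sqrt 2 * expR ((b - x) ^+ 2 / (4 * d))) measurableT ixn.
apply: (le_intble measurableT _ ib).
  by apply: measurable_funM => //; exact: measurable_hk.
move=> y _; rewrite (normrM_ge0r _ (hk_ge0 _ d0)) (normrM_ge0r _ (hk_ge0 _ d2)) [leRHS]mulrCA.
by apply: ler_wpM2l => //; exact: hk_le_shift.
Qed.

(** The time [d] is split into halves: one heat kernel is the initial datum, the other the pairing.
    Fubini and the semigroup law recombine them, and [solution_hk] evaluates the pairing. *)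
Lemma kernel_hk d b : 0 < d ->
  \int[mu]_y (G y * hk d (y - b)) = \int[mu]_(s in `]0, +oo[) (qk s T * hk (d + s) b).
Proof.
move=> d0; have e0 : 0 < d / 2 by lra.
set e := d / 2; have de : d = e + e by rewrite /e; lra.
rewrite {2}de -(solution_hk b hS e0 e0 T0).
have iG := kernel_intble b d0.
have mG : measurable_fun setT G.
  have -> : G = (fun y => G y * hk d (y - b) * (hk d (y - b))^-1).
    by apply/funext => y; rewrite mulfK// lt0r_neq0// hk_gt0.
  apply: measurable_funM; first exact: intble_meas iG.
  apply: continuous_measurable_fun => y; apply: cvgV; first by rewrite lt0r_neq0// hk_gt0.
  exact: continuous_hk_shift.
pose h y x := G y * (hk e (x - b) * hk e (x - y)).
have ihk y : mu.-integrable setT (EFin \o (fun x => hk e (x - b) * hk e (x - y))).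
  have mm : measurable_fun [set: R] (fun x => hk e (x - b) * hk e (x - y)).
    by apply: measurable_funM; exact: measurable_hk.
  apply: (le_intble measurableT mm (intbleZ ((Num.sqrt (4 * pi * e))^-1) measurableT (integrable_hk y e0))).
  move=> x _; rewrite ger0_norm ?mulr_ge0 ?hk_ge0//.
  by rewrite ler_wpM2r ?hk_ge0// hk_le_peak.
have ehk y : \int[mu]_x (hk e (x - b) * hk e (x - y)) = hk d (y - b).
  by rewrite hk_semigroup// -de -hkN opprB.
have ihG y : \int[mu]_x h y x = G y * hk d (y - b).
  by rewrite /h (RintegralcM _ measurableT (ihk y)) ehk.
have [||||||i1 i2 FE] := @Rintegral_Fubini R setT setT h (fun y => `|G y * hk d (y - b)|).
- exact: measurableT.
- exact: measurableT.
- apply: measurable_funTS; rewrite /h; apply: measurable_funM.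
    exact: measurableT_comp mG measurable_fst.
  apply: measurable_funM.
    exact: measurableT_comp (measurable_hk b e0) measurable_snd.
  apply: (@measurableT_comp _ _ _ _ _ _ (hk e) _ (fun z : R * R => z.2 - z.1)).
    exact: continuous_measurable_fun (continuous_hk e0).
  exact: measurable_funB.
- by move=> y _; exact: (intbleZ _ measurableT (ihk y)).
- move=> y _; rewrite le_eqVlt; apply/orP; left; apply/eqP.
  transitivity (\int[mu]_x (`|G y| * (hk e (x - b) * hk e (x - y)))).
    by apply: eq_Rintegral => x _; rewrite /h normrM [X in _ * X]ger0_norm// mulr_ge0 ?hk_ge0.
  by rewrite (RintegralcM _ measurableT (ihk y)) ehk (normrM_ge0r _ (hk_ge0 _ d0)).
- exact: (integrable_norm iG).
transitivity (\int[mu]_y \int[mu]_x h y x).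
  by apply: eq_Rintegral => y _; rewrite ihG.
rewrite FE; have SX : Xmem X (S T (hk e)).
  by have [h1 _ _ _ _] := hS; have [h2 _ _] := h1 _ (ltW T0); apply: h2; exact: Xmem_hk.
apply: Rintegral_ae_eq.
- exact: measurableT.
- exact: intble_meas i2.
- by apply: measurable_funM; [exact: measurable_hk|exact: Xmem_meas SX].
apply: ae_imp (Xforall_ae (hG (Xmem_hk e0))) => x [ix ->] _.
rewrite -(RintegralcM _ measurableT ix); apply: eq_Rintegral => y _.
by rewrite /h mulrCA.
Qed.

End kernel.

End solution_operator.

(** * The Green function *)

Section green_function.
Context {R : realType}.
Notation mu := (@lebesgue_measure R).
Implicit Types (b d r s t x y z T : R) (G : R -> R).

Let in0 (s : R) : (`]0, +oo[%classic : set R) s -> 0 < s.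
Proof. by rewrite /= in_itv/= andbT. Qed.

Let m0 : measurable (`]0, +oo[%classic : set R).
Proof. by []. Qed.

(** Away from its centre the narrow kernel is a small multiple of a fixed Gaussian. For [d <= 1/2]
    the exponents differ by at least [w = r^2 / (8 d)], and [exp (- w) <= 1 / w] gains a factor [d]
    against the normalisation [d^(-1/2)]. *)
Lemma hk_le_off r d z : 0 < d -> d <= 2^-1 -> 0 < r -> r <= `|z| ->
  hk d z <= 8 / r ^+ 2 * Num.sqrt d * hk 1 z.
Proof.
move=> d0 d1 r0 rz; have r2 : r ^+ 2 <= z ^+ 2.
  by rewrite -(real_normK (num_real z)) ler_sqr// nnegrE ltW.
have r20 : 0 < r ^+ 2 by rewrite exprn_gt0.
pose w := r ^+ 2 / (8 * d); have w0 : 0 < w by rewrite divr_gt0// mulr_gt0.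
have wz : z ^+ 2 / (4 * 1) - z ^+ 2 / (4 * d) <= - w.
  rewrite -subr_ge0; have -> : - w - (z ^+ 2 / (4 * 1) - z ^+ 2 / (4 * d)) =
    ((z ^+ 2 - r ^+ 2) + z ^+ 2 * (1 - 2 * d)) / (8 * d) by rewrite /w; field; lra.
  apply: divr_ge0; last lra.
  apply: addr_ge0; first by rewrite subr_ge0.
  by apply: mulr_ge0; [exact: sqr_ge0|lra].
have ew : expR (- w) <= w^-1.
  by rewrite expRN lef_pV2 ?posrE ?expR_gt0//; have := expR_ge1Dx w; lra.
have sd : 0 < Num.sqrt d by rewrite sqrtr_gt0.
have -> : hk d z = hk 1 z * ((Num.sqrt d)^-1 * expR (z ^+ 2 / (4 * 1) - z ^+ 2 / (4 * d))).
  rewrite /hk mulr1 expRD (sqrtrM _ (_ : 0 <= 4 * pi)) ?mulr_ge0 ?pi_ge0// invfM (expRN (z ^+ 2 / (4 * 1))).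
  have e0 : expR (z ^+ 2 / (4 * 1)) != 0 by rewrite gt_eqF ?expR_gt0.
  rewrite mulr1 in e0 *.
  move: (expR (z ^+ 2 / 4)) (expR (- _)) (Num.sqrt _)^-1 (Num.sqrt _)^-1 e0 => a1 a2 a3 a4 e0.
  by field.
rewrite mulrC; apply: ler_wpM2r; first exact: hk_ge0.
apply: le_trans (_ : (Num.sqrt d)^-1 * w^-1 <= _).
  by rewrite ler_wpM2l ?invr_ge0 ?sqrtr_ge0// (le_trans _ ew)// ler_expR.
rewrite /w invf_div -[X in _ * (8 * X / _)](sqr_sqrtr (ltW d0)) le_eqVlt; apply/orP; left; apply/eqP.
by move: (Num.sqrt d) sd => a a0; field; rewrite !gt_eqF.
Qed.

(* The heat kernel is an approximate identity at every continuity point of G,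
   even though G is only integrable against Gaussians. *)
Lemma hk_approx G b :
  (forall d, 0 < d -> mu.-integrable setT (EFin \o (fun y => G y * hk d (y - b)))) ->
  {for b, continuous G} ->
  \int[mu]_y (G y * hk d (y - b)) @[d --> 0^'+] --> G b.
Proof.
move=> iG cG; apply/cvgrPdist_le => e e0.
have e20 : 0 < e / 2 by rewrite divr_gt0.
have [r /= r0 rG] : \forall r \near 0^'+, forall y, `|b - y| < r -> `|G b - G y| <= e / 2.
  have [r /= r0 rG] := (@cvgrPdist_le _ _ _ _ _ _ _).1 cG _ e20.
  exists r => //= r' r'r r'0 y by'; apply: rG; apply: lt_trans by' _.
  by move: r'r; rewrite /ball_/= sub0r normrN gtr0_norm.
have r20 : 0 < r / 2 by rewrite divr_gt0.
have rG' y : `|b - y| < r / 2 -> `|G b - G y| <= e / 2.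
  apply: rG => //; rewrite /ball_/= sub0r normrN gtr0_norm// ltr_pdivrMr//; lra.
have i1 : mu.-integrable setT (EFin \o (fun y => (`|G y| + `|G b|) * hk 1 (y - b))).
  have ia : mu.-integrable setT (EFin \o (fun y => `|G y * hk 1 (y - b)|)).
    exact: integrable_norm (iG 1 ltr01).
  have ib := intbleZ `|G b| measurableT (integrable_hk b (@ltr01 R)).
  have := intbleD measurableT ia ib; apply: eq_integrable => // y _ /=.
  by rewrite normrM (ger0_norm (hk_ge0 _ ltr01)) mulrDl.
set K := \int[mu]_y ((`|G y| + `|G b|) * hk 1 (y - b)).
have cK : 8 / (r / 2) ^+ 2 * Num.sqrt d * K @[d --> 0^'+] --> (0 : R).
  rewrite -[X in _ --> X](mul0r K); apply: cvgMl.
  rewrite -[X in _ --> X](mulr0 (8 / (r / 2) ^+ 2)); apply: cvgMr.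
  rewrite -[X in _ --> X]sqrtr0; apply: cvg_at_right_filter; exact: sqrt_continuous.
near=> d; have d0 : 0 < d by [].
have d1 : d <= 2^-1 by apply: ltW; near: d; exact: nbhs_right_lt.
have idK : 8 / (r / 2) ^+ 2 * Num.sqrt d * K <= e / 2.
  apply: le_trans (ler_norm _) _; rewrite -normrN -sub0r; near: d.
  exact: (@cvgrPdist_le _ _ _ _ _ _ _).1 cK _ e20.
have id := integrable_hk b d0.
have -> : G b - \int[mu]_y (G y * hk d (y - b)) =
    \int[mu]_y (G b * hk d (y - b) - G y * hk d (y - b)).
  rewrite RintegralB//; last 2 first.
    exact: (intbleZ _ measurableT id).
    exact: iG.
  by rewrite (RintegralcM _ measurableT id) integral_hk// mulr1.
have ib := intbleZ (e / 2) measurableT id.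
have ic := intbleZ (8 / (r / 2) ^+ 2 * Num.sqrt d) measurableT i1.
apply: le_trans (Rintegral_le_norm measurableT _ (intbleD measurableT ib ic) _) _.
- exact: (intble_meas (intbleB measurableT (intbleZ (G b) measurableT id) (iG d d0))).
- move=> y _; rewrite -mulrBl normrM (ger0_norm (hk_ge0 _ d0)).
  (* Near [b] continuity makes the oscillation of [G] small; far from [b] the smallness comes from
     the kernel, and the weight [hk 1] keeps the integral finite. *)
  have [yr|yr] := ltP `|b - y| (r / 2).
    apply: ler_wpDr; last by rewrite ler_wpM2r ?hk_ge0// rG'.
    by rewrite !mulr_ge0 ?hk_ge0 ?sqrtr_ge0 ?addr_ge0 ?invr_ge0 ?sqr_ge0.
  apply: ler_wpDl; first by rewrite mulr_ge0 ?hk_ge0// ltW.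
  rewrite [leRHS]mulrCA; apply: ler_pM.
  - exact: normr_ge0.
  - exact: hk_ge0.
  - by rewrite [leRHS]addrC; exact: ler_normB.
  - by apply: hk_le_off => //; rewrite distrC.
rewrite RintegralD//= (RintegralcM _ measurableT id) (RintegralcM _ measurableT i1) integral_hk//.
rewrite -/K mulr1; move: (_ * K) idK => y; lra.
Unshelve. all: by end_near. Qed.

(** With [v = |y| / sqrt (4 pi t)] the claim becomes [v <= exp (pi v^2)]. Uniformity in [t] provides
    a majorant as the Gaussian width tends to 0. *)
Lemma hk_le_dist t y : 0 < t -> y != 0 -> hk t y <= `|y|^-1.
Proof.
move=> t0 y0; have yn : 0 < `|y| by rewrite normr_gt0.
have [P [PE P1]] : exists P : R, P = pi /\ 1 <= P.
  by exists pi; split => //; apply: le_trans (pi_ge2 R); lra.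
have a20 : 0 < 4 * P * t by rewrite !mulr_gt0//; lra.
rewrite /hk -PE.
have -> : y ^+ 2 / (4 * t) = P * (`|y| / Num.sqrt (4 * P * t)) ^+ 2.
  rewrite expr_div_n sqr_sqrtr ?ltW// (real_normK (num_real y)); field; lra.
have : 0 < Num.sqrt (4 * P * t) by rewrite sqrtr_gt0.
move: (Num.sqrt _) => a a0; rewrite expRN.
set v := `|y| / a; have v0 : 0 < v by rewrite divr_gt0.
have -> : a^-1 = v / `|y| by rewrite /v; field; rewrite !gt_eqF.
rewrite mulrAC ler_piMl ?invr_ge0// ler_pdivrMr ?expR_gt0// mul1r.
apply: (le_trans _ (expR_ge1Dx _)).
have h1 : v ^+ 2 <= P * v ^+ 2 by rewrite ler_peMl// sqr_ge0.
have h2 := sqr_ge0 (v - 1); clear PE; move: v h1 h2 {v0} => v h1 h2; nra.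
Qed.

Let qk_hk_algebra (P q a b2 y1 y2 s T : R) : s = a ^+ 2 -> T = q ^+ 2 ->
  0 < P -> 0 < q -> 0 < a -> 0 < b2 -> y1 != 0 ->
  (2 * (P ^+ 2 * P) * q)^-1 * y1 *
    (- (y1^-1 * y2 / (b2 / (4 * T) + b2 / (4 * s))) * - (b2 / (4 * s ^+ 2))) =
  q / (P ^+ 2 * (a * (s + T))) * ((2 * P * a)^-1 * y2).
Proof.
move=> -> -> P0 q0 a0 b0 y10; field.
by rewrite y10 !gt_eqF//= addr_gt0// mulr_gt0// exprn_gt0.
Qed.

Lemma integral_qk_hk T b : 0 < T -> b != 0 ->
  mu.-integrable `]0, +oo[ (EFin \o (fun s => qk s T * hk s b)) /\
  \int[mu]_(s in `]0, +oo[) (qk s T * hk s b) =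
  (2 * (pi * Num.sqrt pi) * Num.sqrt T)^-1 * expR (b ^+ 2 / (4 * T)) * E1 (b ^+ 2 / (4 * T)).
Proof.
move=> T0 b0; have b20 : 0 < b ^+ 2 by rewrite exprn_even_gt0.
set z := b ^+ 2 / (4 * T); have z0 : 0 < z by rewrite divr_gt0// mulr_gt0.
(* The derivative of [E1] at [z + b^2 / (4 s)] contributes [exp (- z)], which the factor [exp z]
   cancels, leaving the exponential of [hk s b]. *)
set C := (2 * (pi * Num.sqrt pi) * Num.sqrt T)^-1 * expR z.
have u0 s : 0 < s -> 0 < z + b ^+ 2 / (4 * s).
  by move=> s0; rewrite addr_gt0// divr_gt0// mulr_gt0.
have dF s : 0 < s -> is_derive s 1 (fun s => C * E1 (z + b ^+ 2 / (4 * s))) (qk s T * hk s b).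
  move=> s0; have du : is_derive s 1 (fun s => z + b ^+ 2 / (4 * s)) (- (b ^+ 2 / (4 * s ^+ 2))).
    by isDeq; [rewrite mulf_neq0// gt_eqF|field; rewrite gt_eqF].
  have dE := @isD_comp _ (@E1 R) _ s _ _ (is_derive_E1 (u0 s s0)) du.
  isDeq; rewrite /C /qk /hk opprD expRD (expRN z) mul0r add0r.
  have [P [PE P0]] : exists P : R, P = Num.sqrt pi /\ 0 < P.
    exists (Num.sqrt pi); split; first exact: erefl.
    by rewrite sqrtr_gt0; exact: pi_gt0.
  have piE : pi = P ^+ 2 by rewrite PE sqr_sqrtr// pi_ge0.
  have s4 : Num.sqrt (4 * pi * s) = 2 * P * Num.sqrt s.
    rewrite piE (_ : 4 * P ^+ 2 * s = (2 * P) ^+ 2 * s); last by ring.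
    by rewrite sqrtrM ?sqr_ge0// sqrtr_sqr ger0_norm// mulr_ge0// ltW.
  rewrite s4 -PE piE; have := lt0r_neq0 (expR_gt0 z); move: (expR z) (expR (- _)) => y1 y2 y10.
  apply: (qk_hk_algebra y2 _ _ P0 _ _ b20 y10).
  - by rewrite sqr_sqrtr// ltW.
  - by rewrite sqr_sqrtr// ltW.
  - by rewrite sqrtr_gt0.
  - by rewrite sqrtr_gt0.
have cf s : 0 < s -> {for s, continuous (fun s => qk s T * hk s b)}.
  move=> s0; apply: cvgM; first exact: continuous_qk.
  exact: isD_continuous (is_derive_hk_time b s0).
have F0 : C * E1 (z + b ^+ 2 / (4 * s)) @[s --> 0^'+] --> 0.
  rewrite -[X in _ --> X](mulr0 C); apply: cvgMr.
  have cu : z + b ^+ 2 / (4 * s) @[s --> 0^'+] --> +oo.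
    apply/cvgryPge => A; near=> s; have s0 : 0 < s by [].
    have sA : s * (4 * (`|A| + 1)) < b ^+ 2.
      rewrite -ltr_pdivlMr ?mulr_gt0 ?ltr_wpDl//; near: s; apply: nbhs_right_lt.
      by rewrite divr_gt0// mulr_gt0// ltr_wpDl.
    apply: ler_wpDl; first exact: ltW.
    rewrite ler_pdivlMr ?mulr_gt0//; apply: le_trans (ltW sA).
    have := ler_norm A; nra.
  exact: (cvg_comp (fun s => z + b ^+ 2 / (4 * s)) (@E1 R) cu cvgy_E1).
have Fy : C * E1 (z + b ^+ 2 / (4 * s)) @[s --> +oo] --> C * E1 z.
  apply: cvgMr.
  have cu : z + b ^+ 2 / (4 * s) @[s --> +oo] --> z.
    rewrite -[X in _ --> X]addr0; apply: cvgD; first exact: cvg_cst.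
    rewrite (_ : (fun s => b ^+ 2 / (4 * s)) = (fun s => b ^+ 2 / 4 * s^-1)); last first.
      by apply/funext => s; rewrite invfM mulrA.
    by rewrite -[X in _ --> X](mulr0 (b ^+ 2 / 4)); apply: cvgMr; exact: cvgV_y.
  have cE : E1 u @[u --> z] --> E1 z := isD_continuous (is_derive_E1 z0).
  exact: (cvg_comp (fun s => z + b ^+ 2 / (4 * s)) (@E1 R) cu cE).
have [|i e] := ftc_oy dF cf F0 Fy.
  by left => s s0; rewrite mulr_ge0 ?qk_ge0 ?hk_ge0.
by split => //; rewrite e subr0.
Unshelve. all: by end_near. Qed.

Section main.
Context (X : Xspace R) (S : R -> (R -> R) -> R -> R) (G : R -> R -> R).
Context (hS : is_solution_operator X S) (hG : is_Green_function X S G).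

Lemma Green_function_E1 b T : b != 0 -> 0 < T ->
  G b T = (2 * (pi * Num.sqrt pi) * Num.sqrt T)^-1 * expR (b ^+ 2 / (4 * T)) * E1 (b ^+ 2 / (4 * T)).
Proof.
move=> b0 T0; have [cG kG] := hG T0; have [i0 <-] := integral_qk_hk T0 b0.
have c1 := hk_approx (fun d => @kernel_intble R X S (G ^~ T) T kG d b) (cG b b0).
have d0 n : 0 < n.+1%:R^-1 :> R by [].
have c2 : \int[mu]_y (G y T * hk n.+1%:R^-1 (y - b)) @[n --> \oo] --> G b T.
  apply: (cvg_comp (fun n => n.+1%:R^-1) _ _ c1).
  apply: (@cvg_within_seq R (fun x => 0 < x)) => //; exact: cvg_harmonic.
(* Dominated convergence with majorant [|b|^-1 * qk s T], from [hk_le_dist]. *)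
have c3 : \int[mu]_(s in `]0, +oo[) (qk s T * hk (n.+1%:R^-1 + s) b) @[n --> \oo] -->
    \int[mu]_(s in `]0, +oo[) (qk s T * hk s b).
  have [iq _] := intble_qk T0.
  apply: (Rintegral_dct m0 _ (intble_meas i0) _ (intbleZ `|b|^-1 m0 iq)).
  - move=> n; apply: open_continuous_measurable_fun => // s; rewrite inE => /in0 s0.
    apply: cvgM; first exact: continuous_qk.
    have ns : 0 < n.+1%:R^-1 + s by rewrite addr_gt0.
    have ca : n.+1%:R^-1 + s' @[s' --> s] --> n.+1%:R^-1 + s.
      by apply: cvgD; [exact: cvg_cst|exact: cvg_id].
    have cb : hk s' b @[s' --> n.+1%:R^-1 + s] --> hk (n.+1%:R^-1 + s) b.
      exact: isD_continuous (is_derive_hk_time b ns).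
    exact: (cvg_comp (fun s' => n.+1%:R^-1 + s') (hk^~ b) ca cb).
  - move=> s /in0 s0; apply: cvgMr.
    have ca : n.+1%:R^-1 + s @[n --> \oo] --> s.
      by rewrite -[X in _ --> X]add0r; apply: cvgD; [exact: cvg_harmonic|exact: cvg_cst].
    have cb : hk s' b @[s' --> s] --> hk s b.
      exact: isD_continuous (is_derive_hk_time b s0).
    exact: (cvg_comp (fun n => n.+1%:R^-1 + s) (hk^~ b) ca cb).
  - move=> n s /in0 s0; have ns : 0 < n.+1%:R^-1 + s by rewrite addr_gt0.
    rewrite (ger0_norm (mulr_ge0 (qk_ge0 s0 T0) (hk_ge0 b ns))) mulrC.
    by apply: ler_wpM2r; [exact: qk_ge0|exact: hk_le_dist].
have E : (fun n => \int[mu]_(s in `]0, +oo[) (qk s T * hk (n.+1%:R^-1 + s) b)) =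
    (fun n => \int[mu]_y (G y T * hk n.+1%:R^-1 (y - b))).
  by apply/funext => n; exact: esym (kernel_hk hS T0 kG b (d0 n)).
rewrite E in c3; exact: (cvg_unique (@Rhausdorff R) c2 c3).
Qed.

End main.

Lemma pi_powR32 : pi `^ (3 / 2) = pi * Num.sqrt pi :> R.
Proof.
rewrite (_ : 3 / 2 = 1 + 2^-1); last by field.
rewrite powRD; last by apply/implyP => _; rewrite gt_eqF// pi_gt0.
by rewrite powRr1 ?powR12_sqrt// pi_ge0.
Qed.

Lemma similarity_cvg (F : set_system R) {FF : Filter F} (f : R * R -> R) (g : R -> R) (l : R) :
  (forall x t, x != 0 -> 0 < t -> f (x, t) = g (x ^+ 2 / (4 * t))) ->
  g z @[z --> F] --> l -> f q @[q --> similarity_filter F] --> l.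
Proof.
move=> fg gl A Al; have H : F [set z | A (g z)] := gl A Al.
change (F [set z | forall x t, x != 0 -> 0 < t -> x ^+ 2 / (4 * t) = z -> A (f (x, t))]).
by apply: (filterS _ H) => z Az x t x0 t0 xz; rewrite fg// xz.
Qed.

End green_function.

Theorem mainTheorem6 (R : realType) (X : Xspace R)
    (S : R -> (R -> R) -> R -> R) (G : R -> R -> R)
    (hS : is_solution_operator X S) (hG : is_Green_function X S G) :
  [/\ forall x t : R, x != 0 -> 0 < t ->
        G x t = (2 * pi `^ (3 / 2) * Num.sqrt t)^-1
                * expR (x ^+ 2 / (4 * t)) * E1 (x ^+ 2 / (4 * t)),
      asymp_equiv (similarity_filter +oo) G
        (fun x t => 2 * Num.sqrt t / (pi `^ (3 / 2) * x ^+ 2)),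
      asymp_equiv (similarity_filter 0^'+) G
        (fun x t => (ln (4 * t) - ln (x ^+ 2))
                    / (2 * pi `^ (3 / 2) * Num.sqrt t))
    & forall x t : R, x != 0 -> 0 < t ->
        (4 * pi `^ (3 / 2) * Num.sqrt t)^-1 * ln (1 + 8 * t / x ^+ 2) < G x t /\
        G x t < (2 * pi `^ (3 / 2) * Num.sqrt t)^-1 * ln (1 + 4 * t / x ^+ 2)].
Proof.
have [P [PE P0]] : exists P : R, P = pi `^ (3 / 2) /\ 0 < P.
  by exists (pi `^ (3 / 2)); split; [exact: erefl|rewrite powR_gt0// pi_gt0].
have GE x t : x != 0 -> 0 < t -> G x t = (2 * P * Num.sqrt t)^-1
    * expR (x ^+ 2 / (4 * t)) * E1 (x ^+ 2 / (4 * t)).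
  by move=> x0 t0; rewrite PE pi_powR32; exact: (Green_function_E1 hS hG x0 t0).
have xx (x : R) : x != 0 -> 0 < x ^+ 2 by move=> x0; rewrite exprn_even_gt0.
rewrite -PE; split.
- exact: GE.
(* The quotient is exactly [z * (exp z * E1 z)] with [z = x^2 / (4 t)], so the limit in two
   variables reduces to one in [z]. *)
- apply: similarity_cvg E1_asymp_y => x t x0 t0; rewrite /= GE//.
  have := xx x x0; have : 0 < Num.sqrt t by rewrite sqrtr_gt0.
  set z := x ^+ 2 / (4 * t).
  move: (expR z) (E1 z) => y1 y2; rewrite /z -[X in 4 * X](sqr_sqrtr (ltW t0)).
  move: (x ^+ 2) (Num.sqrt t) => x2 a a0 x20.
  by field; rewrite !gt_eqF.
(* Here the difference of logarithms is [- ln z], and the quotient is [exp z * E1 z / (- ln z)]. *)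
- apply: similarity_cvg E1_asymp_0 => x t x0 t0; rewrite /= GE//.
  have x20 := xx x x0; have t40 : 0 < 4 * t by rewrite mulr_gt0.
  rewrite ln_div ?posrE// opprB.
  have : 0 < Num.sqrt t by rewrite sqrtr_gt0.
  move: (expR _) (E1 _) (ln _ - ln _) (Num.sqrt t) => y1 y2 y3 a a0.
  rewrite invf_div; move: (y3^-1) => y4.
  by field; rewrite !gt_eqF.
- move=> x t x0 t0; rewrite GE//; have x20 := xx x x0.
  set z := x ^+ 2 / (4 * t); have z0 : 0 < z by rewrite divr_gt0// mulr_gt0.
  have -> : 8 * t / x ^+ 2 = 2 / z by rewrite /z; field; rewrite ?x0 ?(gt_eqF t0).
  have -> : 4 * t / x ^+ 2 = z^-1 by rewrite /z invf_div.
  have a0 : 0 < Num.sqrt t by rewrite sqrtr_gt0.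
  have h1 := E1_gt z0; have h2 := E1_lt z0.
  have c0 : 0 < (2 * P * Num.sqrt t)^-1 by rewrite invr_gt0 !mulr_gt0.
  rewrite -(ltr_pM2l (expR_gt0 z)) expRN_mulK in h1.
  rewrite -(ltr_pM2l (expR_gt0 z)) expRN_mulK in h2.
  rewrite -[_ * expR z * _]mulrA; split; last by rewrite ltr_pM2l.
  have -> : (4 * P * Num.sqrt t)^-1 * ln (1 + 2 / z) =
      (2 * P * Num.sqrt t)^-1 * (2^-1 * ln (1 + 2 / z)) by field; rewrite !gt_eqF.
  by rewrite ltr_pM2l.
Qed.
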